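(* Let $G=(\Lambda,E)$ be a finite connected undirected graph without self-loops and let $0\le l\le r$. Endow the subdivided graph $G_r=(\Lambda_r,E_r)$ with i.i.d. edge weights $W_e>0$, $e\in E_r$, and let $W^{(m)}=(W^{(m)}_e)_{e\in E_m}$, $0\le m\le r$, be the corresponding effective weights, all on one probability space with expectation $\mathbb{E}$. Let $C_\alpha:=2^{-\alpha}\Gamma(\frac12-\alpha)/\sqrt\pi$ for $0\le\alpha<\frac12$ and $c_2:=\gamma+\log2$, where $\gamma=-\int_0^\infty e^{-t}\log t\,dt$ is the Euler–Mascheroni constant. Then for all $\bar e\in E_l$ and $e'\in E_r$: $$\mathbb{E}[(W^{(l)}_{\bar e})^\alpha]\le (2^{-\alpha})^{r-l}\mathbb{E}[W_{e'}^\alpha]\quad\text{for }\alpha\in[0,1],$$ $$\mathbb{E}[(W^{(l)}_{\bar e})^\alpha]\le \frac1{C_\alpha}\min_{m\in\{l,\ldots,r\}}\Big(C_\alpha(2^{-\alpha})^{r-m}\mathbb{E}[W_{e'}^\alpha]\Big)^{2^{m-l}}\quad\text{for }\alpha\in[0,\tfrac12),$$ $$\mathbb{E}[\log W^{(l)}_{\bar e}]\le \min_{m\in\{l,\ldots,r\}}2^{m-l}\big(\mathbb{E}[\log W_{e'}]-(r-m)\log2+c_2\big)-c_2.$$ Moreover, let $m_0:=r-2-\lfloor\alpha^{-1}\log_2(C_\alpha\mathbb{E}[W_{e'}^\alpha])\rfloor$ and $m_1:=r-2-\lfloor(\log2)^{-1}(\mathbb{E}[\log W_{e'}]+c_2)\rfloor$.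 If $m_0\in\{l,\ldots,r\}$, then $m=m_0$ is a minimizer in the second bound; if $m_0<l$ (resp. $m_0>r$), then $m=l$ (resp. $m=r$) is a minimizer. The analogous statement holds for $m_1$ and the third bound.
   Context: Subdivision: the $2^r$-subdivision $G_r=(\Lambda_r,E_r)$ replaces each edge $e\in E$ (with endpoints $v_{e,0},v_{e,1}$) by the path of edges $e_{j,r}=\{v_{e,2^{-r}(j-1)},v_{e,2^{-r}j}\}$, $1\le j\le 2^r$, with new vertices $v_{e,2^{-r}j}$; $\Lambda_m\subseteq\Lambda_r$ for $m\le r$. Edge weights are identified with the symmetric matrix $W$ on $\Lambda_r$ with $W_{ij}=W_e$ if $e=\{i,j\}\in E_r$, $W_{ij}=0$ otherwise. The random field $\beta$: for finite $\Lambda$ and symmetric $W\in[0,\infty)^{\Lambda\times\Lambda}$, $H^W_\beta=2\operatorname{diag}(\beta)-W$ and $\nu^W_\Lambda(d\beta)=(2/\pi)^{|\Lambda|/2}1_{\{H^W_\beta>0\}}e^{-\frac12\langle1,H^W_\beta1\rangle}(\det H^W_\beta)^{-1/2}d\beta$. Given $W$, let $\beta\in\mathbb{R}^{\Lambda_r}$ have conditional law $\nu^W_{\Lambda_r}$. Effective weights: for $J\subseteq\Lambda_r$, $I=\Lambda_r\setminus J$, $W^J(\beta_I):=W_{JJ}+W_{JI}([H^W_\beta]_{II})^{-1}W_{IJ}$ ($A_{IJ}$ denotes the submatrix). For $0\le m\le r$ and $e=\{i,j\}\in E_m$, $W^{(m)}_e:=W^{\Lambda_m}_{ij}(\beta_{\Lambda_r\setminus\Lambda_m})$;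 in particular $W^{(r)}=W$. *)

(* Defs.v *)
From HB Require Import structures.
From mathcomp Require Import all_boot all_order all_algebra.
From mathcomp Require Import all_classical all_reals all_analysis.
Set Implicit Arguments. Unset Strict Implicit. Unset Printing Implicit Defensive.
Import Order.TTheory GRing.Theory Num.Theory.
Local Open Scope classical_set_scope.
Local Open Scope ring_scope.

(* Graph G = (Lambda, E): vertex type V, edge type Ed, each edge e having      *)
(* endpoints v_{e,0} = src e and v_{e,1} = tgt e (an arbitrary orientation,   *)
(* needed only to label the subdivision vertices v_{e,t}).                    *)

Definition pair2 (T : finType) (a b : T) : {set T} := finset (fun x => (x == a) || (x == b)).

Definition adjacent (V Ed : finType) (src tgt : Ed -> V) : rel V :=
  fun u v => [exists e, ((src e == u) && (tgt e == v)) || ((src e == v) && (tgt e == u))].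

Definition simple_connected_graph (V Ed : finType) (src tgt : Ed -> V) : Prop :=
  [/\ (forall e, src e != tgt e),
      (forall e f, pair2 (src e) (tgt e) = pair2 (src f) (tgt f) -> e = f) &
      (forall u v, connect (adjacent src tgt) u v)].

(* Vertices of G_r: original vertices, and inner vertices v_{e,2^{-r} j},     *)
(* 1 <= j <= 2^r - 1, encoded as (e, j-1).                                    *)
Definition svert (V Ed : finType) (r : nat) : finType := (V + (Ed * 'I_(2 ^ r).-1))%type.
(* Edges of G_r: e_{j,r}, 1 <= j <= 2^r, encoded as (e, j-1).                 *)
Definition sedge (Ed : finType) (r : nat) : finType := (Ed * 'I_(2 ^ r))%type.

(* the vertex v_{e, 2^{-r} j} of G_r, for 0 <= j <= 2^r *)
Definition pos (V Ed : finType) (src tgt : Ed -> V) (r : nat) (e : Ed) (j : nat)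
  : svert V Ed r :=
  if j == 0%N then inl (src e)
  else if (insub j.-1 : option 'I_(2 ^ r).-1) is Some k then inr (e, k)
  else inl (tgt e).

Definition sedge_ends (V Ed : finType) (src tgt : Ed -> V) (r : nat) (f : sedge Ed r)
  : {set svert V Ed r} :=
  pair2 (pos src tgt r f.1 f.2) (pos src tgt r f.1 f.2.+1).

(* the inclusion Lambda_m \subseteq Lambda_r : v_{e,k 2^{-m}} = v_{e, k 2^{r-m} 2^{-r}} *)
Definition sembed (V Ed : finType) (src tgt : Ed -> V) (m r : nat) (x : svert V Ed m)
  : svert V Ed r :=
  match x with
  | inl v => inl v
  | inr (e, k) => pos src tgt r e (k.+1 * 2 ^ (r - m))
  end.

Section Matrices.
Variable R : realType.
Variable T : finType.

Definition posdef (H : T -> T -> R) : Prop :=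
  forall x : T -> R, (exists a, x a != 0) ->
    0 < \sum_(a : T) \sum_(b : T) x a * H a b * x b.

Definition detT (H : T -> T -> R) : R :=
  \det (\matrix_(i < #|T|, j < #|T|) H (enum_val i) (enum_val j)).

Definition Hmat (W : T -> T -> R) (beta : T -> R) : T -> T -> R :=
  fun a b => (if a == b then 2 * beta a else 0) - W a b.

Definition effective (J : {set T}) (W : T -> T -> R) (beta : T -> R) (i j : T) : R :=
  let HII := \matrix_(a < #|~: J|, b < #|~: J|) Hmat W beta (enum_val a) (enum_val b) in
  W i j + \sum_(a < #|~: J|) \sum_(b < #|~: J|)
            W i (enum_val a) * invmx HII a b * W (enum_val b) j.

Definition nu_density (W : T -> T -> R) (beta : T -> R) : \bar R :=
  if `[< posdef (Hmat W beta) >] then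
    ((2 / pi) `^ (#|T|%:R / 2) *
     expR (- (1/2) * \sum_(a : T) \sum_(b : T) Hmat W beta a b) *
     detT (Hmat W beta) `^ (- (1/2)))%:E
  else 0%E.

End Matrices.

Definition Wmat (R : realType) (V Ed : finType) (src tgt : Ed -> V) (r : nat)
  (W : sedge Ed r -> R) (a b : svert V Ed r) : R :=
  \sum_(f : sedge Ed r | pair2 a b == sedge_ends src tgt f) W f.

Definition effW (R : realType) (V Ed : finType) (src tgt : Ed -> V) (m r : nat)
  (W : sedge Ed r -> R) (beta : svert V Ed r -> R) (e : sedge Ed m) : R :=
  let J := imset (sembed src tgt r (m:=m)) (mem (finset.setT : {set svert V Ed m})) in
  effective J (Wmat src tgt W) beta
    (sembed src tgt r (pos src tgt m e.1 e.2))
    (sembed src tgt r (pos src tgt m e.1 e.2.+1)).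

Fixpoint iint (R : realType) (d : measure_display) (X : measurableType d)
  (I : eqType) (m : {measure set X -> \bar R}) (s : seq I)
  (F : (I -> X) -> \bar R) (x : I -> X) {struct s} : \bar R :=
  match s with
  | [::] => F x
  | a :: s' => (\int[m]_t iint m s' F (fun i => if i == a then t else x i))%E
  end.

(* Joint expectation of a nonnegative functional F(W, beta), where the edge   *)
(* weights (W_f)_{f in E_r} are i.i.d. with law mu and, given W, beta has law *)
(* nu^W_{Lambda_r}:  E[F] = int mu^{(x)E_r}(dW) int nu^W(dbeta) F(W,beta).    *)
Definition Epos (R : realType) (V Ed : finType) (src tgt : Ed -> V) (r : nat)
  (mu : probability R R)
  (F : (sedge Ed r -> R) -> (svert V Ed r -> R) -> \bar R) : \bar R :=
  iint mu (enum (sedge Ed r))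
    (fun w => iint (@lebesgue_measure R) (enum (svert V Ed r))
       (fun b => (nu_density (Wmat src tgt w) b * F w b)%E) (fun _ => 0))
    (fun _ => 0).

Definition Ereal (R : realType) (V Ed : finType) (src tgt : Ed -> V) (r : nat)
  (mu : probability R R)
  (F : (sedge Ed r -> R) -> (svert V Ed r -> R) -> R) : \bar R :=
  (Epos src tgt mu (fun w b => (Num.max (F w b) 0)%:E)
   - Epos src tgt mu (fun w b => (Num.max (- F w b) 0)%:E))%E.

Definition Gamma (R : realType) (s : R) : R :=
  Rintegral (@lebesgue_measure R) `]0, +oo[%classic
    (fun t => t `^ (s - 1) * expR (- t)).

Definition euler_gamma (R : realType) : R :=
  - Rintegral (@lebesgue_measure R) `]0, +oo[%classic (fun t => expR (- t) * ln t).

Definition C_alpha (R : realType) (a : R) : R :=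
  2 `^ (- a) * Gamma (1/2 - a) / Num.sqrt pi.

Definition c2 (R : realType) : R := euler_gamma R + ln 2.

(* Main.v *)
(* Eliminating the inner vertices one at a time, the pivot [y = 2 beta_i - W_ii]
   has the reciprocal inverse Gaussian density [rig eta], [eta] being the total
   weight at [i], and the remaining weights become [W_ac + W_ai W_ic / y].
   Two edges of weights [u], [v] in series thus become one edge of weight
   [u v / y] with [y] of density [rig (u + v)], and since the weights on G_r are
   i.i.d., the law of W^(l) arises from [mu] by [r - l] steps of the recursion that
   puts two independent copies in series.
   For one step, Jensen's inequality for the concave [z |-> z^a] and the mean
   [1 / (u + v)] of [1 / y] give the factor [2^(-a)]; comparing [rig (u + v)] with
   [rig 0], which it crosses exactly once, and using
   [int rig 0 y * y^(-a) dy = C_alpha a] gives the product bound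
   [C_alpha a * u^a * v^a]; the same comparison with the logarithm, whose [rig 0]
   mean is [- c2], gives the logarithmic bound. Using the first kind of bound for the
   steps r -> m and the second for m -> l yields the family of bounds indexed by m. *)

Require Import Defs.
From HB Require Import structures.
From mathcomp Require Import all_boot all_order all_fingroup all_algebra.
From mathcomp Require Import all_classical all_reals all_analysis.
From mathcomp Require Import measurable_realfun.
From mathcomp Require Import zify ring lra.
Set Implicit Arguments. Unset Strict Implicit. Unset Printing Implicit Defensive.
Import Order.TTheory GRing.Theory Num.Theory numFieldNormedType.Exports.
Local Open Scope ring_scope.

(** * Iterated integrals *)

(** Each pivot step rests on completing the square in [<1, H 1>] and factoring [det H]: the density
    of beta splits into twice [rig] of the pivot times the density of the Schur complement, whose
    new diagonal is absorbed by a shift of the remaining beta. The order of elimination is free, so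
    the interior of [ebar] comes first, in dyadic order, which produces the binary recursion. The
    interiors of the other level-l edges follow; a level-l edge is determined by its ends, so none
    of them touches both ends of [ebar], and its weight stays unchanged. The density vanishes unless
    all pivots are positive, and there elimination agrees with the inverse matrix of the definition.
    The value [- c2] is the mean logarithm of a chi-square variable written as [2 T / (1 + V^2)]:
    the exponential [T] contributes [- gamma], and a doubling identity for the half-Cauchy [V] gives
    [E log (1 + V^2) = 2 log 2]. Means of logarithms may be infinite, so the inequalities are proved
    between sums of positive and negative parts, and subtraction is delayed to the end. *)

Section IteratedIntegral.
Context (R : realType) (dX : measure_display) (X : measurableType dX) (I : eqType).
Implicit Types (s : seq I) (F G : (I -> X) -> \bar R) (x : I -> X).

(* Joint measurability of a function of finitely many coordinates, tested
   against all measurable curves: no sigma-algebra on [I -> X] is needed. *)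
Definition mfun F := forall (d : measure_display) (D : measurableType d) (x : D -> I -> X),
  (forall i, measurable_fun setT (fun z => x z i)) ->
  measurable_fun setT (fun z => F (x z)).

Definition upd x (a : I) (t : X) : I -> X := fun i => if i == a then t else x i.

Lemma updC x a b t u : a != b -> upd (upd x a t) b u = upd (upd x b u) a t.
Proof.
by move=> ab; apply/funext => i; rewrite /upd; case: eqP => // ->; rewrite eq_sym (negPf ab).
Qed.

Lemma measurable_upd d (D : measurableType d) (x : D -> I -> X) (t : D -> X) a :
  (forall i, measurable_fun setT (fun z => x z i)) -> measurable_fun setT t ->
  forall i, measurable_fun setT (fun z => upd (x z) a (t z) i).
Proof. by move=> mx mt i; rewrite /upd; case: eqP. Qed.

Section Sigma_finite.
Context (m : {sigma_finite_measure set X -> \bar R}).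

Lemma iint_ge0 s F x : (forall y, 0 <= F y)%E -> (0 <= iint m s F x)%E.
Proof.
move=> F0; elim: s x => [|a s IH] x //=.
by apply: integral_ge0 => t _; exact: IH.
Qed.

(** The parameter space [Z] and the arbitrary domain [D] make the induction close: integrating one
    coordinate enlarges [D] to [D * X], and Tonelli applies to the outer variable. *)
Lemma measurable_iint dZ (Z : measurableType dZ) s (F : Z -> (I -> X) -> \bar R) :
  (forall z y, 0 <= F z y)%E ->
  (forall (d : measure_display) (D : measurableType d) (g : D -> Z) (x : D -> I -> X),
    measurable_fun setT g -> (forall i, measurable_fun setT (fun z => x z i)) ->
    measurable_fun setT (fun z => F (g z) (x z))) ->
  forall (d : measure_display) (D : measurableType d) (g : D -> Z) (x : D -> I -> X),
    measurable_fun setT g -> (forall i, measurable_fun setT (fun z => x z i)) ->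
    measurable_fun setT (fun z => iint m s (F (g z)) (x z)).
Proof.
move=> F0 mF; elim: s => [|a s IH] //= d D g x mg mx.
apply: (measurable_fun_fubini_tonelli_F
    (fun p : D * X => iint m s (F (g p.1)) (upd (x p.1) a p.2))).
  apply: (IH _ _ (g \o fst)); first exact: measurableT_comp.
  apply: measurable_upd => // i.
  by apply: measurableT_comp (mx i) _.
by move=> p; apply: iint_ge0.
Qed.

Lemma mfun_iint s F : (forall y, 0 <= F y)%E -> mfun F -> mfun (iint m s F).
Proof.
move=> F0 mF d D x mx.
apply: (@measurable_iint _ D s (fun=> F) _ _ _ D id x) => // d' D' g y _ my.
exact: mF.
Qed.

Lemma mfun_upd F a x : mfun F -> measurable_fun setT (fun t => F (upd x a t)).
Proof.
move=> mF; apply: mF; apply: (measurable_upd (x := fun=> x)) => // i.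
Qed.

Lemma mfun_upd2 F a b x : mfun F ->
  measurable_fun setT (fun p : X * X => F (upd (upd x a p.1) b p.2)).
Proof.
move=> mF; apply: mF; apply: measurable_upd; last exact: measurable_snd.
by apply: (measurable_upd (x := fun=> x)).
Qed.

Lemma iint_cat s1 s2 F x : iint m (s1 ++ s2) F x = iint m s1 (iint m s2 F) x.
Proof.
by elim: s1 x => [|a s IH] x //=; apply: eq_integral => t _; rewrite -IH.
Qed.

(** Coordinates outside [s] are never updated, so only points agreeing with [x] there are
    visited. *)
Lemma eq_iint s F G x :
  (forall y, (forall i, i \notin s -> y i = x i) -> F y = G y) ->
  iint m s F x = iint m s G x.
Proof.
elim: s x => [|a s IH] x FG /=; first by apply: FG.
apply: eq_integral => t _; apply: IH => y yx; apply: FG => i.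
by rewrite inE negb_or => /andP[ia /yx ->]; rewrite (negPf ia).
Qed.

Lemma iintC a b s F x : (forall y, 0 <= F y)%E -> mfun F ->
  iint m [:: a, b & s] F x = iint m [:: b, a & s] F x.
Proof.
move=> F0 mF; have [->//|ab] := eqVneq a b.
rewrite /= -[LHS]/(\int[m]_t \int[m]_u iint m s F (upd (upd x a t) b u))%E.
rewrite -[RHS]/(\int[m]_t \int[m]_u iint m s F (upd (upd x b t) a u))%E.
rewrite (fubini_tonelli (fun p : X * X => iint m s F (upd (upd x a p.1) b p.2))) /=; last 2 first.
- by apply: mfun_upd2; exact: mfun_iint.
- by move=> p; apply: iint_ge0.
by apply: eq_integral => t _; apply: eq_integral => u _; rewrite updC.
Qed.

Lemma perm_iint s s' F x : (forall y, 0 <= F y)%E -> mfun F -> perm_eq s s' ->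
  iint m s F x = iint m s' F x.
Proof.
move=> F0 mF.
have move_front a s1 s2 y : iint m (s1 ++ a :: s2) F y = iint m (a :: s1 ++ s2) F y.
  elim: s1 y => // b s1 IH y; rewrite cat_cons -/(cat _ _) [RHS]iintC//=.
  by apply: eq_integral => t _; exact: IH.
elim: s s' x => [|a s IH] s' x; first by rewrite perm_sym => /perm_nilP ->.
move=> ps; have as' : a \in s' by rewrite -(perm_mem ps) mem_head.
case/splitPr: as' ps => s1 s2 ps.
have {}ps : perm_eq s (s1 ++ s2).
  by rewrite -(perm_cons a) (permPl ps) perm_sym -cat1s perm_catCA.
rewrite move_front /=.
by apply: eq_integral => t _; exact: IH.
Qed.

Lemma iintZl s F (c : \bar R) x : (forall y, 0 <= F y)%E -> mfun F -> (0 <= c)%E ->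
  iint m s (fun y => c * F y)%E x = (c * iint m s F x)%E.
Proof.
move=> F0 mF c0; elim: s x => [|a s IH] x //=.
under eq_integral do rewrite IH.
rewrite ge0_integralZl//; last by move=> t _; exact: iint_ge0.
by apply: (@mfun_upd (iint m s F)); exact: mfun_iint.
Qed.

End Sigma_finite.

Section Probability.
Context (m : probability X R).

Lemma iint_cst s F x : (forall y, (forall i, i \notin s -> y i = x i) -> F y = F x) ->
  iint m s F x = F x.
Proof.
move=> Fx; rewrite (@eq_iint m s F (fun=> F x) x)//.
move: (F x) => c; elim: s x {Fx} => //= a s IH x; under eq_integral do rewrite IH.
by rewrite integral_cst//= probability_setT mule1.
Qed.

(** The exceptional set is removed one coordinate at a time, each time as the null complement of
    [P], so no product measure is involved. *)
Lemma ae_eq_iint (P : set X) s F G x : measurable P -> m P = 1%E ->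
  (forall y, 0 <= F y)%E -> (forall y, 0 <= G y)%E -> mfun F -> mfun G ->
  (forall y, (forall i, i \in s -> P (y i)) -> (forall i, i \notin s -> y i = x i) -> F y = G y) ->
  iint m s F x = iint m s G x.
Proof.
move=> mP P1 F0 G0 mF mG; elim: s x => [|a s IH] x FG /=; first by apply: FG.
apply: ge0_ae_eq_integral => //.
- by apply: (@mfun_upd (iint m s F)); exact: mfun_iint.
- by apply: (@mfun_upd (iint m s G)); exact: mfun_iint.
- by move=> t _; exact: iint_ge0.
- by move=> t _; exact: iint_ge0.
exists (~` P)%classic; split; first exact: measurableC.
  by have := probability_setC m mP; rewrite P1 subee// => <-.
move=> t /= /not_implyP[_ neq] Pt; apply: neq; apply: IH => y yP yx.
apply: FG => i; rewrite inE.
  have [/yP//|is'] := boolP (i \in s); rewrite orbF => /eqP ia.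
  by rewrite yx// ia eqxx.
by rewrite negb_or => /andP[ia /yx ->]; rewrite (negPf ia).
Qed.

End Probability.
End IteratedIntegral.

(** * Changes of variables on the line *)

Section ChangeOfVariables.
Local Open Scope classical_set_scope.
Context (R : realType).
Local Notation leb := (@lebesgue_measure R).

Lemma measurable_invr : measurable_fun [set: R] (@GRing.inv R).
Proof.
(* Measurability of real powers gives that of the inverse; the extra factor [x] restores the sign
   and the value 0 at 0. *)
rewrite (_ : GRing.inv = fun x : R => x * (x ^+ 2) `^ (-1)).
  apply: measurable_funM => //.
  apply: (measurableT_comp (measurable_powR (-1))).
  exact: measurable_funX.
apply/funext => x; rewrite powR_inv1 ?sqr_ge0// expr2 invfM.
have [->|x0] := eqVneq x 0; first by rewrite invr0 mul0r.
by rewrite mulrA mulfV// mul1r.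
Qed.

Lemma measurable_set_bool d (T : measurableType d) (f : T -> bool) :
  measurable_fun setT f -> measurable [set x | f x].
Proof.
move=> mf; have := mf measurableT [set true] I; rewrite setTI.
suff -> : f @^-1` [set true] = [set x | f x] by [].
by apply/seteqP; split => x /=.
Qed.

Lemma ge0_integral_mrestr d (T : measurableType d) (m : {measure set T -> \bar R})
    (U : set T) (mU : measurable U) (f : T -> \bar R) :
  measurable_fun setT f -> (forall x, 0 <= f x)%E ->
  (\int[mrestr m mU]_x f x = \int[m]_(x in U) f x)%E.
Proof.
move=> mf f0.
have mUc : measurable (~` U) by exact: measurableC.
have dU : [disjoint U & ~` U] by apply/disj_setPS; rewrite setICr.
have mf' : measurable_fun (U `|` ~` U) f by rewrite setUv.
rewrite -(setUv U) ge0_integral_setU//.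
rewrite [X in (_ + X)%E](_ : _ = 0%E) ?adde0.
  by apply: eq_measure_integral => A mA AU; rewrite /= /mrestr setIidl.
apply/eqP; rewrite eq_le integral_ge0// andbT.
rewrite (@ge0_negligible_integral _ _ _ _ _ (~` U))//.
- by rewrite setDv integral_set0.
- exact: measurable_funS mf.
- by rewrite /= /mrestr setICl measure0.
Qed.

(** Twice the image of Lebesgue measure under [t |-> 2 t - c] gives each half-open interval its
    length, so uniqueness identifies it with Lebesgue measure. *)
Lemma integral_affine (c : R) (g : R -> \bar R) :
  measurable_fun setT g -> (forall x, 0 <= g x)%E ->
  (\int[leb]_t (2%:E * g (2 * t - c)%R) = \int[leb]_y g y)%E.
Proof.
move=> mg g0.
have mphi : measurable_fun [set: R] (fun t : R => 2 * t - c : measurableTypeR R).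
  by apply: measurable_funB => //; apply: measurable_funM.
have mphi' : measurable_fun [set: measurableTypeR R] (fun t : R => 2 * t - c : measurableTypeR R) by [].
pose two : {nonneg R} := NngNum (ler0n R 2).
pose nu0 := mscale two (pushforward leb (fun t : R => 2 * t - c : measurableTypeR R)).
pose nu := nu0 mphi'.
have nuE A : measurable A -> leb A = nu A.
  apply: lebesgue_measure_unique => _ [[a b]] _ <-.
  rewrite /nu /nu0 /= /mscale /= /pushforward.
  rewrite (_ : _ @^-1` _ = `](a + c) / 2, (b + c) / 2]); last first.
    by apply/seteqP; split => x /=; rewrite !in_itv/= => /andP[? ?]; apply/andP; split; lra.
  rewrite !lebesgue_measure_itv/= !lte_fin.
  rewrite (_ : ((a + c) / 2 < (b + c) / 2) = (a < b)); last by apply/idP/idP => ?; lra.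
  case: ifPn => _; last by rewrite mule0.
  by rewrite -!EFinB -EFinM; congr EFin; field.
transitivity (\int[nu]_y g y)%E; last by apply: eq_measure_integral => A mA _; exact/esym/nuE.
rewrite ge0_integral_mscale// ge0_integral_pushforward//= preimage_setT.
rewrite ge0_integralZl//.
exact: (measurableT_comp mg mphi).
Qed.

Section Substitution.
Variables (D : set R) (phi dphi psi : R -> R).
Hypotheses (mD : measurable D) (mphi : measurable_fun setT phi)
  (mdphi : measurable_fun setT dphi).
Hypothesis Ditv : forall a b z, D a -> D b -> a <= z <= b -> D z.
Hypothesis dphi_gt0 : forall z, D z -> 0 < dphi z.
Hypothesis der : forall z, D z -> is_derive z 1 phi (dphi z).
Hypothesis cdphi : forall z, D z -> {for z, continuous dphi}.
Hypothesis phi_lt : forall a b, D a -> D b -> a < b -> phi a < phi b.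
Hypothesis Dpsi : forall t, D (psi t).
Hypothesis phiK : forall t, phi (psi t) = t.

Let cphi z : D z -> {for z, continuous phi}.
Proof. by move=> /der [dz _]; apply/differentiable_continuous/derivable1_diffP. Qed.

Let itvD a b z : D a -> D b -> z \in `[a, b]%R -> D z.
Proof. by move=> Da Db; rewrite in_itv/=; exact: Ditv. Qed.

Let FTC a b : D a -> D b -> a < b ->
  (\int[leb]_(z in `[a, b]) (dphi z)%:E = (phi b - phi a)%:E)%E.
Proof.
move=> Da Db ab; rewrite (@continuous_FTC2 _ dphi phi a b) ?EFinB//.
- apply: continuous_in_subspaceT => z; rewrite inE/= => zab.
  by apply: cdphi; apply: itvD zab.
- split.
  + move=> z /subset_itv_oo_cc zab; have [] // := der (itvD Da Db zab).
  + by apply: cvg_at_right_filter; exact: cphi.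
  + by apply: cvg_at_left_filter; exact: cphi.
- move=> z /subset_itv_oo_cc zab; rewrite derive1E.
  by have [_] := der (itvD Da Db zab).
Qed.

Let phi_le a b : D a -> D b -> (phi a <= phi b) = (a <= b).
Proof.
move=> Da Db; case: (leP a b) => [|ba]; last by rewrite leNgt phi_lt.
by rewrite le_eqVlt => /orP[/eqP ->|ab]; rewrite ?lexx// ltW// phi_lt.
Qed.

(** The region under the graph of [dphi] over [D]. Area restricted to it realises the measure of
    density [dphi], so that the image measure under [phi] is an ordinary pushforward along the first
    coordinate. *)
Let U : set (R * R) := [set p | D p.1 /\ 0 <= p.2 < dphi p.1].

Let mU : measurable U.
Proof.
rewrite (_ : U = (fst @^-1` D) `&` ([set p | 0 <= p.2] `&` [set p | p.2 < dphi p.1])).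
  apply: measurableI; first by rewrite -[X in measurable X]setTI; exact: measurable_fst.
  apply: measurableI; apply: measurable_set_bool.
    by apply: measurable_fun_ler => //; exact: measurable_snd.
  by apply: measurable_fun_ltr; [exact: measurable_snd|exact: measurableT_comp].
apply/seteqP; split => p /=; first by move=> [? /andP[? ?]].
by move=> [? [? ?]]; split => //; apply/andP.
Qed.

Let mphi1 : measurable_fun [set: R * R] (phi \o fst : _ -> measurableTypeR R).
Proof. exact: measurableT_comp. Qed.

Let nu : {measure set (measurableTypeR R) -> \bar R} :=
  measure_function_pushforward__canonical__measure_function_Measure (mrestr (leb \x leb)%E mU) mphi1.

Let integral_nu (g : R -> \bar R) :
  measurable_fun setT g -> (forall x, 0 <= g x)%E ->
  (\int[nu]_t g t = \int[leb]_(z in D) (g (phi z) * (dphi z)%:E))%E.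
Proof.
move=> mg g0.
have mgphi : measurable_fun setT (g \o phi) by exact: measurableT_comp.
have mgphi1 : measurable_fun setT ((g \o phi) \o @fst R R) by exact: measurableT_comp.
rewrite ge0_integral_pushforward//= preimage_setT ge0_integral_mrestr//=.
rewrite integral_mkcond.
transitivity (\int[(leb \x leb)%E]_p (g (phi p.1) * (\1_U p)%:E))%E.
  apply: eq_integral => p _; rewrite patchE indicE.
  by case: ifPn; rewrite ?mule1 ?mule0.
have mgU : measurable_fun setT (fun p => g (phi p.1) * (\1_U p)%:E)%E.
  by apply: emeasurable_funM => //; exact/measurable_EFinP.
rewrite fubini_tonelli1//=; last by move=> p; rewrite mule_ge0// lee_fin.
rewrite /fubini_F [RHS]integral_mkcond; apply: eq_integral => z _.
have mU1 : measurable_fun setT (fun y : R => (\1_U (z, y))%:E : \bar R).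
  by apply/measurable_EFinP; apply: measurableT_comp => //; exact: measurable_pair1.
transitivity (g (phi z) * \int[leb]_y (\1_U (z, y))%:E)%E.
  by rewrite -ge0_integralZl// => y _; rewrite lee_fin.
rewrite patchE; case: ifPn; rewrite ?inE ?notin_setE => Dz.
  congr (_ * _)%E.
  transitivity (\int[leb]_y (\1_(`[0, dphi z[) y)%:E)%E.
    apply: eq_integral => y _; rewrite !indicE.
    suff -> : ((z, y) \in U) = (y \in `[0%R, dphi z[%classic) by [].
    apply/idP/idP.
      by rewrite !inE /U /= in_itv /= => -[].
    by rewrite !inE /U /= in_itv /=.
  rewrite integral_indic// setIT.
  by apply: (etrans (lebesgue_measure_itv `[0, dphi z[%R)); rewrite /= lte_fin dphi_gt0// oppr0 adde0.
rewrite integral0_eq ?mule0// => y _; rewrite indicE memNset//=.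
by move=> [].
Qed.

(** The pushforward [nu] gives []a, b]] the mass [b - a], by the fundamental theorem of calculus
    between [psi a] and [psi b]; it is therefore Lebesgue measure. *)
Lemma integral_substitution (g : R -> \bar R) :
  measurable_fun setT g -> (forall x, 0 <= g x)%E ->
  (\int[leb]_(z in D) (g (phi z) * (dphi z)%:E) = \int[leb]_t g t)%E.
Proof.
move=> mg g0; rewrite -integral_nu//; apply: eq_measure_integral => A mA _.
apply/esym; apply: (@lebesgue_measure_unique _ (nu)) => // _ [[a b]] _ <-.
apply: esym; rewrite -[X in nu X]setIT -[LHS]integral_indic//= integral_nu//; last exact/measurable_EFinP.
have [ab|ba] := ltP a b; last first.
  rewrite lebesgue_measure_itv/= lte_fin ltNge ba/= integral0_eq// => z _.
  by rewrite set_itv_ge ?bnd_simp -?leNgt// indic0 mul0e.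
apply: (etrans _ (esym (lebesgue_measure_itv `]a, b]%R))); rewrite /= lte_fin ab.
transitivity (\int[leb]_(z in `]psi a, psi b]) (dphi z)%:E)%E.
  rewrite [LHS]integral_mkcond [RHS]integral_mkcond; apply: eq_integral => z _.
  have ltphi c : D z -> (c < phi z) = (psi c < z).
    by move=> Dz; rewrite !ltNge -{1}(phiK c) phi_le.
  have lephi c : D z -> (phi z <= c) = (z <= psi c).
    by move=> Dz; rewrite -{1}(phiK c) phi_le.
  rewrite !patchE; case: ifPn; rewrite ?inE ?notin_setE => Dz.
    rewrite indicE (_ : (phi z \in _) = (z \in `]psi a, psi b]%classic)).
      by case: ifPn; rewrite ?mul1e ?mul0e.
    by apply/idP/idP; rewrite !inE/= !in_itv/= ltphi// lephi.
  rewrite ifF//; apply/negbTE; rewrite notin_setE => /=; rewrite in_itv/= => /andP[az zb].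
  by apply: Dz; apply: (@Ditv (psi a) (psi b)) => //; rewrite (ltW az).
have ab' : psi a < psi b by rewrite ltNge -phi_le// !phiK -ltNge.
rewrite integral_itv_obnd_cbnd; last exact/measurable_EFinP/measurable_funTS.
by rewrite FTC// !phiK EFinB.
Qed.
End Substitution.

Local Notation pos := `]0, +oo[%classic.

Let posE (z : R) : pos z = (0 < z) :> Prop.
Proof. by rewrite /= in_itv/= andbT. Qed.

Let integral_subst_pos (phi dphi psi : R -> R) (g : R -> \bar R) :
  measurable_fun setT phi -> measurable_fun setT dphi ->
  (forall z, 0 < z -> 0 < dphi z) ->
  (forall z : R, 0 < z -> is_derive z 1 phi (dphi z)) ->
  (forall z, 0 < z -> {for z, continuous dphi}) ->
  (forall a b, 0 < a -> 0 < b -> a < b -> phi a < phi b) ->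
  (forall t, 0 < psi t) -> (forall t, phi (psi t) = t) ->
  measurable_fun setT g -> (forall x, 0 <= g x)%E ->
  (\int[leb]_(z in pos) (g (phi z) * (dphi z)%:E) = \int[leb]_t g t)%E.
Proof.
move=> mphi mdphi dphi0 der cdphi phi_lt psi0 phiK mg g0.
apply: (@integral_substitution pos phi dphi psi) => //.
- by move=> a b z; rewrite !posE => a0 _ /andP[/(lt_le_trans a0)].
- by move=> z; rewrite posE => /dphi0.
- by move=> z; rewrite posE => /der.
- by move=> z; rewrite posE => /cdphi.
- by move=> a b; rewrite !posE; exact: phi_lt.
- by move=> t; rewrite posE.
Qed.

Lemma integral_exp (g : R -> \bar R) : measurable_fun setT g -> (forall x, 0 <= g x)%E ->
  (\int[leb]_(z in pos) g z = \int[leb]_t (g (expR t) * (expR t)%:E))%E.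
Proof.
move=> mg g0; rewrite -(@integral_subst_pos (@ln R) (@GRing.inv R) (@expR R)).
- apply: eq_integral => z; rewrite inE posE => z0.
  by rewrite lnK ?posrE// -muleA -EFinM divff ?gt_eqF// mule1.
- exact: measurable_ln.
- exact: measurable_invr.
- by move=> z z0; rewrite invr_gt0.
- by move=> z z0; apply: inv_continuous; rewrite gt_eqF.
- by move=> a b a0 b0; rewrite ltr_ln ?posrE.
- exact: expR_gt0.
- exact: expRK.
- apply: emeasurable_funM; first exact: measurableT_comp.
  by apply/measurable_EFinP; exact: measurable_expR.
- by move=> x; rewrite mule_ge0// lee_fin expR_ge0.
Qed.

Lemma integralN (g : R -> \bar R) : measurable_fun setT g -> (forall x, 0 <= g x)%E ->
  (\int[leb]_z g z = \int[leb]_z (g (- z)%R))%E.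
Proof.
move=> mg g0.
have mN : measurable_fun [set: measurableTypeR R] (-%R : _ -> measurableTypeR R) by [].
have := @ge0_integral_pushforward _ _ _ _ R _ mN leb setT g measurableT mg (fun x _ => g0 x).
rewrite preimage_setT => <-.
by apply: eq_measure_integral => A mA _; exact/esym/lebesgue_measureN.
Qed.

Lemma integral_sgM (k : R) (g : R -> \bar R) : k != 0 ->
  measurable_fun setT g -> (forall x, 0 <= g x)%E ->
  (\int[leb]_t g t = \int[leb]_t (g (Num.sg k * t)%R))%E.
Proof.
move=> k0 mg g0; have [kp|kn] := ltP 0 k.
  by rewrite gtr0_sg//; apply: eq_integral => t _; rewrite mul1r.
rewrite integralN// ltr0_sg; last by rewrite lt_neqAle k0.
by apply: eq_integral => t _; rewrite mulN1r.
Qed.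

(** In logarithmic coordinates [z |-> c z^k] is affine with slope [k]; a negative [k] costs a
    reflection of the line, handled by [integral_sgM]. *)
Lemma integral_pow (c k : R) (g : R -> \bar R) : 0 < c -> k != 0 ->
  measurable_fun setT g -> (forall x, 0 <= g x)%E ->
  (\int[leb]_(z in pos) g z =
   \int[leb]_(z in pos) (g (c * z `^ k)%R * (c * `|k| * z `^ (k - 1))%:E))%E.
Proof.
move=> c0 k0 mg g0; rewrite integral_exp//.
pose G t := (g (expR t) * (expR t)%:E)%E.
have mG : measurable_fun setT G.
  apply: emeasurable_funM; first exact: measurableT_comp.
  by apply/measurable_EFinP; exact: measurable_expR.
have G0 x : (0 <= G x)%E by rewrite mule_ge0// lee_fin expR_ge0.
rewrite (integral_sgM k0 mG G0).
have mM (x : R) : measurable_fun setT (fun t : R => x * t) by exact: measurable_funM.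
have der (z : R) : 0 < z ->
    is_derive z 1 (fun z => `|k| * ln z + Num.sg k * ln c) (`|k| / z).
  move=> z0; have ? := is_derive1_ln z0.
  by apply: is_derive_eq; rewrite addr0.
rewrite -(@integral_subst_pos (fun z => `|k| * ln z + Num.sg k * ln c) (fun z => `|k| / z)
   (fun t => expR ((t - Num.sg k * ln c) / `|k|)) _ _ _ _ der).
- apply: eq_integral => z; rewrite inE posE => z0.
  have -> : Num.sg k * (`|k| * ln z + Num.sg k * ln c) = k * ln z + ln c.
    by rewrite mulrDr !mulrA -numEsg -expr2 sqr_sg k0 mul1r.
  rewrite /G -muleA -EFinM expRD lnK ?posrE// [_ * c]mulrC.
  have -> : expR (k * ln z) = z `^ k by rewrite /powR gt_eqF.
  congr (_ * _%:E)%E; rewrite powRB ?(gt_eqF z0) ?implybT//.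
  by rewrite powRr1 ?ltW//; ring.
- apply: measurable_funD => //; apply: measurable_funM => //; exact: measurable_ln.
- apply: measurable_funM => //; exact: measurable_invr.
- by move=> z z0; rewrite divr_gt0// normr_gt0.
- by move=> z z0; apply: cvgM; [exact: cvg_cst|apply: inv_continuous; rewrite gt_eqF].
- by move=> a b a0 b0 ab; rewrite ltrD2r ltr_pM2l ?normr_gt0// ltr_ln ?posrE.
- by move=> t; exact: expR_gt0.
- by move=> t; rewrite expRK mulrC divfK ?normr_eq0// subrK.
- exact: measurableT_comp.
- by move=> x; exact: G0.
Qed.

(** The Cauchy-Schlomilch substitution: [z |-> c (z - eta / z)] increases from minus to plus
    infinity on the positive half-line. *)
Lemma integral_subst_subV (c eta : R) (g : R -> \bar R) : 0 < c -> 0 < eta ->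
  measurable_fun setT g -> (forall x, 0 <= g x)%E ->
  (\int[leb]_t g t =
   \int[leb]_(z in pos) (g (c * (z - eta / z))%R * (c * (1 + eta / z ^+ 2))%:E))%E.
Proof.
move=> c0 e0 mg g0.
(* Discriminant of [z^2 - (t / c) z - eta], whose positive root is the preimage of [t]. *)
pose s t := (t / c) ^+ 2 + 4 * eta.
have s0 t : 0 < s t by rewrite ltr_wpDl ?sqr_ge0// mulr_gt0.
have der (z : R) : 0 < z ->
    is_derive z 1 (fun z => c * (z - eta / z)) (c * (1 + eta / z ^+ 2)).
  move=> z0; have zn0 : z != 0 by rewrite gt_eqF.
  have ? := @is_deriveV R id z 1 1 zn0 _.
  by apply: is_derive_eq; rewrite /GRing.scale/= mulr1 mulrN opprK.
rewrite -(@integral_subst_pos (fun z => c * (z - eta / z)) (fun z => c * (1 + eta / z ^+ 2))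
   (fun t => (t / c + Num.sqrt (s t)) / 2) _ _ _ _ der)//.
- apply: measurable_funM => //; apply: measurable_funB => //.
  by apply: measurable_funM => //; exact: measurable_invr.
- apply: measurable_funM => //; apply: measurable_funD => //.
  apply: measurable_funM => //; apply: (measurableT_comp measurable_invr).
  exact: measurable_funX.
- by move=> z z0; rewrite mulr_gt0// addr_gt0// divr_gt0// exprn_gt0.
- move=> z z0; apply: cvgM; first exact: cvg_cst.
  apply: cvgD; first exact: cvg_cst.
  apply: cvgM; first exact: cvg_cst.
  apply: (@continuousV _ _ (fun z : R => z ^+ 2)); first by rewrite expf_eq0 gt_eqF.
  exact: exprn_continuous.
- move=> a b a0 b0 ab; rewrite ltr_pM2l// ltrB// ?ltr_pM2l// ltf_pV2 ?posrE//.
- move=> t; have q2 := sqr_sqrtr (ltW (s0 t)); have q0 := sqrtr_ge0 (s t).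
  rewrite divr_gt0// ltNge; apply/negP => tq; have := s0 t; rewrite /s in q2 *; nra.
- move=> t; have q2 := sqr_sqrtr (ltW (s0 t)); have q0 := sqrtr_ge0 (s t).
  set q := Num.sqrt _ in q2 q0 *; set tau := t / c in q2 *.
  have tq : tau + q != 0.
    by apply/eqP => tq; have := s0 t; rewrite /s -/tau in q2 *; nra.
  have -> : (tau + q) / 2 - eta / ((tau + q) / 2) = tau.
    rewrite /s -/tau in q2; field: q2; exact: tq.
  by rewrite /tau mulrC divfK ?gt_eqF.
Qed.

End ChangeOfVariables.

Section RealValuedIntegrals.
Local Open Scope classical_set_scope.
Context (R : realType) d (T : measurableType d) (m : {measure set T -> \bar R}).
Variables (D : set T) (mD : measurable D).

Lemma ge0_integralrZl (k : R) (f : T -> R) : 0 <= k -> measurable_fun setT f ->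
  (forall x, D x -> 0 <= f x) ->
  (\int[m]_(x in D) (k * f x)%:E = k%:E * \int[m]_(x in D) (f x)%:E)%E.
Proof.
move=> k0 mf f0; rewrite -ge0_integralZl ?lee_fin//.
by apply/measurable_EFinP; exact: measurable_funTS.
Qed.

Lemma ge0_integralrD (f g : T -> R) : measurable_fun setT f -> measurable_fun setT g ->
  (forall x, D x -> 0 <= f x) -> (forall x, D x -> 0 <= g x) ->
  (\int[m]_(x in D) (f x + g x)%:E =
   \int[m]_(x in D) (f x)%:E + \int[m]_(x in D) (g x)%:E)%E.
Proof.
move=> mf mg f0 g0; by rewrite -ge0_integralD//; apply/measurable_EFinP; exact: measurable_funTS.
Qed.

Lemma ge0_le_integralr (f g : T -> R) : measurable_fun setT f -> measurable_fun setT g ->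
  (forall x, D x -> 0 <= f x) -> (forall x, D x -> f x <= g x) ->
  (\int[m]_(x in D) (f x)%:E <= \int[m]_(x in D) (g x)%:E)%E.
Proof.
move=> mf mg f0 fg; by apply: ge0_le_integral => //; apply/measurable_EFinP; exact: measurable_funTS.
Qed.

End RealValuedIntegrals.

(** * The reciprocal inverse Gaussian law *)

Section InverseGaussian.
Local Open Scope classical_set_scope.
Context (R : realType).
Local Notation leb := (@lebesgue_measure R).
Local Notation pos := `]0, +oo[%classic.
Implicit Types (eta y z : R).

(* Reciprocal inverse Gaussian density. *)
Definition rig eta y : R := (2 * pi * y) `^ (- (1 / 2)) * expR (- (y - eta) ^+ 2 / (2 * y)).

Lemma rig_ge0 eta y : 0 <= rig eta y.
Proof. by rewrite mulr_ge0 ?powR_ge0 ?expR_ge0. Qed.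

Lemma rig_gt0 eta y : 0 < y -> 0 < rig eta y.
Proof. by move=> y0; rewrite mulr_gt0 ?powR_gt0 ?expR_gt0// mulr_gt0// mulr_gt0// pi_gt0. Qed.

Lemma measurable_rig d (D : measurableType d) (f g : D -> R) :
  measurable_fun setT f -> measurable_fun setT g ->
  measurable_fun setT (fun x => rig (f x) (g x)).
Proof.
move=> mf mg; apply: measurable_funM.
  by apply: (measurableT_comp (measurable_powR _)); exact: measurable_funM.
apply: measurableT_comp; first exact: measurable_expR.
apply: measurable_funM.
  by apply: measurableT_comp => //; apply: measurable_funX; exact: measurable_funB.
by apply: (measurableT_comp (@measurable_invr R)); exact: measurable_funM.
Qed.

Let gs (x : R) : R := expR (- x ^+ 2 / 2).

Let gs_ge0 x : 0 <= gs x. Proof. exact: expR_ge0. Qed.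

Let measurable_gs : measurable_fun setT gs.
Proof.
apply: measurableT_comp; first exact: measurable_expR.
apply: measurable_funM => //; apply: measurableT_comp => //; exact: measurable_funX.
Qed.

Let integral_gs : (\int[leb]_x (gs x)%:E = (Num.sqrt (2 * pi))%:E)%E.
Proof.
have := @integral_normal_pdf R 0 1.
have s0 : 0 < Num.sqrt (2 * pi : R) by rewrite sqrtr_gt0 mulr_gt0 ?pi_gt0.
have -> : (\int[leb]_x (normal_pdf 0 1 x)%:E =
    ((Num.sqrt (2 * pi))^-1)%:E * \int[leb]_x (gs x)%:E)%E.
  rewrite -ge0_integralrZl ?invr_ge0 ?(ltW s0)//.
  apply: eq_integral => x _; rewrite normal_pdfE ?oner_neq0//.
  rewrite /normal_peak /normal_fun /gs subr0 expr1n mul1r -mulr_natl.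
  by congr (_ * expR _)%:E; congr (_ / _); rewrite mulr2n.
move=> /(congr1 (fun x => (Num.sqrt (2 * pi))%:E * x)%E).
by rewrite muleA -EFinM divff ?gt_eqF// mul1e mule1.
Qed.

Let sqrt2pi_gt0 : 0 < Num.sqrt (2 * pi : R).
Proof. by rewrite sqrtr_gt0 mulr_gt0 ?pi_gt0. Qed.

(** Under [y = z^2] the exponent [(y - eta)^2 / (2 y)] becomes [(z - eta / z)^2 / 2], a Gaussian in
    [z - eta / z]. *)
Let rigE eta z : 0 < z ->
  rig eta (1 * z `^ 2) * (1 * `|2| * z `^ (2 - 1)) = 2 / Num.sqrt (2 * pi) * gs (z - eta / z).
Proof.
move=> z0; have -> : (2 - 1 = 1 :> R) by ring.
rewrite !mul1r powRr1 ?ltW// (@powR_mulrn _ z 2) ?ltW// ger0_norm// /rig.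
have p0 : 0 <= 2 * pi :> R by rewrite mulr_ge0 ?pi_ge0.
have -> : (2 * pi * z ^+ 2) `^ (- (1 / 2)) = (Num.sqrt (2 * pi))^-1 / z.
  rewrite powRN mul1r powR12_sqrt ?(mulr_ge0 p0 (sqr_ge0 _))//.
  by rewrite sqrtrM// sqrtr_sqr gtr0_norm// invfM.

have -> : - (z ^+ 2 - eta) ^+ 2 / (2 * z ^+ 2) = - (z - eta / z) ^+ 2 / 2.
  by field; rewrite gt_eqF.
by rewrite -/(gs _); field; rewrite !gt_eqF.
Qed.

Let integral_rigE eta (h : R -> R) : measurable_fun setT h -> (forall y, 0 <= h y) ->
  (\int[leb]_(y in pos) (rig eta y * h y)%:E =
   (2 / Num.sqrt (2 * pi))%:E * \int[leb]_(z in pos) (gs (z - eta / z) * h (z ^+ 2))%:E)%E.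
Proof.
move=> mh h0.
have mrig : measurable_fun setT (fun y => (rig eta y * h y)%:E).
  by apply/measurable_EFinP; apply: measurable_funM => //; exact: measurable_rig.
rewrite (@integral_pow R 1 2) //; last by move=> y; rewrite lee_fin mulr_ge0 ?rig_ge0.
rewrite -ge0_integralrZl ?divr_ge0 ?(ltW sqrt2pi_gt0)//; last 2 first.
- apply: measurable_funM.
    apply: (measurableT_comp measurable_gs); apply: measurable_funB => //.
    by apply: measurable_funM => //; exact: measurable_invr.
  by apply: measurableT_comp => //; exact: measurable_funX.
- by move=> y _; rewrite mulr_ge0.
apply: eq_integral => z; rewrite inE/= in_itv/= andbT => z0.
rewrite -!EFinM [rig _ _ * _ * _]mulrAC rigE// mul1r (@powR_mulrn _ z 2) ?ltW//.
by rewrite mulrA.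
Qed.

Let measurable_gs_sub eta : measurable_fun setT (fun z => gs (z - eta / z)).
Proof.
apply: (measurableT_comp measurable_gs); apply: measurable_funB => //.
by apply: measurable_funM => //; exact: measurable_invr.
Qed.

Let measurable_V2 eta : measurable_fun setT (fun z : R => eta / z ^+ 2).
Proof.
apply: measurable_funM => //; apply: (measurableT_comp (@measurable_invr R)).
exact: measurable_funX.
Qed.

(** The involution [z |-> eta / z] only changes the sign of [z - eta / z], and its Jacobian is
    [eta / z^2]. *)
Let integral_gs_flip eta : 0 < eta -> (\int[leb]_(z in pos) (gs (z - eta / z))%:E =
    \int[leb]_(z in pos) (gs (z - eta / z) * (eta / z ^+ 2))%:E)%E.
Proof.
move=> e0; have ms := measurable_gs_sub eta.
have mse : measurable_fun setT (EFin \o (fun z => gs (z - eta / z))) by exact/measurable_EFinP.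
  rewrite (@integral_pow R eta (-1) (fun z => (gs (z - eta / z))%:E)) ?oppr_eq0 ?oner_eq0//; last first.
    by move=> z; rewrite lee_fin.
  apply: eq_integral => z; rewrite inE/= in_itv/= andbT => z0.
  rewrite -EFinM normrN1 mulr1 powR_inv1 ?ltW//.
  have -> : (-1 - 1 = - 2 :> R) by ring.
  rewrite (@powR_invn _ z 2) ?ltW//; congr ((expR _ * _)%:E).
  by field; rewrite !gt_eqF.
Qed.

Let integral_gs_sub eta : 0 <= eta ->
  (\int[leb]_(z in pos) (gs (z - eta / z))%:E = (Num.sqrt (2 * pi) / 2)%:E)%E.
Proof.
have half (I : \bar R) : (I + I = (Num.sqrt (2 * pi))%:E)%E -> I = (Num.sqrt (2 * pi) / 2)%:E.
  by case: I => //= x; rewrite -EFinD => -[] H; congr EFin; lra.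
have mg : measurable_fun setT (fun z => (gs z)%:E) by exact/measurable_EFinP.
rewrite le_eqVlt => /predU1P[<-|e0]; apply: half.
  under eq_integral do rewrite mul0r subr0.
  rewrite -integral_gs (@ge0_symfun_integralT _ gs)//; last 2 first.
  - move=> x; apply: continuous_comp; last exact: continuous_expR.
    apply: cvgM; last exact: cvg_cst.
    by apply: cvgN; exact: exprn_continuous.
  - by move=> x; rewrite /gs /= sqrrN.
  rewrite (_ : [set x | 0 <= x] = `[0, +oo[); last first.
    by apply/seteqP; split => x /=; rewrite in_itv/= andbT.
  rewrite -integral_itv_obnd_cbnd; last exact: (measurable_funTS mg).
  by rewrite mule_natl mule2n.
(* The integral plus its flipped form carries the weight [1 + eta / z^2], the derivative of
   [z - eta / z]; twice the integral is thus a full Gaussian integral. *)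
rewrite {2}integral_gs_flip// -ge0_integralrD//; last 3 first.
- exact: measurable_gs_sub.
- by apply: measurable_funM; [exact: measurable_gs_sub|exact: measurable_V2].
- by move=> z _; rewrite mulr_ge0// divr_ge0 ?sqr_ge0// ltW.
have gs0 z : (0 <= (gs z)%:E)%E by rewrite lee_fin.
rewrite -integral_gs (@integral_subst_subV R 1 eta (fun z => (gs z)%:E) ltr01 e0 mg gs0).
by apply: eq_integral => z _; rewrite -EFinM !mul1r mulrDr mulr1.
Qed.

Lemma integral_rig eta : 0 <= eta -> (\int[leb]_(y in pos) (rig eta y)%:E = 1)%E.
Proof.
move=> e0; under eq_integral do rewrite -[rig _ _]mulr1.
rewrite (integral_rigE _ (h := cst 1))//; under eq_integral do rewrite mulr1.
by rewrite integral_gs_sub// -EFinM; congr EFin; field; rewrite gt_eqF.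
Qed.

(** After [y = z^2] the factor [1 / y] is [eta^-1] times the flip weight [eta / z^2], so the flip
    turns the mean into [eta^-1] times the total mass. The absolute value keeps the integrand
    nonnegative on the whole line. *)
Lemma integral_rigV eta : 0 < eta ->
  (\int[leb]_(y in pos) (rig eta y * `|y^-1|)%:E = (eta^-1)%:E)%E.
Proof.
move=> e0; rewrite (integral_rigE _ (h := fun y => `|y^-1|))//; last first.
  by apply: measurableT_comp => //; exact: measurable_invr.
transitivity ((2 / Num.sqrt (2 * pi))%:E * (eta^-1%:E *
    \int[leb]_(z in pos) (gs (z - eta / z) * (eta / z ^+ 2))%:E))%E.
  congr (_ * _)%E; rewrite -ge0_integralrZl ?invr_ge0 ?(ltW e0)//; last 2 first.
  - by apply: measurable_funM; [exact: measurable_gs_sub|exact: measurable_V2].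
  - by move=> z _; rewrite mulr_ge0// divr_ge0 ?sqr_ge0// ltW.
  apply: eq_integral => z; rewrite inE/= in_itv/= andbT => z0.
  rewrite ger0_norm ?invr_ge0 ?sqr_ge0//; congr EFin; field; rewrite !gt_eqF//.
rewrite -integral_gs_flip// integral_gs_sub ?ltW// -!EFinM; congr EFin; field.
by rewrite !gt_eqF.
Qed.

End InverseGaussian.

Section Tonelli.
Local Open Scope classical_set_scope.
Context (R : realType) d1 d2 (T1 : measurableType d1) (T2 : measurableType d2).
Context (m1 : {sigma_finite_measure set T1 -> \bar R}) (m2 : {sigma_finite_measure set T2 -> \bar R}).

Lemma tonelli1_in (D1 : set T1) (D2 : set T2) (f : T1 -> T2 -> \bar R) :
  measurable D1 -> measurable D2 ->
  measurable_fun setT (fun p => f p.1 p.2) -> (forall x y, 0 <= f x y)%E ->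
  (\int[m1 \x m2]_(p in D1 `*` D2) f p.1 p.2 = \int[m1]_(x in D1) \int[m2]_(y in D2) f x y)%E.
Proof.
move=> mD1 mD2 mf f0.
pose F p := (f p.1 p.2 * ((\1_D1 p.1 : R)%:E * (\1_D2 p.2 : R)%:E))%E.
have mF : measurable_fun setT F.
  apply: emeasurable_funM => //; apply: emeasurable_funM; apply/measurable_EFinP.
    exact: measurableT_comp.
  exact: measurableT_comp.
have F0 p : (0 <= F p)%E by rewrite mule_ge0// -EFinM lee_fin mulr_ge0.
transitivity (\int[m1 \x m2]_p F p)%E.
  rewrite integral_mkcond; apply: eq_integral => -[x y] _; rewrite patchE /F /= !indicE.
  rewrite in_setX /=.
  by case: (x \in D1); case: (y \in D2); rewrite ?mule1 ?mule0.
rewrite (fubini_tonelli1 F)// /fubini_F /F /=.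
rewrite [RHS]integral_mkcond; apply: eq_integral => x _; rewrite patchE.
case: ifPn => xD; rewrite /F /= indicE ?xD ?(negPf xD).
  rewrite [RHS]integral_mkcond; apply: eq_integral => y _; rewrite patchE indicE.
  by case: ifPn => yD; rewrite mul1e ?mule1 ?mule0.
by rewrite integral0_eq// => y _; rewrite mul0e mule0.
Qed.

Lemma tonelli_in (D1 : set T1) (D2 : set T2) (f : T1 -> T2 -> \bar R) :
  measurable D1 -> measurable D2 ->
  measurable_fun setT (fun p => f p.1 p.2) -> (forall x y, 0 <= f x y)%E ->
  (\int[m1]_(x in D1) \int[m2]_(y in D2) f x y = \int[m2]_(y in D2) \int[m1]_(x in D1) f x y)%E.
Proof.
move=> mD1 mD2 mf f0.
pose F p := (f p.1 p.2 * ((\1_D1 p.1 : R)%:E * (\1_D2 p.2 : R)%:E))%E.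
have mF : measurable_fun setT F.
  apply: emeasurable_funM => //; apply: emeasurable_funM; apply/measurable_EFinP.
    exact: measurableT_comp.
  exact: measurableT_comp.
have F0 p : (0 <= F p)%E by rewrite mule_ge0// -EFinM lee_fin mulr_ge0.
have := fubini_tonelli (m1 := m1) (m2 := m2) F mF F0.
rewrite /F /=.
have -> : (\int[m1]_(x in D1) \int[m2]_(y in D2) f x y = \int[m1]_x \int[m2]_y F (x, y))%E.
  rewrite integral_mkcond; apply: eq_integral => x _; rewrite patchE.
  case: ifPn => xD; rewrite /F /= indicE ?xD ?(negPf xD).
    rewrite integral_mkcond; apply: eq_integral => y _; rewrite patchE indicE.
    by case: ifPn => yD; rewrite mul1e ?mule1 ?mule0.
  by rewrite integral0_eq// => y _; rewrite mul0e mule0.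
move=> ->; apply/esym.
rewrite integral_mkcond; apply: eq_integral => y _; rewrite patchE.
case: ifPn => yD; rewrite /F /= indicE ?yD ?(negPf yD).
  rewrite integral_mkcond; apply: eq_integral => x _; rewrite patchE indicE.
  by case: ifPn => xD; rewrite mule1 ?mule1 ?mule0.
by rewrite integral0_eq// => x _; rewrite !mule0.
Qed.
End Tonelli.

Lemma integral_gt0 (R : realType) d (T : measurableType d) (m : {measure set T -> \bar R})
    (D : set T) (f : T -> R) : measurable D -> measurable_fun D f ->
  (forall x, D x -> 0 < f x) -> m D != 0%E -> (0 < \int[m]_(x in D) (f x)%:E)%E.
Proof.
move=> mD mf f0 mD0; rewrite lt_neqAle integral_ge0 ?andbT; last first.
  by move=> x Dx; rewrite lee_fin ltW// f0.
apply: contraNN mD0 => /eqP I0.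
have H : (\int[m]_(x in D) `|(f x)%:E| = 0)%E.
  rewrite {}I0; apply: eq_integral => x; rewrite inE => Dx.
  by rewrite gee0_abs// lee_fin ltW// f0.
have mfE : measurable_fun D (EFin \o f) by exact/measurable_EFinP.
have [N [mN N0 DN]] := (ae_eq_integral_abs m mD mfE).1 H.
rewrite eq_le measure_ge0 andbT -N0 le_measure ?inE// => x Dx; apply: DN => /=.
by move=> /(_ Dx) [] /eqP; rewrite gt_eqF// f0.
Qed.

(** * Gamma integrals and the constant [C_alpha] *)

Section GammaIntegrals.
Local Open Scope classical_set_scope.
Context (R : realType).
Local Notation leb := (@lebesgue_measure R).
Local Notation pos := `]0, +oo[%classic.

Lemma integral_expN : (\int[leb]_(t in pos) (expR (- t))%:E = 1)%E.
Proof.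
rewrite -(@integral_exponential_pdf R 1 ltr01).
rewrite [in RHS](_ : (fun x => _) = ((fun t => (expR (- t))%:E) \_ `[0%R, +oo[)); last first.
  apply/funext => x; rewrite /exponential_pdf !patchE; case: ifPn => // _.
  by rewrite mul1r mulN1r.
rewrite -integral_mkcond -integral_itv_obnd_cbnd//.
by apply: measurable_funTS; apply/measurable_EFinP; exact: measurableT_comp.
Qed.

(** The substitution [t = z^(1/s)] removes the singularity at 0, and [z <= 1 + z^(1/s)], valid since
    [1 <= 1/s], bounds what remains by a multiple of [exp (- z)]. *)
Lemma integral_powR_expN (s : R) : 0 < s <= 1 ->
  (\int[leb]_(t in pos) (t `^ (s - 1) * expR (- t))%:E < +oo)%E.
Proof.
move=> /andP[s0 s1].
have mg : measurable_fun setT (fun t : R => t `^ (s - 1) * expR (- t)).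
  by apply: measurable_funM => //; exact: measurableT_comp.
have g0 (t : R) : 0 <= t `^ (s - 1) * expR (- t).
  by rewrite mulr_ge0 ?powR_ge0 ?expR_ge0.
have mEg : measurable_fun setT (fun t : R => (t `^ (s - 1) * expR (- t))%:E).
  exact/measurable_EFinP.
have sV : s^-1 != 0 by rewrite invr_eq0 gt_eqF.
rewrite (@integral_pow R 1 s^-1 _ ltr01 sV mEg) //.
have mexp : measurable_fun setT (fun t : R => expR (- t)) by exact: measurableT_comp.
apply: (@le_lt_trans _ _ (\int[leb]_(t in pos) ((s^-1 * expR 1) * expR (- t))%:E)%E); last first.
  by rewrite ge0_integralrZl ?mulr_ge0 ?invr_ge0 ?expR_ge0 ?(ltW s0)// integral_expN -EFinM ltry.
have mT (x : R) : measurable_fun setT (fun z : R => z `^ x) by exact: measurable_powR.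
apply: (@le_trans _ _ (\int[leb]_(t in pos) (s^-1 * expR (- t `^ s^-1))%:E)%E).
  rewrite le_eqVlt; apply/orP; left; apply/eqP; apply: eq_integral => z.
  rewrite inE/= in_itv/= andbT => z0; rewrite -EFinM; congr EFin.
  rewrite !mul1r ger0_norm ?invr_ge0 ?(ltW s0)// -powRrM.
  have -> : s^-1 * (s - 1) = - (s^-1 - 1) by field; rewrite gt_eqF.
  have : z `^ (s^-1 - 1) != 0 by rewrite gt_eqF// powR_gt0.
  rewrite powRN; move: (z `^ (s^-1 - 1)) (expR _) => q E q0.
  by field; rewrite q0 gt_eqF.
apply: (@ge0_le_integralr R _ _ leb pos _ (fun t : R => s^-1 * expR (- t `^ s^-1))
  (fun t : R => s^-1 * expR 1 * expR (- t))) => //.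
- apply: measurable_funM => //; apply: measurableT_comp; first exact: measurable_expR.
  exact: measurableT_comp.
- by apply: measurable_funM.
- by move=> z _; rewrite mulr_ge0 ?invr_ge0 ?expR_ge0 ?(ltW s0).
- move=> z; rewrite /= in_itv/= andbT => z0.
  rewrite -mulrA ler_pM2l ?invr_gt0// -expRD ler_expR.
  have [z1|z1] := leP z 1; first by have := powR_ge0 z s^-1; lra.
  suff : z <= z `^ s^-1 by lra.
  rewrite -{1}(powRr1 (ltW z0)); apply: ler_powR; first exact: ltW.
  by rewrite invf_ge1.
Qed.

(** Under [y = 2 t] the density [rig 0] is the Gamma density of shape 1/2. *)
Lemma integral_rig0E (h : R -> R) : measurable_fun setT h -> (forall y, 0 <= h y) ->
  (\int[leb]_(y in pos) (rig 0 y * h y)%:E =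
   ((Num.sqrt pi)^-1)%:E * \int[leb]_(t in pos) (t `^ (- (1 / 2)) * expR (- t) * h (2 * t))%:E)%E.
Proof.
move=> mh h0.
have mg : measurable_fun setT (fun y => (rig 0 y * h y)%:E).
  by apply/measurable_EFinP; apply: measurable_funM => //; exact: measurable_rig.
rewrite (@integral_pow R 2 1 _ _ _ mg)//; last by move=> y; rewrite lee_fin mulr_ge0 ?rig_ge0.
rewrite -ge0_integralrZl ?invr_ge0 ?sqrtr_ge0//; last 2 first.
- apply: measurable_funM; last by apply: measurableT_comp => //; exact: measurable_funM.
  by apply: measurable_funM => //; exact: measurableT_comp.
- by move=> y _; rewrite !mulr_ge0 ?powR_ge0 ?expR_ge0.
apply: eq_integral => t; rewrite inE/= in_itv/= andbT => t0.
rewrite -EFinM subrr powRr0 powRr1 ?ltW// normr1 !mulr1 mulrAC mulrA; congr (_ * _)%:E.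
rewrite /rig subr0.
have -> : - (2 * t) ^+ 2 / (2 * (2 * t)) = - t by field; rewrite gt_eqF.
have -> : 2 * pi * (2 * t) = 2 ^+ 2 * (pi * t) by ring.
have p0 : 0 <= pi :> R := pi_ge0 R.
rewrite powRM ?sqr_ge0 ?mulr_ge0 ?(ltW t0)// powRM ?(ltW t0)//.
rewrite !powRN !mul1r !powR12_sqrt ?(ltW t0)// sqrtr_sqr ger0_norm//.
by move: (expR _) (Num.sqrt pi)^-1 (Num.sqrt t)^-1 => E p q; field.
Qed.

Lemma integral_rig0_powR (a : R) : 0 <= a < 1 / 2 ->
  (\int[leb]_(y in pos) (rig 0 y * y `^ (- a))%:E = (C_alpha a)%:E)%E.
Proof.
move=> /andP[a0 a1].
rewrite (integral_rig0E (h := fun y => y `^ (- a))); last 2 first.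
- exact: measurable_powR.
- by move=> y; exact: powR_ge0.
have mg : measurable_fun setT (fun t : R => t `^ (1 / 2 - a - 1) * expR (- t)).
  by apply: measurable_funM => //; exact: measurableT_comp.
transitivity (((Num.sqrt pi)^-1)%:E * (((2 `^ (- a)))%:E *
   \int[leb]_(t in pos) (t `^ (1 / 2 - a - 1) * expR (- t))%:E))%E.
  congr (_ * _)%E; rewrite -ge0_integralrZl ?powR_ge0//; last first.
    by move=> t _; rewrite mulr_ge0 ?powR_ge0 ?expR_ge0.
  apply: eq_integral => t; rewrite inE/= in_itv/= andbT => t0.
  have -> : 1 / 2 - a - 1 = - (1 / 2) - a :> R by lra.
  rewrite powRM ?(ltW t0)// [t `^ (- _ - _)]powRD ?(gt_eqF t0) ?implybT//.
  by congr EFin; ring.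
rewrite /C_alpha /Gamma /Rintegral.
(* [Gamma] is the real part of an extended-real integral, so finiteness is required to recover the
   integral from it. *)
rewrite -{1}[(\int[leb]_(t in pos) _)%E]fineK; last first.
  rewrite ge0_fin_numE; first by apply: integral_powR_expN; lra.
  by apply: integral_ge0 => t _; rewrite lee_fin mulr_ge0 ?powR_ge0 ?expR_ge0.
by rewrite -!EFinM; congr EFin; ring.
Qed.

Lemma C_alpha_gt0 (a : R) : 0 <= a < 1 / 2 -> 0 < C_alpha a.
Proof.
move=> /integral_rig0_powR I; rewrite -lte_fin -I; apply: integral_gt0 => //.
- apply: measurable_funTS; apply: measurable_funM; last exact: measurable_powR.
  exact: measurable_rig.
- by move=> y; rewrite /= in_itv/= andbT => y0; rewrite mulr_gt0 ?rig_gt0 ?powR_gt0.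
- have posy : leb pos = +oo%E.
    by apply: (etrans (lebesgue_measure_itv `]0, +oo[%R)); rewrite /= ltry.
  by apply/eqP => H; have := etrans (esym H) posy.
Qed.

Lemma C_alpha0 : C_alpha 0 = 1 :> R.
Proof.
apply: EFin_inj; rewrite -integral_rig0_powR; last by apply/andP; split; lra.
rewrite -(integral_rig (lexx 0)).
by apply: eq_integral => y _; rewrite oppr0 powRr0 mulr1.
Qed.

End GammaIntegrals.

(** * Comparison of [rig eta] with [rig 0] *)

Section Crossing.
Local Open Scope classical_set_scope.
Context (R : realType).
Local Notation leb := (@lebesgue_measure R).
Local Notation pos := `]0, +oo[%classic.
Implicit Types (eta y : R).

(** [rig eta] is an exponential tilt of [rig 0]; for positive [eta] the exponent changes sign only
    at [y = eta / 2]. *)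
Lemma rig_exp eta y : 0 < y -> rig eta y = rig 0 y * expR (eta - eta ^+ 2 / (2 * y)).
Proof.
move=> y0; rewrite /rig -[RHS]mulrA -expRD; congr (_ * expR _).
by field; rewrite gt_eqF.
Qed.

Let cross eta y : 0 < y -> (eta - eta ^+ 2 / (2 * y)) = eta * (y - eta / 2) / y.
Proof. by move=> y0; field; rewrite gt_eqF. Qed.

Lemma rig_le_rig0 eta y : 0 <= eta -> 0 < y -> y <= eta / 2 -> rig eta y <= rig 0 y.
Proof.
move=> e0 y0 ye; rewrite rig_exp// ler_piMr ?rig_ge0// -[leRHS]expR0 ler_expR cross//.
by rewrite mulr_le0_ge0 ?invr_ge0 ?(ltW y0)// mulr_ge0_le0// subr_le0.
Qed.

Lemma rig0_le_rig eta y : 0 <= eta -> 0 < y -> eta / 2 <= y -> rig 0 y <= rig eta y.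
Proof.
move=> e0 y0 ye; rewrite [leRHS]rig_exp// ler_peMr ?rig_ge0// -[leLHS]expR0 ler_expR cross//.
by rewrite divr_ge0 ?(ltW y0)// mulr_ge0// subr_ge0.
Qed.

(* [rig eta] dominates [rig 0] exactly to the right of [eta / 2], so for a
   nonincreasing [g] the product of [g y - g (eta / 2)] with [rig eta y - rig 0 y]
   is nonpositive; here [g = gp - gm] is split to keep all integrands nonnegative. *)
Lemma rig_crossing eta (gp gm : R -> R) : 0 < eta ->
  measurable_fun setT gp -> measurable_fun setT gm ->
  (forall y, 0 <= gp y) -> (forall y, 0 <= gm y) ->
  (forall x y, 0 < x -> x <= y -> gp y - gm y <= gp x - gm x) ->
  (\int[leb]_(y in pos) (rig eta y * gp y)%:E + \int[leb]_(y in pos) (rig 0 y * gm y)%:E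
   <= \int[leb]_(y in pos) (rig 0 y * gp y)%:E + \int[leb]_(y in pos) (rig eta y * gm y)%:E)%E.
Proof.
move=> e0 mgp mgm gp0 gm0 gmono.
have e20 : 0 < eta / 2 by rewrite divr_gt0.
pose cp := gp (eta / 2); pose cm := gm (eta / 2).
have cp0 : 0 <= cp := gp0 _; have cm0 : 0 <= cm := gm0 _.
have mr e : measurable_fun setT (fun y : R => rig e y) by exact: measurable_rig.
have mM e (h : R -> R) : measurable_fun setT h -> measurable_fun setT (fun y => rig e y * h y).
  by move=> mh; apply: measurable_funM.
have r0 e y : 0 <= rig e y by exact: rig_ge0.
have cst e (c : R) : 0 <= e -> 0 <= c -> (\int[leb]_(y in pos) (rig e y * c)%:E = c%:E)%E.
  move=> ee c0; transitivity (c%:E * \int[leb]_(y in pos) (rig e y)%:E)%E.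
    rewrite -ge0_integralrZl//; last exact: mr.
    by apply: eq_integral => y _; rewrite mulrC.
  by rewrite integral_rig// mule1.
(* Both densities have mass 1, so a constant may be integrated against either. Adding [cp + cm] on
   both sides, spread differently over the two densities, makes the inequality hold pointwise. *)
suff : (\int[leb]_(y in pos) (rig eta y * gp y)%:E + \int[leb]_(y in pos) (rig 0 y * gm y)%:E
      + (cp + cm)%:E <=
    \int[leb]_(y in pos) (rig 0 y * gp y)%:E + \int[leb]_(y in pos) (rig eta y * gm y)%:E
      + (cp + cm)%:E)%E.
  by rewrite leeD2rE.
have iD (u v w z : R -> R) :
    measurable_fun setT u -> measurable_fun setT v -> measurable_fun setT w ->
    measurable_fun setT z -> (forall y, 0 <= u y) -> (forall y, 0 <= v y) ->
    (forall y, 0 <= w y) -> (forall y, 0 <= z y) ->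
    (\int[leb]_(y in pos) (u y + v y + (w y + z y))%:E = \int[leb]_(y in pos) (u y)%:E +
    \int[leb]_(y in pos) (v y)%:E + (\int[leb]_(y in pos) (w y)%:E +
    \int[leb]_(y in pos) (z y)%:E))%E.
  move=> mu mv mw mz u0 v0 w0 z0.
  rewrite ge0_integralrD//; last 4 first.
  - exact: measurable_funD.
  - exact: measurable_funD.
  - by move=> y _; rewrite addr_ge0.
  - by move=> y _; rewrite addr_ge0.
  by rewrite !ge0_integralrD.
have -> : ((cp + cm)%:E = \int[leb]_(y in pos) (rig 0 y * cp)%:E +
    \int[leb]_(y in pos) (rig eta y * cm)%:E)%E by rewrite !cst ?(ltW e0).
rewrite -iD//; do ?[exact: mM | by move=> y; rewrite mulr_ge0].
have -> : (\int[leb]_(y in pos) (rig 0 y * cp)%:E +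
    \int[leb]_(y in pos) (rig eta y * cm)%:E = \int[leb]_(y in pos) (rig eta y * cp)%:E +
    \int[leb]_(y in pos) (rig 0 y * cm)%:E)%E by rewrite !cst ?(ltW e0).
rewrite -iD//; do ?[exact: mM | by move=> y; rewrite mulr_ge0].
apply: (@ge0_le_integralr R _ _ leb pos _
  (fun y => rig eta y * gp y + rig 0 y * gm y + (rig 0 y * cp + rig eta y * cm))
  (fun y => rig 0 y * gp y + rig eta y * gm y + (rig eta y * cp + rig 0 y * cm))) => //.
- by apply: measurable_funD; apply: measurable_funD; exact: mM.
- by apply: measurable_funD; apply: measurable_funD; exact: mM.
- by move=> y _; do !apply: addr_ge0; apply: mulr_ge0.
move=> y; rewrite /= in_itv/= andbT => y0.
have [ye|ey] := leP y (eta / 2).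
  have := rig_le_rig0 (ltW e0) y0 ye; have := gmono _ _ y0 ye; rewrite -/cp -/cm; nra.
have := rig0_le_rig (ltW e0) y0 (ltW ey); have := gmono _ _ e20 (ltW ey); rewrite -/cp -/cm; nra.
Qed.

Lemma integral_rig_powR_le eta (a : R) : 0 < eta -> 0 <= a < 1 / 2 ->
  (\int[leb]_(y in pos) (rig eta y * y `^ (- a))%:E <= (C_alpha a)%:E)%E.
Proof.
move=> e0 a01; rewrite -integral_rig0_powR//; have /andP[a0 _] := a01.
have := @rig_crossing eta (fun y => y `^ (- a)) (fun=> 0) e0 (@measurable_powR _ _) (measurable_cst _).
rewrite (_ : (\int[leb]_(y in pos) (rig 0 y * 0)%:E)%E = 0%E); last first.
  by rewrite integral0_eq// => y _; rewrite mulr0.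
rewrite (_ : (\int[leb]_(y in pos) (rig eta y * 0)%:E)%E = 0%E); last first.
  by rewrite integral0_eq// => y _; rewrite mulr0.
rewrite !adde0; apply => //.
  by move=> y; exact: powR_ge0.
move=> x y x0 xy; rewrite !subr0 !powRN lef_pV2 ?posrE ?powR_gt0//; last exact: lt_le_trans xy.
by apply: ge0_ler_powR => //; rewrite nnegrE; lra.
Qed.

End Crossing.

(** * The logarithmic mean of the pivot law *)

Section Digamma.
Local Open Scope classical_set_scope.
Context (R : realType).
Local Notation leb := (@lebesgue_measure R).
Local Notation pos := `]0, +oo[%classic.
Implicit Types (x y t v : R).

(** Logarithms are carried as two nonnegative parts, so that every integral makes sense in the
    extended reals without an integrability condition. *)
Definition lnp x : R := Num.max (ln x) 0.
Definition lnm x : R := Num.max (- ln x) 0.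

Lemma lnp_ge0 x : 0 <= lnp x. Proof. by rewrite /lnp le_max lexx orbT. Qed.
Lemma lnm_ge0 x : 0 <= lnm x. Proof. by rewrite /lnm le_max lexx orbT. Qed.

Lemma lnpBlnm x : lnp x - lnm x = ln x.
Proof. by rewrite /lnp /lnm; case: (leP (ln x) 0); case: (leP (- ln x) 0); lra. Qed.

Lemma measurable_lnp : measurable_fun setT lnp.
Proof. by apply: measurable_maxr => //; exact: measurable_ln. Qed.

Lemma measurable_lnm : measurable_fun setT lnm.
Proof.
by apply: measurable_maxr => //; apply: measurableT_comp => //; exact: measurable_ln.
Qed.

(* Half-Cauchy density. *)
Let kappa v : R := 2 / pi / (1 + v ^+ 2).

Let v2_gt0 v : 0 < 1 + v ^+ 2.
Proof. by rewrite ltr_pwDl ?sqr_ge0. Qed.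

Let kappa_ge0 v : 0 <= kappa v.
Proof. by rewrite !divr_ge0 ?pi_ge0// ltW. Qed.

Let measurable_v2V : measurable_fun setT (fun v : R => (1 + v ^+ 2)^-1).
Proof.
apply: (measurableT_comp (@measurable_invr R)).
by apply: measurable_funD => //; exact: measurable_funX.
Qed.

Let measurable_kappa : measurable_fun setT kappa.
Proof. exact: measurable_funM. Qed.

(** Total mass of [rig 0] after the substitution [y = 2 x v^2]. *)
Let integral_gauss_scaled x : 0 < x ->
  (\int[leb]_(v in pos) (2 * x / Num.sqrt (pi * x) * expR (- (x * v ^+ 2)))%:E = 1)%E.
Proof.
move=> x0; rewrite -(integral_rig (lexx 0)).
have mg : measurable_fun setT (fun y : R => (rig 0 y)%:E).
  by apply/measurable_EFinP; exact: measurable_rig.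
have x20 : 0 < 2 * x by rewrite mulr_gt0.
rewrite (@integral_pow R (2 * x) 2 _ x20 _ mg)//; last by move=> y; rewrite lee_fin rig_ge0.
apply: eq_integral => v; rewrite inE/= in_itv/= andbT => v0.
rewrite -EFinM; congr EFin.
have -> : (2 - 1 = 1 :> R) by ring.
rewrite powRr1 ?ltW// (@powR_mulrn _ v 2) ?ltW// ger0_norm// /rig subr0.
have p0 : 0 <= pi :> R := pi_ge0 R.
have -> : - (2 * x * v ^+ 2) ^+ 2 / (2 * (2 * x * v ^+ 2)) = - (x * v ^+ 2).
  by field; rewrite !gt_eqF.
have -> : 2 * pi * (2 * x * v ^+ 2) = (2 * v) ^+ 2 * (pi * x) by ring.
rewrite powRM ?sqr_ge0 ?mulr_ge0 ?(ltW x0)// !powRN mul1r !powR12_sqrt ?sqr_ge0 ?mulr_ge0 ?(ltW x0)//.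
rewrite sqrtr_sqr ger0_norm ?mulr_ge0 ?(ltW v0)//.
by move: (expR _) (Num.sqrt (pi * x))^-1 => E q; field; rewrite gt_eqF.
Qed.

(* A chi-square variable with one degree of freedom has the law of
   [2 T / (1 + V^2)], with [T] exponential and [V] half-Cauchy, independent. *)
Lemma rig0_mixture (h : R -> R) : measurable_fun setT h -> (forall y, 0 <= h y) ->
  (\int[leb]_(y in pos) (rig 0 y * h y)%:E =
   \int[leb]_(v in pos) ((kappa v)%:E *
     \int[leb]_(t in pos) (expR (- t) * h (2 * (t / (1 + v ^+ 2))))%:E))%E.
Proof.
move=> mh h0; rewrite integral_rig0E//.
pose F x v := ((2 / pi * expR (- (x * (1 + v ^+ 2))) * h (2 * x))%:E : \bar R).
have mF : measurable_fun setT (fun p : R * R => F p.1 p.2).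
  apply/measurable_EFinP; apply: measurable_funM; last first.
    by apply: measurableT_comp => //; apply: measurable_funM => //; exact: measurable_fst.
  apply: measurable_funM => //; apply: measurableT_comp; first exact: measurable_expR.
  apply: measurableT_comp => //; apply: measurable_funM; first exact: measurable_fst.
  apply: measurable_funD => //; apply: measurable_funX; exact: measurable_snd.
have F0 x v : (0 <= F x v)%E.
  by rewrite lee_fin mulr_ge0// mulr_ge0 ?expR_ge0// divr_ge0 ?pi_ge0.
transitivity (\int[leb]_(x in pos) \int[leb]_(v in pos) F x v)%E.
  rewrite -ge0_integralrZl ?invr_ge0 ?sqrtr_ge0//; last 2 first.
  - apply: measurable_funM; last by apply: measurableT_comp => //; exact: measurable_funM.
    by apply: measurable_funM => //; exact: measurableT_comp.
  - by move=> y _; rewrite !mulr_ge0 ?powR_ge0 ?expR_ge0.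
  apply: eq_integral => x; rewrite inE/= in_itv/= andbT => x0.
  have p0 : 0 < pi :> R := pi_gt0 R.
  set A := _^-1 * _.
  have A0 : 0 <= A by rewrite !mulr_ge0 ?invr_ge0 ?sqrtr_ge0 ?powR_ge0 ?expR_ge0.
  (* The inserted Gaussian integral in [v] cancels the factor [x^(-1/2)] of the Gamma density and
     leaves an exponential in [x] of rate [1 + v^2], to be rescaled after the exchange of
     integrals. *)
  rewrite -[A in LHS]mulr1 EFinM -(integral_gauss_scaled x0) -ge0_integralrZl//; last 2 first.
  - apply: measurable_funM => //; apply: measurableT_comp; first exact: measurable_expR.
    apply: measurableT_comp => //; apply: measurable_funM => //; exact: measurable_funX.
  - by move=> v _; rewrite !mulr_ge0 ?invr_ge0 ?sqrtr_ge0 ?expR_ge0// ltW.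
  apply: eq_integral => v _; rewrite /F /A; congr EFin.
  rewrite mulrDr mulr1 opprD expRD powRN mul1r powR12_sqrt ?(ltW x0)// sqrtrM ?(ltW p0)//.
  have -> : 2 * x = 2 * Num.sqrt x ^+ 2 by rewrite sqr_sqrtr// ltW.
  have -> : 2 / pi = 2 / Num.sqrt pi ^+ 2 :> R by rewrite sqr_sqrtr// ltW.
  have := sqrtr_gt0 x; have := sqrtr_gt0 (pi : R); rewrite x0 p0.
  by move=> q0 pp; field; rewrite !gt_eqF.
rewrite (@tonelli_in R _ _ _ _ leb leb pos pos F)//.
apply: eq_integral => v _.
have mg : measurable_fun setT (F^~ v).
  exact: (measurableT_comp mF (pair2_measurable v)).
have c0 : 0 < (1 + v ^+ 2)^-1 by rewrite invr_gt0.
rewrite (@integral_pow R _ 1 _ c0 (oner_neq0 _) mg)// -ge0_integralrZl//; last 2 first.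
- apply: measurable_funM; first exact: measurableT_comp.
  by apply: measurableT_comp => //; apply: measurable_funM => //; exact: measurable_funM.
- by move=> t _; rewrite mulr_ge0 ?expR_ge0.
apply: eq_integral => t; rewrite inE/= in_itv/= andbT => t0.
rewrite -EFinM subrr powRr0 powRr1 ?(ltW t0)// normr1 !mulr1 [_^-1 * t]mulrC divfK ?gt_eqF//.
by rewrite /kappa; congr EFin; move: (_^-1) (expR _) (h _) (_^-1) => a b c e; ring.
Qed.

Let integral_kappa : (\int[leb]_(v in pos) (kappa v)%:E = 1)%E.
Proof.
rewrite -(integral_rig (lexx 0)).
transitivity (\int[leb]_(y in pos) (rig 0 y * cst 1 y)%:E)%E; last first.
  by apply: eq_integral => y _; rewrite mulr1.
rewrite rig0_mixture//; apply: eq_integral => v _.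
rewrite (_ : (\int[leb]_(t in pos) _)%E = 1%E) ?mule1//.
by rewrite -(@integral_expN R); apply: eq_integral => t _; rewrite mulr1.
Qed.

Let lnq v : R := ln (1 + v ^+ 2).

Let lnq_ge0 v : 0 <= lnq v.
Proof. by apply: ln_ge0; rewrite lerDl sqr_ge0. Qed.

Let measurable_lnq : measurable_fun setT lnq.
Proof.
apply: measurableT_comp; first exact: measurable_ln.
by apply: measurable_funD => //; exact: measurable_funX.
Qed.

Let L := (\int[leb]_(v in pos) (kappa v * lnq v)%:E)%E.

(** The half-Cauchy law is invariant under [v |-> 1 / v]. *)
Let integral_kappa_inv : L = (\int[leb]_(v in pos) (kappa v * lnq v^-1)%:E)%E.
Proof.
have mg : measurable_fun setT (fun v => (kappa v * lnq v)%:E).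
  by apply/measurable_EFinP; apply: measurable_funM.
have n10 : (-1 : R) != 0 by rewrite oppr_eq0 oner_eq0.
rewrite /L (@integral_pow R 1 (-1) _ ltr01 n10 mg); last first.
  by move=> v; rewrite lee_fin mulr_ge0.
apply: eq_integral => v; rewrite inE/= in_itv/= andbT => v0.
rewrite -EFinM normrN1 !mul1r powR_inv1 ?(ltW v0)//.
have -> : (-1 - 1 = - 2 :> R) by ring.
rewrite (@powR_invn _ v 2) ?(ltW v0)// mulrAC; congr (_ * _)%:E.
have := v2_gt0 v; rewrite /kappa => q0.
have pn0 : (pi : R) != 0 by rewrite gt_eqF ?pi_gt0.
by move: (pi : R) pn0 => p pn0; field; rewrite pn0 !gt_eqF.
Qed.

(* The doubling map [v |-> (v - 1/v) / 2] carries the half-Cauchy law to the Cauchy law. *)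
Let integral_lnq_double : (L + (2 * ln 2)%:E = L + L)%E.
Proof.
have mk : measurable_fun setT (fun v => kappa v * lnq v) by apply: measurable_funM.
have mkl : measurable_fun setT (fun v => kappa v * lnq v^-1).
  by apply: measurable_funM => //; apply: (measurableT_comp measurable_lnq); exact: measurable_invr.
have h0 : 0 < 2^-1 :> R by rewrite invr_gt0.
have k0 v : 0 <= 2^-1 * (kappa v * lnq v) by apply: mulr_ge0; [exact: ltW|exact: mulr_ge0].
have mg : measurable_fun setT (fun v => (2^-1 * (kappa v * lnq v))%:E).
  by apply/measurable_EFinP; apply: measurable_funM.
have LT : L = (\int[leb]_v (2^-1 * (kappa v * lnq v))%:E)%E.
  rewrite ge0_symfun_integralT//; last 2 first.
  - move=> v; apply: cvgM; first exact: cvg_cst.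
    have cq : (fun v : R => 1 + v ^+ 2) @ v --> 1 + v ^+ 2.
      by apply: cvgD; [exact: cvg_cst|exact: exprn_continuous].
    apply: cvgM.
      apply: cvgM; first exact: cvg_cst.
      by apply: cvgV => //; rewrite gt_eqF.
    by apply: continuous_comp => //; apply: continuous_ln.
  - by move=> v; rewrite /kappa /lnq /= sqrrN.
  rewrite (_ : [set x | 0 <= x] = `[0, +oo[); last first.
    by apply/seteqP; split => x /=; rewrite in_itv/= andbT.
  rewrite -integral_itv_obnd_cbnd; last exact: (measurable_funTS mg).
  rewrite -ge0_integralrZl//; last first.
    by apply: measurable_funM.
  by apply: eq_integral => v _; congr EFin; field.
have nk v : pos v -> 0 <= kappa v * lnq v by move=> _; exact: mulr_ge0.
have nkl v : pos v -> 0 <= kappa v * lnq v^-1 by move=> _; exact: mulr_ge0.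
pose w v : R := 2^-1 * (v - 1 / v).
pose dw v : R := 2^-1 * (1 + 1 / v ^+ 2).
pose f v : R := 2^-1 * (kappa (w v) * lnq (w v)) * dw v.
have mf : measurable_fun setT f.
  apply: measurable_funM.
    apply: (measurableT_comp (f := fun v => 2^-1 * (kappa v * lnq v))).
      by apply: measurable_funM.
    apply: measurable_funM => //; apply: measurable_funB => //.
    by apply: measurable_funM => //; exact: measurable_invr.
  apply: measurable_funM => //; apply: measurable_funD => //.
  apply: measurable_funM => //; apply: (measurableT_comp (@measurable_invr R)).
  exact: measurable_funX.
have f0 v : pos v -> 0 <= f v.
  move=> _; apply: mulr_ge0; first exact: k0.
  by rewrite mulr_ge0 ?(ltW h0)// addr_ge0// divr_ge0// sqr_ge0.
have ln40 : 0 <= 2 * ln 2 :> R by rewrite mulr_ge0 ?ln_ge0//; lra.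
have mc : measurable_fun setT (fun v => 2 * ln 2 * kappa v) by apply: measurable_funM.
have c0 v : pos v -> 0 <= 2 * ln 2 * kappa v by move=> _; exact: mulr_ge0.
have -> : (L + (2 * ln 2)%:E = \int[leb]_(v in pos) (f v + 2 * ln 2 * kappa v)%:E)%E.
  rewrite (@ge0_integralrD _ _ _ leb pos _ f (fun v => 2 * ln 2 * kappa v))//.
  congr (_ + _)%E; last by rewrite ge0_integralrZl// integral_kappa mule1.
  rewrite LT (@integral_subst_subV R 2^-1 1 _ h0 ltr01 mg k0).
  by apply: eq_integral => v _; rewrite -EFinM.
rewrite {2}integral_kappa_inv.
rewrite -(@ge0_integralrD _ _ _ leb pos _ (fun v => kappa v * lnq v) (fun v => kappa v * lnq v^-1))//.
apply: eq_integral => v; rewrite inE/= in_itv/= andbT => v0; congr EFin.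
have q0 := v2_gt0 v; have vn0 : v != 0 by rewrite gt_eqF.
have p0 : (pi : R) != 0 by rewrite gt_eqF ?pi_gt0.
(* This factorisation gives [lnq (w v) = lnq v + lnq (1/v) - 2 ln 2]. As [w] carries the half-Cauchy
   law to the Cauchy law and [lnq] is even, averaging yields [L = 2 L - 2 ln 2], here without
   subtraction. *)
have qw : 1 + w v ^+ 2 = (1 + v ^+ 2) * (1 + v^-1 ^+ 2) / 2 ^+ 2.
  by rewrite /w; field.
have kw : 2^-1 * kappa (w v) * dw v = kappa v.
  rewrite /kappa qw /dw; move: (pi : R) p0 => p p0; field.
  by rewrite p0 vn0 gt_eqF.
have -> : f v = kappa v * lnq (w v) by rewrite -kw /f; ring.
have -> : lnq (w v) = lnq v + lnq v^-1 - 2 * ln 2.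
  rewrite /lnq qw ln_div ?posrE ?mulr_gt0// lnM ?posrE//.
  have -> : ln (2 ^+ 2) = 2 * ln 2 :> R by rewrite expr2 lnM ?posrE//; ring.
  by [].
by ring.
Qed.

Let lnm_le x (k : R) : 0 < x -> 0 < k -> lnm x <= k^-1 * x `^ (- k).
Proof.
move=> x0 k0; rewrite ge_max; apply/andP; split; last first.
  by rewrite mulr_ge0 ?powR_ge0// invr_ge0 ltW.
have := ln_sublinear (powR_gt0 (- k) x0); rewrite ln_powR => H.
by rewrite -(ler_pM2l k0) mulrA mulfV ?gt_eqF// mul1r mulrN -mulNr ltW.
Qed.

Let lnp_le x (k : R) : 0 < x -> 0 < k -> lnp x <= k^-1 * x `^ k.
Proof.
move=> x0 k0; rewrite ge_max; apply/andP; split; last first.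
  by rewrite mulr_ge0 ?powR_ge0// invr_ge0 ltW.
have := ln_sublinear (powR_gt0 k x0); rewrite ln_powR => H.
by rewrite -(ler_pM2l k0) mulrA mulfV ?gt_eqF// mul1r ltW.
Qed.

Let dominated (f g : R -> R) (c : R) : measurable_fun setT f -> measurable_fun setT g ->
  0 <= c -> (forall y, 0 < y -> 0 <= f y) -> (forall y, 0 < y -> 0 <= g y) ->
  (forall y, 0 < y -> f y <= c * g y) -> (\int[leb]_(y in pos) (g y)%:E < +oo)%E ->
  (\int[leb]_(y in pos) (f y)%:E < +oo)%E.
Proof.
move=> mf mg c0 f0 g0 fg gy.
have posE y : pos y -> 0 < y by rewrite /= in_itv/= andbT.
apply: (@le_lt_trans _ _ (\int[leb]_(y in pos) (c * g y)%:E)%E).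
  apply: (@ge0_le_integralr R _ _ leb pos _ f (fun y => c * g y)) => //.
  - exact: measurable_funM.
  - by move=> y /posE /f0.
  - by move=> y /posE /fg.
rewrite ge0_integralrZl//; last by move=> y /posE /g0.
by rewrite lte_mul_pinfty// lee_fin.
Qed.

Let integral_exp_half : (\int[leb]_(t in pos) (expR (- (t / 2)))%:E < +oo)%E.
Proof.
have mg : measurable_fun setT (fun t : R => (expR (- (t / 2)))%:E).
  apply/measurable_EFinP; apply: measurableT_comp; first exact: measurable_expR.
  by apply: measurableT_comp => //; exact: measurable_funM.
have g0 (t : R) : (0 <= (expR (- (t / 2)))%:E)%E by rewrite lee_fin expR_ge0.
rewrite (@integral_pow R 2 1 _ (ltr0Sn _ _) (oner_neq0 _) mg g0).
rewrite (_ : (\int[leb]_(z in pos) _)%E = (2%:E * \int[leb]_(z in pos) (expR (- z))%:E)%E).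
  by rewrite integral_expN mule1 ltry.
rewrite -ge0_integralrZl//; last exact: measurableT_comp.
apply: eq_integral => t; rewrite inE/= in_itv/= andbT => t0.
rewrite -EFinM subrr powRr0 powRr1 ?(ltW t0)// normr1 !mulr1 mulrC; congr (_ * expR _)%:E.
by field.
Qed.

Let mexpN : measurable_fun setT (fun t : R => expR (- t)).
Proof. exact: measurableT_comp. Qed.

Let exp_lnp_fin : (\int[leb]_(t in pos) (expR (- t) * lnp t)%:E < +oo)%E.
Proof.
apply: (dominated (c := 2) _ _ _ _ _ _ integral_exp_half) => //.
- by apply: measurable_funM => //; exact: measurable_lnp.
- apply: measurableT_comp; first exact: measurable_expR.
  by apply: measurableT_comp => //; exact: measurable_funM.
- by move=> y _; rewrite mulr_ge0 ?expR_ge0 ?lnp_ge0.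
move=> y y0; have := lnp_le y0 ltr01; rewrite invr1 mul1r powRr1 ?(ltW y0)// => H.
have -> : expR (- (y / 2)) = expR (- y) * expR (y / 2) by rewrite -expRD; congr expR; field.
rewrite mulrCA ler_pM2l ?expR_gt0//.
by have := expR_ge1Dx (y / 2); lra.
Qed.

Let exp_lnm_fin : (\int[leb]_(t in pos) (expR (- t) * lnm t)%:E < +oo)%E.
Proof.
have h01 : 0 < (1 / 2 : R) <= 1 by lra.
apply: (dominated (c := 2) _ _ _ _ _ _ (integral_powR_expN h01)) => //.
- by apply: measurable_funM => //; exact: measurable_lnm.
- by apply: measurable_funM.
- by move=> y _; rewrite mulr_ge0 ?expR_ge0 ?lnm_ge0.
- by move=> y _; rewrite mulr_ge0 ?powR_ge0 ?expR_ge0.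
move=> y y0; rewrite mulrA [leRHS]mulrC ler_pM2l ?expR_gt0//.
have h0 : 0 < 1 / 2 :> R by lra.
have := lnm_le y0 h0; rewrite (_ : (1 / 2)^-1 = 2); last by field.
by rewrite (_ : 1 / 2 - 1 = - (1 / 2) :> R)//; field.
Qed.

Lemma integral_rig0_lnp_fin : (\int[leb]_(y in pos) (rig 0 y * lnp y)%:E < +oo)%E.
Proof.
apply: (dominated (c := 2 * (2 * pi) `^ (- (1 / 2))) _ _ _ _ _ _ integral_exp_half) => //.
- by apply: measurable_funM; [exact: measurable_rig|exact: measurable_lnp].
- apply: measurableT_comp; first exact: measurable_expR.
  by apply: measurableT_comp => //; exact: measurable_funM.
- by rewrite mulr_ge0 ?powR_ge0.
- by move=> y _; rewrite mulr_ge0 ?rig_ge0 ?lnp_ge0.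
move=> y y0; have h0 : 0 < 1 / 2 :> R by lra.
have := lnp_le y0 h0; rewrite (_ : (1 / 2)^-1 = 2); last by field.
move=> H; rewrite /rig subr0.
have -> : - y ^+ 2 / (2 * y) = - (y / 2) by field; rewrite gt_eqF.
rewrite mulrAC ler_pM2r ?expR_gt0// powRM ?mulr_ge0 ?pi_ge0 ?(ltW y0)// -[leLHS]mulrA [leRHS]mulrC.
rewrite ler_pM2l ?powR_gt0 ?mulr_gt0 ?pi_gt0//.
apply: le_trans (ler_wpM2l (powR_ge0 _ _) H) _.
by rewrite powRN mulrCA mulVf ?mulr1// gt_eqF// powR_gt0.
Qed.

Let integral_rig0_lnm_fin : (\int[leb]_(y in pos) (rig 0 y * lnm y)%:E < +oo)%E.
Proof.
have h01 : 0 <= (1 / 4 : R) < 1 / 2 by lra.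
apply: (@dominated _ (fun y => rig 0 y * y `^ (- (1 / 4))) 4) => //.
- by apply: measurable_funM; [exact: measurable_rig|exact: measurable_lnm].
- by apply: measurable_funM; [exact: measurable_rig|exact: measurable_powR].
- by move=> y _; rewrite mulr_ge0 ?rig_ge0 ?lnm_ge0.
- by move=> y _; rewrite mulr_ge0 ?rig_ge0 ?powR_ge0.
- move=> y y0; rewrite mulrCA ler_pM2l ?rig_gt0//.
  have h0 : 0 < 1 / 4 :> R by lra.
  by have := lnm_le y0 h0; rewrite (_ : (1 / 4)^-1 = 4); last by field.
- by rewrite integral_rig0_powR// ltry.
Qed.

Let mix (H : R * R -> R) :=
  (\int[leb \x leb]_(p in pos `*` pos) (kappa p.1 * (expR (- p.2) * H p))%:E)%E.

Let mweight : measurable_fun setT (fun p : R * R => kappa p.1 * expR (- p.2)).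
Proof.
apply: measurable_funM; first exact: (measurableT_comp measurable_kappa).
exact: (measurableT_comp mexpN).
Qed.

Let mix_measurable (H : R * R -> R) : measurable_fun setT H ->
  measurable_fun setT (fun p : R * R => kappa p.1 * (expR (- p.2) * H p)).
Proof.
move=> mH; rewrite (_ : (fun p => _) = (fun p : R * R => (kappa p.1 * expR (- p.2)) * H p)).
  exact: measurable_funM.
by apply/funext => p; rewrite mulrA.
Qed.

Let mix_ge0 (H : R * R -> R) : (forall p, 0 <= H p) ->
  forall p : R * R, 0 <= kappa p.1 * (expR (- p.2) * H p).
Proof. by move=> H0 p; rewrite mulr_ge0// mulr_ge0 ?expR_ge0. Qed.

Let mixE (H : R * R -> R) : measurable_fun setT H -> (forall p, 0 <= H p) ->
  mix H = (\int[leb]_(v in pos) ((kappa v)%:E *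
     \int[leb]_(t in pos) (expR (- t) * H (v, t))%:E))%E.
Proof.
move=> mH H0; rewrite /mix.
pose f v t := ((kappa v * (expR (- t) * H (v, t)))%:E : \bar R).
have fE : (fun p : R * R => f p.1 p.2) = (fun p => (kappa p.1 * (expR (- p.2) * H p))%:E).
  by apply/funext => -[].
have mf : measurable_fun setT (fun p : R * R => f p.1 p.2).
  by rewrite fE; apply/measurable_EFinP; exact: mix_measurable.
have f0 v t : (0 <= f v t)%E by rewrite lee_fin; exact: (mix_ge0 H0 (v, t)).
rewrite -fE (@tonelli1_in R _ _ _ _ leb leb pos pos f)//.
apply: eq_integral => v _; rewrite ge0_integralrZl//.
- by apply: measurable_funM => //; exact: (measurableT_comp mH).
- by move=> t _; rewrite mulr_ge0 ?expR_ge0.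
Qed.

Let mixD (H1 H2 : R * R -> R) : measurable_fun setT H1 -> measurable_fun setT H2 ->
  (forall p, 0 <= H1 p) -> (forall p, 0 <= H2 p) ->
  mix (fun p => H1 p + H2 p) = (mix H1 + mix H2)%E.
Proof.
move=> m1 m2 h1 h2; rewrite /mix -ge0_integralrD//; last 5 first.
- exact: measurableX.
- exact: mix_measurable.
- exact: mix_measurable.
- by move=> p _; exact: mix_ge0.
- by move=> p _; exact: mix_ge0.
by apply: eq_integral => p _; rewrite !mulrDr.
Qed.

Let integral_kappaZ (c : \bar R) : (0 <= c)%E ->
  (\int[leb]_(v in pos) ((kappa v)%:E * c) = c)%E.
Proof.
move=> c0; under eq_integral do rewrite muleC.
rewrite ge0_integralZl//.
- by rewrite integral_kappa mule1.
- by apply: measurable_funTS; exact/measurable_EFinP.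
- by move=> v _; rewrite lee_fin.
Qed.

(** The mixture gives the mean logarithm [ln 2 - gamma - 2 ln 2 = - c2] of [rig 0]; it is stated as
    an equation between the negative and positive parts. *)
Lemma integral_rig0_lnm :
  (\int[leb]_(y in pos) (rig 0 y * lnm y)%:E =
   \int[leb]_(y in pos) (rig 0 y * lnp y)%:E + (c2 R)%:E)%E.
Proof.
set Bm := (\int[leb]_(y in pos) (rig 0 y * lnm y)%:E)%E.
set Bp := (\int[leb]_(y in pos) (rig 0 y * lnp y)%:E)%E.
pose Am := (\int[leb]_(t in pos) (expR (- t) * lnm t)%:E)%E.
pose Ap := (\int[leb]_(t in pos) (expR (- t) * lnp t)%:E)%E.
have ln20 : 0 <= ln 2 :> R by rewrite ln_ge0//; lra.
(* The average of [ln y = ln 2 + ln t - ln (1 + v^2)] over the mixture, with negative terms moved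
   across. *)
have key : (Bm + (ln 2)%:E + Ap = Bp + Am + L)%E.
  pose y (p : R * R) := 2 * (p.2 / (1 + p.1 ^+ 2)).
  have my : measurable_fun setT y.
    apply: measurable_funM => //; apply: measurable_funM => //.
    exact: (measurableT_comp measurable_v2V).
  have mml : measurable_fun setT (fun p => lnm (y p)) by exact: (measurableT_comp measurable_lnm).
  have mpl : measurable_fun setT (fun p => lnp (y p)) by exact: (measurableT_comp measurable_lnp).
  have mm2 : measurable_fun setT (fun p : R * R => lnm p.2).
    exact: (measurableT_comp measurable_lnm).
  have mp2 : measurable_fun setT (fun p : R * R => lnp p.2).
    exact: (measurableT_comp measurable_lnp).
  have mq1 : measurable_fun setT (fun p : R * R => lnq p.1).
    exact: (measurableT_comp measurable_lnq).
  have -> : Bm = mix (fun p => lnm (y p)).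
    rewrite mixE//; last by move=> p; exact: lnm_ge0.
    by apply: rig0_mixture; [exact: measurable_lnm|exact: lnm_ge0].
  have -> : Bp = mix (fun p => lnp (y p)).
    rewrite mixE//; last by move=> p; exact: lnp_ge0.
    by apply: rig0_mixture; [exact: measurable_lnp|exact: lnp_ge0].
  have [Am0 Ap0] : ((0 <= Am) /\ (0 <= Ap))%E.
    by split; apply: integral_ge0 => t _; rewrite lee_fin mulr_ge0 ?expR_ge0 ?lnm_ge0 ?lnp_ge0.
  have -> : Am = mix (fun p => lnm p.2).
    rewrite mixE//; last by move=> p; exact: lnm_ge0.
    by rewrite /= integral_kappaZ.
  have -> : Ap = mix (fun p => lnp p.2).
    rewrite mixE//; last by move=> p; exact: lnp_ge0.
    by rewrite /= integral_kappaZ.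
  have expc (c : R) : 0 <= c -> (\int[leb]_(t in pos) (expR (- t) * c)%:E = c%:E)%E.
    move=> c0; transitivity (c%:E * \int[leb]_(t in pos) (expR (- t))%:E)%E.
      rewrite -ge0_integralrZl//; do ?[exact: mexpN|by move=> ? _; exact: expR_ge0].
      by apply: eq_integral => t _; rewrite mulrC.
    by rewrite integral_expN mule1.
  have -> : (ln 2)%:E = mix (fun=> ln 2).
    rewrite mixE//; apply/esym; under eq_integral do rewrite expc//.
    by rewrite integral_kappaZ// lee_fin.
  have -> : L = mix (fun p => lnq p.1).
    rewrite mixE//; apply: eq_integral => v _.
    by rewrite /= expc// EFinM.
  rewrite -!mixD//; do ?[exact: measurable_funD|by move=> p; rewrite ?addr_ge0 ?lnm_ge0 ?lnp_ge0].
  apply: eq_integral => -[v t]; rewrite inE => -[] /=; rewrite !in_itv/= !andbT => v0 t0.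
  congr (_ * (_ * _))%:E; rewrite /y /=.
  set z := 2 * _.
  have : ln z = ln 2 + ln t - lnq v.
    by rewrite /z /lnq lnM ?posrE ?divr_gt0// ln_div ?posrE// addrA.
  by rewrite -(lnpBlnm z) -(lnpBlnm t); lra.
have Apf : Ap \is a fin_num.
  rewrite ge0_fin_numE ?exp_lnp_fin//.
  by apply: integral_ge0 => t _; rewrite lee_fin mulr_ge0 ?expR_ge0 ?lnp_ge0.
have Amf : Am \is a fin_num.
  rewrite ge0_fin_numE ?exp_lnm_fin//.
  by apply: integral_ge0 => t _; rewrite lee_fin mulr_ge0 ?expR_ge0 ?lnm_ge0.
have gE : (euler_gamma R = fine Am - fine Ap).
  rewrite /euler_gamma /Rintegral integralE.
  have -> : (\int[leb]_(t in pos) (fun t => (expR (- t) * ln t)%:E)^\+ t = Ap)%E.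
    apply: eq_integral => t _; rewrite funeposE -EFin_max /lnp maxr_pMr ?expR_ge0//.
    by rewrite mulr0.
  have -> : (\int[leb]_(t in pos) (fun t => (expR (- t) * ln t)%:E)^\- t = Am)%E.
    apply: eq_integral => t _; rewrite funenegE -EFinN -EFin_max /lnm maxr_pMr ?expR_ge0//.
    by rewrite mulr0 mulrN.
  by rewrite fineB// opprB.
have L0 : (0 <= L)%E by apply: integral_ge0 => v _; rewrite lee_fin mulr_ge0.
have [Am0 Ap0] : ((0 <= Am) /\ (0 <= Ap))%E.
  by split; apply: integral_ge0 => t _; rewrite lee_fin mulr_ge0 ?expR_ge0 ?lnm_ge0 ?lnp_ge0.
have [Bm0 Bp0] : ((0 <= Bm) /\ (0 <= Bp))%E.
  by split; apply: integral_ge0 => t _; rewrite lee_fin mulr_ge0 ?rig_ge0 ?lnm_ge0 ?lnp_ge0.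
have := integral_lnq_double; rewrite /c2 gE.
have Bmf : Bm \is a fin_num by rewrite ge0_fin_numE// integral_rig0_lnm_fin.
have Bpf : Bp \is a fin_num by rewrite ge0_fin_numE// integral_rig0_lnp_fin.
rewrite -(fineK Amf) -(fineK Apf) -(fineK Bmf) -(fineK Bpf) in key *.
(* All other terms of [key] are finite, which forces [L] to be finite; only then does the doubling
   identity determine it as [2 ln 2]. *)
move: L0 key; case: (L) => //= l _.
by rewrite -!EFinD => -[k] [L2]; congr EFin; lra.
Qed.

End Digamma.

(** * Edges in series *)

Section SeriesOperator.
Local Open Scope classical_set_scope.
Context (R : realType).
Local Notation leb := (@lebesgue_measure R).
Local Notation pos := `]0, +oo[%classic.
Implicit Types (u v x y : R) (h : R -> \bar R).

Let posE y : pos y -> 0 < y. Proof. by rewrite /= in_itv/= andbT. Qed.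

Lemma measurable_integral_in d (D : measurableType d) dY (Y : measurableType dY)
    (m : {sigma_finite_measure set Y -> \bar R}) (S : set Y) (F : D -> Y -> \bar R) :
  measurable S -> measurable_fun setT (fun p : D * Y => F p.1 p.2) ->
  (forall z (t : Y), 0 <= F z t)%E ->
  measurable_fun setT (fun z => \int[m]_(t in S) F z t)%E.
Proof.
move=> mS mF F0.
rewrite (_ : (fun z => _) = fun z => (\int[m]_t (F z t * (\1_S t : R)%:E))%E); last first.
  apply/funext => z; rewrite integral_mkcond; apply: eq_integral => y _.
  by rewrite patchE indicE; case: ifPn; rewrite ?mule1 ?mule0.
apply: (measurable_fun_fubini_tonelli_F (fun p : D * Y => F p.1 p.2 * (\1_S p.2 : R)%:E)%E).
  apply: emeasurable_funM => //; apply/measurable_EFinP.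
  exact: (measurableT_comp (measurable_indic mS)).
by move=> p; rewrite mule_ge0// lee_fin.
Qed.

(* Law of the effective weight of two edges of weights [u] and [v] in series. *)
Definition series u v h : \bar R :=
  (\int[leb]_(y in pos) ((rig (u + v) y)%:E * h (u * v / y)%R))%E.

Lemma series_ge0 u v h : (forall x, 0 <= h x)%E -> (0 <= series u v h)%E.
Proof. by move=> h0; apply: integral_ge0 => y _; rewrite mule_ge0// lee_fin rig_ge0. Qed.

Let measurable_seriesF d (D : measurableType d) (a b : D -> R) (H : D -> R -> \bar R) :
  measurable_fun setT a -> measurable_fun setT b ->
  measurable_fun setT (fun p : D * R => H p.1 p.2) ->
  measurable_fun setT (fun p : D * R => (rig (a p.1 + b p.1) p.2)%:E * H p.1 (a p.1 * b p.1 / p.2)%R)%E.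
Proof.
move=> ma mb mH; have mfst : measurable_fun setT (@fst D R) by exact: measurable_fst.
have msnd : measurable_fun setT (@snd D R) by exact: measurable_snd.
have ma1 : measurable_fun setT (fun p : D * R => a p.1) by exact: measurableT_comp.
have mb1 : measurable_fun setT (fun p : D * R => b p.1) by exact: measurableT_comp.
apply: emeasurable_funM.
  by apply/measurable_EFinP; apply: measurable_rig => //; exact: measurable_funD.
apply: (measurableT_comp mH (g := fun p : D * R => (p.1, a p.1 * b p.1 / p.2))).
apply: measurable_fun_pair => //; apply: measurable_funM; first exact: measurable_funM.
exact: (measurableT_comp (@measurable_invr R)).
Qed.

Lemma measurable_series d (D : measurableType d) (a b : D -> R) (H : D -> R -> \bar R) :
  measurable_fun setT a -> measurable_fun setT b ->
  measurable_fun setT (fun p : D * R => H p.1 p.2) -> (forall z x, 0 <= H z x)%E ->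
  measurable_fun setT (fun z => series (a z) (b z) (H z)).
Proof.
move=> ma mb mH H0.
rewrite /series; apply: (@measurable_integral_in _ D _ _ leb pos
  (fun z y => (rig (a z + b z) y)%:E * H z (a z * b z / y)%R)%E) => //.
  exact: measurable_seriesF.
by move=> z y; rewrite mule_ge0// lee_fin rig_ge0.
Qed.

Lemma measurable_series_integrand u v h : measurable_fun setT h ->
  measurable_fun setT (fun y => (rig (u + v) y)%:E * h (u * v / y)%R)%E.
Proof.
move=> mh; apply: emeasurable_funM; first by apply/measurable_EFinP; exact: measurable_rig.
apply: (measurableT_comp mh); apply: measurable_funM => //; exact: measurable_invr.
Qed.

Lemma le_series u v h1 h2 : 0 < u -> 0 < v ->
  measurable_fun setT h1 -> measurable_fun setT h2 -> (forall x, 0 <= h1 x)%E ->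
  (forall x, 0 < x -> (h1 x <= h2 x)%E) -> (series u v h1 <= series u v h2)%E.
Proof.
move=> u0 v0 m1 m2 h10 h12; apply: ge0_le_integral => //.
- by move=> y _; rewrite mule_ge0// lee_fin rig_ge0.
- by apply: measurable_funTS; exact: measurable_series_integrand.
- by apply: measurable_funTS; exact: measurable_series_integrand.
- move=> y /posE y0; rewrite lee_pmul2l ?h12 ?divr_gt0 ?mulr_gt0//.
  by rewrite lte_fin rig_gt0.
Qed.

Lemma seriesD u v h1 h2 : measurable_fun setT h1 -> measurable_fun setT h2 ->
  (forall x, 0 <= h1 x)%E -> (forall x, 0 <= h2 x)%E ->
  series u v (fun x => h1 x + h2 x)%E = (series u v h1 + series u v h2)%E.
Proof.
move=> m1 m2 h10 h20; rewrite /series -ge0_integralD//.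
- by apply: eq_integral => y _; rewrite ge0_muleDr.
- by move=> y _; rewrite mule_ge0// lee_fin rig_ge0.
- by apply: measurable_funTS; exact: measurable_series_integrand.
- by move=> y _; rewrite mule_ge0// lee_fin rig_ge0.
- by apply: measurable_funTS; exact: measurable_series_integrand.
Qed.

Lemma seriesZ u v h (c : \bar R) : measurable_fun setT h -> (forall x, 0 <= h x)%E ->
  (0 <= c)%E -> series u v (fun x => c * h x)%E = (c * series u v h)%E.
Proof.
move=> m1 h10 c0; rewrite /series -ge0_integralZl//.
- by apply: eq_integral => y _; rewrite muleCA.
- by apply: measurable_funTS; exact: measurable_series_integrand.
- by move=> y _; rewrite mule_ge0// lee_fin rig_ge0.
Qed.

Lemma series_cst u v (c : \bar R) : 0 < u -> 0 < v -> (0 <= c)%E -> series u v (fun=> c) = c.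
Proof.
move=> u0 v0 c0; rewrite /series; under eq_integral do rewrite muleC.
rewrite ge0_integralZl//.
- by rewrite integral_rig ?mule1// addr_ge0 ?ltW.
- by apply: measurable_funTS; apply/measurable_EFinP; exact: measurable_rig.
- by move=> y _; rewrite lee_fin rig_ge0.
Qed.

Section Level.
Variable mu : probability R R.

(** A law is represented by the functional sending a test function to its mean. Two independent
    copies are then two nested functionals, and the law after [n] steps needs no measure of its
    own. *)
Fixpoint level n h : \bar R :=
  if n is n'.+1 then level n' (fun u => level n' (fun v => series u v h))
  else (\int[mu]_x h x)%E.

Lemma level_ge0 n h : (forall x, 0 <= h x)%E -> (0 <= level n h)%E.
Proof.
elim: n h => [|n IH] h h0 /=; first exact: integral_ge0.
by apply: (IH) => u; apply: (IH) => v; exact: series_ge0.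
Qed.

Lemma measurable_level d (D : measurableType d) n (H : D -> R -> \bar R) :
  measurable_fun setT (fun p : D * R => H p.1 p.2) -> (forall z x, 0 <= H z x)%E ->
  measurable_fun setT (fun z => level n (H z)).
Proof.
elim: n d D H => [|n IH] d D H mH H0 /=.
  exact: (measurable_fun_fubini_tonelli_F (fun p : D * R => H p.1 p.2)).
apply: (IH d D (fun z u => level n (fun v => series u v (H z)))).
- apply: (IH _ (D * R)%type (fun p v => series p.2 v (H p.1))).
  + apply: (@measurable_series _ (D * R * R)%type (fun q => q.1.2) (fun q => q.2)
      (fun q x => H q.1.1 x)) => //.
    * exact: (measurableT_comp measurable_snd measurable_fst).
    * exact: measurable_snd.
    * apply: (measurableT_comp mH (g := fun q : (D * R * R) * R => (q.1.1.1, q.2))).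
      apply: measurable_fun_pair; last exact: measurable_snd.
      apply: (measurableT_comp measurable_fst (g := fun q : (D * R * R) * R => q.1.1)).
      exact: (measurableT_comp measurable_fst measurable_fst).
  + by move=> p v; exact: series_ge0.
- by move=> z u; apply: level_ge0 => v; exact: series_ge0.
Qed.

Hypothesis mu_pos : mu pos = 1%E.

Let level1_measurable h u : measurable_fun setT h -> (forall x, 0 <= h x)%E ->
  measurable_fun setT (fun v => series u v h).
Proof.
move=> mh h0; apply: (@measurable_series _ _ (fun=> u) id (fun=> h)) => //.
exact: (measurableT_comp mh).
Qed.

Let measurable_series2 h : measurable_fun setT h -> (forall x, 0 <= h x)%E ->
  measurable_fun setT (fun p : R * R => series p.1 p.2 h).
Proof.
move=> mh h0; apply: (@measurable_series _ _ fst snd (fun=> h)) => //.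
exact: (measurableT_comp mh).
Qed.

(** Positive arguments suffice: [mu] is carried by them, and [u * v / y] stays positive at each
    step. *)
Lemma le_level n h1 h2 : measurable_fun setT h1 -> measurable_fun setT h2 ->
  (forall x, 0 <= h1 x)%E -> (forall x, 0 <= h2 x)%E ->
  (forall x, 0 < x -> (h1 x <= h2 x)%E) -> (level n h1 <= level n h2)%E.
Proof.
elim: n h1 h2 => [|n IH] h1 h2 m1 m2 h10 h20 h12 /=.
  apply: ae_ge0_le_integral => //.
  exists (~` pos); split; first exact: measurableC.
    have mpos : measurable (pos : set R) by exact: measurable_itv.
    by have := probability_setC mu mpos; rewrite mu_pos subee// => <-.
  by move=> x /= /not_implyP[_ hx] /posE x0; apply: hx; exact: h12.
have m2v h : measurable_fun setT h -> (forall x, 0 <= h x)%E ->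
    measurable_fun setT (fun u => level n (fun v => series u v h)).
  move=> mh h0; apply: (@measurable_level _ _ n (fun u v => series u v h)).
    exact: measurable_series2.
  by move=> u v; exact: series_ge0.
apply: (IH) => //; [exact: m2v|exact: m2v| | |].
- by move=> u; apply: level_ge0 => v; exact: series_ge0.
- by move=> u; apply: level_ge0 => v; exact: series_ge0.
move=> u u0; apply: (IH) => //; do ?[exact: level1_measurable|by move=> v; exact: series_ge0].
by move=> v v0; exact: le_series.
Qed.

Lemma eq_level n h1 h2 : measurable_fun setT h1 -> measurable_fun setT h2 ->
  (forall x, 0 <= h1 x)%E -> (forall x, 0 <= h2 x)%E ->
  (forall x, 0 < x -> h1 x = h2 x) -> level n h1 = level n h2.
Proof.
move=> m1 m2 h10 h20 h12; apply/eqP; rewrite eq_le !le_level// => x x0.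
  by rewrite h12.
by rewrite h12.
Qed.

Lemma levelD n h1 h2 : measurable_fun setT h1 -> measurable_fun setT h2 ->
  (forall x, 0 <= h1 x)%E -> (forall x, 0 <= h2 x)%E ->
  level n (fun x => h1 x + h2 x)%E = (level n h1 + level n h2)%E.
Proof.
elim: n h1 h2 => [|n IH] h1 h2 m1 m2 h10 h20 /=; first exact: ge0_integralD.
have m2v h : measurable_fun setT h -> (forall x, 0 <= h x)%E ->
    measurable_fun setT (fun u => level n (fun v => series u v h)).
  move=> mh h0; apply: (@measurable_level _ _ n (fun u v => series u v h)).
    exact: measurable_series2.
  by move=> u v; exact: series_ge0.
have s0 h u v : (forall x, 0 <= h x)%E -> (0 <= series u v h)%E by exact: series_ge0.
rewrite -IH; [|exact: m2v|exact: m2v| |]; last 2 first.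
- by move=> u; apply: level_ge0 => v; exact: series_ge0.
- by move=> u; apply: level_ge0 => v; exact: series_ge0.
congr level; apply/funext => u.
rewrite -IH//; do ?[exact: level1_measurable|by move=> v; exact: series_ge0].
by congr level; apply/funext => v; rewrite seriesD.
Qed.

Lemma levelZ n h (c : \bar R) : measurable_fun setT h -> (forall x, 0 <= h x)%E ->
  (0 <= c)%E -> level n (fun x => c * h x)%E = (c * level n h)%E.
Proof.
elim: n h => [|n IH] h mh h0 c0 /=; first exact: ge0_integralZl.
rewrite -IH//; last 2 first.
- apply: (@measurable_level _ _ n (fun u v => series u v h)).
    exact: measurable_series2.
  by move=> u v; exact: series_ge0.
- by move=> u; apply: level_ge0 => v; exact: series_ge0.
congr level; apply/funext => u.
rewrite -IH//; do ?[exact: level1_measurable|by move=> v; exact: series_ge0].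
by congr level; apply/funext => v; rewrite seriesZ.
Qed.

Lemma level_cst n (c : \bar R) : (0 <= c)%E -> level n (fun=> c) = c.
Proof.
elim: n c => [|n IH] c c0 /=.
  by rewrite integral_cst// -[RHS]mule1; congr (_ * _)%E; exact: probability_setT.
have m2 : measurable_fun setT (fun u => level n (fun v => series u v (fun=> c))).
  apply: (@measurable_level _ _ n (fun u v => series u v (fun=> c))).
    exact: measurable_series2.
  by move=> u v; exact: series_ge0.
have l0 u : (0 <= level n (fun v => series u v (fun=> c)))%E.
  by apply: level_ge0 => v; exact: series_ge0.
rewrite -[RHS](IH c c0); apply: eq_level => // u u0.
rewrite -[RHS](IH c c0); apply: eq_level => //; first exact: level1_measurable.
  by move=> v; exact: series_ge0.
by move=> v v0; rewrite series_cst.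
Qed.

Definition level2 n (H : R -> R -> \bar R) := level n (fun u => level n (fun v => H u v)).

Lemma levelS n h : level n.+1 h = level2 n (fun u v => series u v h).
Proof. by []. Qed.

Let measurable_level2 n (H : R -> R -> \bar R) :
  measurable_fun setT (fun p => H p.1 p.2) -> (forall u v, 0 <= H u v)%E ->
  measurable_fun setT (fun u => level n (fun v => H u v)).
Proof. exact: measurable_level. Qed.

Let measurable_pair1 (H : R -> R -> \bar R) u :
  measurable_fun setT (fun p => H p.1 p.2) -> measurable_fun setT (fun v => H u v).
Proof. by move=> mH; exact: (measurableT_comp mH (pair1_measurable u)). Qed.

Lemma le_level2 n (H1 H2 : R -> R -> \bar R) :
  measurable_fun setT (fun p => H1 p.1 p.2) -> measurable_fun setT (fun p => H2 p.1 p.2) ->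
  (forall u v, 0 <= H1 u v)%E -> (forall u v, 0 <= H2 u v)%E ->
  (forall u v, 0 < u -> 0 < v -> (H1 u v <= H2 u v)%E) -> (level2 n H1 <= level2 n H2)%E.
Proof.
move=> m1 m2 h1 h2 h12; apply: le_level.
- exact: measurable_level2.
- exact: measurable_level2.
- by move=> u; exact: level_ge0.
- by move=> u; exact: level_ge0.
move=> u u0; apply: le_level => // [| |v v0]; [exact: measurable_pair1..|exact: h12].
Qed.

Lemma level2D n (H1 H2 : R -> R -> \bar R) :
  measurable_fun setT (fun p => H1 p.1 p.2) -> measurable_fun setT (fun p => H2 p.1 p.2) ->
  (forall u v, 0 <= H1 u v)%E -> (forall u v, 0 <= H2 u v)%E ->
  level2 n (fun u v => H1 u v + H2 u v)%E = (level2 n H1 + level2 n H2)%E.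
Proof.
move=> m1 m2 h1 h2; rewrite /level2 -levelD.
- congr level; apply/funext => u; rewrite levelD//; exact: measurable_pair1.
- exact: measurable_level2.
- exact: measurable_level2.
- by move=> u; exact: level_ge0.
- by move=> u; exact: level_ge0.
Qed.

Lemma level2M n h1 h2 : measurable_fun setT h1 -> measurable_fun setT h2 ->
  (forall x, 0 <= h1 x)%E -> (forall x, 0 <= h2 x)%E ->
  level2 n (fun u v => h1 u * h2 v)%E = (level n h1 * level n h2)%E.
Proof.
move=> m1 m2 h10 h20; rewrite /level2.
transitivity (level n (fun u => level n h2 * h1 u)%E).
  by congr level; apply/funext => u; rewrite levelZ// muleC.
by rewrite levelZ// ?level_ge0// muleC.
Qed.

Lemma level2_l n h : measurable_fun setT h -> (forall x, 0 <= h x)%E ->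
  level2 n (fun u _ => h u) = level n h.
Proof.
by move=> mh h0; congr level; apply/funext => u; exact: level_cst.
Qed.

Lemma level2_r n h : measurable_fun setT h -> (forall x, 0 <= h x)%E ->
  level2 n (fun _ v => h v) = level n h.
Proof. by move=> mh h0; rewrite /level2 level_cst// level_ge0. Qed.

End Level.
End SeriesOperator.

(** * One-step inequalities for two edges in series *)

Section SeriesInequalities.
Local Open Scope classical_set_scope.
Context (R : realType).
Local Notation leb := (@lebesgue_measure R).
Local Notation pos := `]0, +oo[%classic.
Implicit Types (u v x y a : R).

Let mE (f : R -> R) : measurable_fun setT f -> measurable_fun setT (fun x => (f x)%:E).
Proof. by move=> mf; exact/measurable_EFinP. Qed.

(** The mean of [1 / y] under [rig (u + v)] is [1 / (u + v)]. The absolute value makes the test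
    function nonnegative off the positive half-line. *)
Lemma series_norm u v : 0 < u -> 0 < v ->
  series u v (fun x => `|x|%:E) = (u * v / (u + v))%:E.
Proof.
move=> u0 v0; have uv0 : 0 < u + v by exact: addr_gt0.
have uvM : 0 <= u * v by rewrite mulr_ge0 ?ltW.
transitivity ((u * v)%:E * \int[leb]_(y in pos) (rig (u + v) y * `|y^-1|)%:E)%E.
  rewrite -ge0_integralrZl//; last 2 first.
  - apply: measurable_funM; first exact: measurable_rig.
    by apply: measurableT_comp => //; exact: measurable_invr.
  - by move=> y _; rewrite mulr_ge0 ?rig_ge0.
  apply: eq_integral => y _; rewrite -EFinM normrM (ger0_norm uvM).
  by rewrite mulrCA mulrA.
by rewrite integral_rigV// -EFinM.
Qed.

(** Jensen's inequality by a tangent line: [f - g] lies below the affine function [c2 - c1 + k x],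
    whose mean is known. The terms are distributed so that each is nonnegative and infinite means
    are allowed. *)
Lemma series_le_tangent u v (f g : R -> R) (c1 c2 k : R) : 0 < u -> 0 < v ->
  measurable_fun setT f -> measurable_fun setT g -> (forall x, 0 <= f x) -> (forall x, 0 <= g x) ->
  0 <= c1 -> 0 <= c2 -> 0 <= k ->
  (forall x, 0 < x -> f x + c1 <= g x + (c2 + k * x)) ->
  (series u v (EFin \o f) + c1%:E <= series u v (EFin \o g) + (c2 + k * (u * v / (u + v)))%:E)%E.
Proof.
move=> u0 v0 mf mg f0 g0 c10 c20 k0 fg.
have mn : measurable_fun setT (fun x : R => k%:E * `|x|%:E)%E.
  by apply: emeasurable_funM => //; apply: mE; exact: normr_measurable.
have n0 (x : R) : (0 <= k%:E * `|x|%:E)%E by rewrite mule_ge0// lee_fin.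
have mcn : measurable_fun setT (fun x : R => c2%:E + k%:E * `|x|%:E)%E by exact: emeasurable_funD.
have cn0 (x : R) : (0 <= c2%:E + k%:E * `|x|%:E)%E by rewrite adde_ge0.
have -> : (series u v (EFin \o f) + c1%:E = series u v (fun x => (f x)%:E + c1%:E))%E.
  by rewrite seriesD ?series_cst//; exact: mE.
have -> : (series u v (EFin \o g) + (c2 + k * (u * v / (u + v)))%:E =
    series u v (fun x => (g x)%:E + (c2%:E + k%:E * `|x|%:E)))%E.
  rewrite seriesD//; last exact: mE.
  rewrite seriesD// series_cst// seriesZ//; last by apply: mE; exact: normr_measurable.
  by rewrite series_norm// -EFinM -EFinD.
apply: le_series => //.
- by apply: emeasurable_funD => //; exact: mE.
- by apply: emeasurable_funD => //; exact: mE.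
- by move=> x; rewrite -EFinD lee_fin addr_ge0.
by move=> x x0; rewrite -EFinM -!EFinD lee_fin gtr0_norm//; exact: fg.
Qed.

Lemma powR_tangent a x : 0 <= a <= 1 -> 0 <= x -> x `^ a <= 1 - a + a * x.
Proof.
move=> /andP[a0 a1] x0.
have [->|an0] := eqVneq a 0; first by rewrite powRr0; lra.
have [->|an1] := eqVneq a 1; first by rewrite powRr1//; lra.
have {}a0 : 0 < a by rewrite lt_neqAle eq_sym an0.
have {}a1 : 0 < 1 - a by rewrite subr_gt0 lt_neqAle an1.
(* Young's inequality with exponents [1 / a] and [1 / (1 - a)], applied to [x^a] and 1. *)
have := @conjugate_powR R (x `^ a) 1 a^-1 (1 - a)^-1.
rewrite powR_ge0 ler01 !invr_gt0 a0 a1 !invrK -powRrM mulfV// powRr1// powR1 mulr1 mul1r.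
by move=> /(_ isT isT isT isT); rewrite subrKC => /(_ erefl); lra.
Qed.

Let half_harmonic u v : 0 < u -> 0 < v -> 0 < u * v / (u + v).
Proof. by move=> u0 v0; rewrite divr_gt0 ?mulr_gt0 ?addr_gt0. Qed.

Let sqr_harmonic u v : 0 < u -> 0 < v -> (2 * (u * v / (u + v))) ^+ 2 <= u * v.
Proof.
move=> u0 v0; have s0 : 0 < u + v by rewrite addr_gt0.
have -> : (2 * (u * v / (u + v))) ^+ 2 = (u * v) * (4 * (u * v)) / (u + v) ^+ 2.
  by field; rewrite gt_eqF.
rewrite ler_pdivrMr ?exprn_gt0// ler_pM2l ?mulr_gt0//.
by have := sqr_ge0 (u - v); lra.
Qed.

(** Jensen's inequality at the mean [x0], which is half the harmonic mean of [u] and [v]: the half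
    gives [2^(-a)], and the harmonic mean is at most the geometric one, whose power [(u v)^(a/2)] is
    at most the average of [u^a] and [v^a]. *)
Lemma series_powR_half u v a : 0 < u -> 0 < v -> 0 <= a <= 1 ->
  (series u v (fun x => (x `^ a)%:E) <= (2 `^ (- a) * ((u `^ a + v `^ a) / 2))%:E)%E.
Proof.
move=> u0 v0 a01; have /andP[a0 a1] := a01.
set x0 := u * v / (u + v); have x00 : 0 < x0 by exact: half_harmonic.
apply: (@le_trans _ _ (x0 `^ a)%:E).
  have H x : 0 < x -> x `^ a + 0 <= 0 + (x0 `^ a * (1 - a) + x0 `^ a * a / x0 * x).
    move=> xp; have xx0 : 0 <= x / x0 by rewrite divr_ge0 ?ltW.
    have -> : x `^ a = x0 `^ a * (x / x0) `^ a.
      by rewrite -powRM ?(ltW x00)// mulrC divfK ?gt_eqF.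
    rewrite addr0 add0r; apply: le_trans (ler_wpM2l (powR_ge0 _ _) (powR_tangent a01 xx0)) _.
    by rewrite le_eqVlt; apply/orP; left; apply/eqP; field; rewrite gt_eqF.
  have p0 : 0 <= x0 `^ a by exact: powR_ge0.
  have := @series_le_tangent u v (fun x => x `^ a) (fun=> 0) 0 (x0 `^ a * (1 - a)) (x0 `^ a * a / x0)
     u0 v0 (@measurable_powR _ _) (measurable_cst _) (fun x => powR_ge0 _ _) (fun=> lexx 0) (lexx 0).
  rewrite -/x0 adde0 series_cst// add0e divfK ?gt_eqF//.
  have -> : x0 `^ a * (1 - a) + x0 `^ a * a = x0 `^ a by ring.
  apply => //; first by rewrite mulr_ge0// subr_ge0.
  by rewrite divr_ge0 ?(ltW x00)// mulr_ge0.
rewrite lee_fin.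
have h2 : a / 2 + a / 2 = a by lra.
have pw x : 0 < x -> x `^ a = x `^ (a / 2) ^+ 2.
  by move=> xp; rewrite expr2 -powRD ?h2// (gt_eqF xp) implybT.
have -> : x0 `^ a = 2 `^ (- a) * (2 * x0) `^ a.
  rewrite powRM ?(ltW x00)// mulrA -powRD ?addNr ?powRr0 ?mul1r//.
  by rewrite pnatr_eq0 implybT.
rewrite ler_pM2l ?powR_gt0//.
have tx0 : 0 < 2 * x0 by rewrite mulr_gt0.
have -> : (2 * x0) `^ a = ((2 * x0) ^+ 2) `^ (a / 2).
  by rewrite (pw _ tx0) -!powR_mulrn ?powR_ge0 ?(ltW tx0)// powRAC.
apply: (@le_trans _ _ ((u * v) `^ (a / 2))).
  apply: ge0_ler_powR; rewrite ?nnegrE ?sqr_ge0 ?mulr_ge0 ?(ltW u0) ?(ltW v0)//.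
  exact: sqr_harmonic.
rewrite powRM ?(ltW u0) ?(ltW v0)// (pw u)// (pw v)//.
by have := sqr_ge0 (u `^ (a / 2) - v `^ (a / 2)); lra.
Qed.

Lemma series_powR_C u v a : 0 < u -> 0 < v -> 0 <= a < 1 / 2 ->
  (series u v (fun x => (x `^ a)%:E) <= (C_alpha a * (u `^ a * v `^ a))%:E)%E.
Proof.
move=> u0 v0 a01; have uv0 : 0 < u + v by exact: addr_gt0.
have uvM : 0 <= u * v by rewrite mulr_ge0 ?ltW.
have -> : series u v (fun x => (x `^ a)%:E) =
    ((u `^ a * v `^ a)%:E * \int[leb]_(y in pos) (rig (u + v) y * y `^ (- a))%:E)%E.
  rewrite -ge0_integralrZl ?mulr_ge0 ?powR_ge0//; last 2 first.
  - by apply: measurable_funM; [exact: measurable_rig|exact: measurable_powR].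
  - by move=> y _; rewrite mulr_ge0 ?rig_ge0 ?powR_ge0.
  apply: eq_integral => y; rewrite inE/= in_itv/= andbT => y0.
  rewrite -EFinM powRM ?invr_ge0 ?(ltW y0)// powRM ?(ltW u0) ?(ltW v0)//.
  rewrite -powR_inv1 ?(ltW y0)// -powRrM mulN1r; congr EFin; ring.
rewrite [(C_alpha a * _)%R]mulrC [leRHS]EFinM lee_pmul2l//; last by rewrite lte_fin mulr_gt0 ?powR_gt0.
exact: integral_rig_powR_le.
Qed.

Local Notation lnpE := (fun x => (lnp x)%:E).
Local Notation lnmE := (fun x => (lnm x)%:E).

Let ln_tangent x x0 : 0 < x -> 0 < x0 -> ln x <= ln x0 + x / x0 - 1.
Proof.
move=> xp x0p; have xx0 : 0 < x / x0 by rewrite divr_gt0.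
have : ln (x / x0) <= x / x0 - 1.
  by have := @le_ln1Dx R (x / x0 - 1); rewrite subrKC; apply; lra.
by rewrite ln_div ?posrE//; lra.
Qed.

Let ln_lnpm x : ln x = lnp x - lnm x. Proof. by rewrite lnpBlnm. Qed.

(** The mean [x0] is at most [u], and the tangent of [ln] at [x0] transfers this to logarithms. Its
    use is that negative parts grow with the level, so their finiteness passes to earlier levels. *)
Lemma series_lnm_ge u v : 0 < u -> 0 < v -> ((lnm u)%:E <= series u v lnmE)%E.
Proof.
move=> u0 v0; set x0 := u * v / (u + v); have x00 : 0 < x0 by exact: half_harmonic.
have x0u : x0 <= u by rewrite /x0 ler_pdivrMr ?addr_gt0// ler_pM2l//; lra.
have [u1|u1] := leP 1 u.
  have -> : lnm u = 0 by apply/eqP; rewrite eq_le lnm_ge0 andbT /lnm ge_max lexx andbT oppr_le0 ln_ge0.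
  by apply: series_ge0 => x; rewrite lee_fin lnm_ge0.
have lu : lnm u = - ln u.
  by rewrite /lnm; apply/max_idPl; rewrite oppr_ge0 ln_le0// ltW.
have H x : 0 < x -> 0 + (lnm u + 1) <= lnm x + (0 + x0^-1 * x).
  move=> xp; have := ln_tangent xp x00.
  have : ln x0 <= ln u by rewrite ler_ln.
  rewrite !add0r [x0^-1 * x]mulrC lu => h1 h2.
  by have := lnp_ge0 x; have := ln_lnpm x; lra.
have u10 : 0 <= lnm u + 1 by rewrite addr_ge0 ?lnm_ge0.
have xV0 : 0 <= x0^-1 by rewrite invr_ge0 ltW.
have := @series_le_tangent u v (fun=> 0) (@lnm R) (lnm u + 1) 0 x0^-1 u0 v0
  (measurable_cst _) (@measurable_lnm R) (fun=> lexx 0) (@lnm_ge0 R) u10 (lexx 0) xV0 H.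
rewrite -/x0 mulVf ?gt_eqF// add0r (_ : EFin \o _ = fun=> 0%:E)// series_cst// add0e.
by rewrite EFinD leeD2rE.
Qed.

(** Jensen's inequality for [ln] at [x0], followed by the comparison of harmonic and geometric mean,
    which gives [ln x0 <= (ln u + ln v) / 2 - ln 2]. *)
Lemma series_lnp_half u v : 0 < u -> 0 < v ->
  (series u v lnpE + ((lnm u + lnm v) / 2 + ln 2)%:E <=
   series u v lnmE + ((lnp u + lnp v) / 2)%:E)%E.
Proof.
move=> u0 v0; set x0 := u * v / (u + v); have x00 : 0 < x0 by exact: half_harmonic.
have := @series_le_tangent u v (@lnp R) (@lnm R) (lnm x0 + 1) (lnp x0) x0^-1 u0 v0
  (@measurable_lnp R) (@measurable_lnm R) (@lnp_ge0 R) (@lnm_ge0 R).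
have -> : (EFin \o @lnp R) = lnpE by [].
have -> : (EFin \o @lnm R) = lnmE by [].
rewrite -/x0 mulVf ?gt_eqF//.
have H x : 0 < x -> lnp x + (lnm x0 + 1) <= lnm x + (lnp x0 + x0^-1 * x).
  move=> xp; have := ln_tangent xp x00; rewrite (ln_lnpm x) (ln_lnpm x0) [x0^-1 * x]mulrC; lra.
have lx0 : ln x0 <= (ln u + ln v) / 2 - ln 2.
  have := sqr_harmonic u0 v0; rewrite -/x0; move: (x0) x00 => z z0.
  have tz0 : 0 < 2 * z by rewrite mulr_gt0.
  rewrite -ler_ln ?posrE ?mulr_gt0 ?exprn_gt0//.
  by rewrite expr2 !lnM ?posrE ?mulr_gt0//; lra.
move=> /(_ _ _ _ H).
rewrite addr_ge0 ?lnm_ge0// lnp_ge0 invr_ge0 (ltW x00) => /(_ isT isT isT).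
have P0 : (0 <= series u v lnpE)%E by apply: series_ge0 => x; rewrite lee_fin lnp_ge0.
have M0 : (0 <= series u v lnmE)%E by apply: series_ge0 => x; rewrite lee_fin lnm_ge0.
rewrite (ln_lnpm u) (ln_lnpm v) (ln_lnpm x0) in lx0.
move: P0 M0; case: (series u v lnpE) => [p| |]//; case: (series u v lnmE) => [q| |]// _ _;
  rewrite -?EFinD ?lee_fin ?addye ?addey ?leey ?leye_eq//; lra.
Qed.

Let series_flip u v (h : R -> R) : 0 < u -> 0 < v ->
  series u v (fun x => (h (u * v / x))%:E) = (\int[leb]_(y in pos) (rig (u + v) y * h y)%:E)%E.
Proof.
move=> u0 v0; apply: eq_integral => y; rewrite inE/= in_itv/= andbT => y0.
by rewrite -EFinM; congr (_ * h _)%:E; field; rewrite !gt_eqF.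
Qed.

(** The tilt from [rig 0] to [rig eta] is at most [exp eta], so finiteness is inherited. *)
Let integral_rig_lnp_fin eta : 0 <= eta ->
  (\int[leb]_(y in pos) (rig eta y * lnp y)%:E < +oo)%E.
Proof.
move=> e0.
have mr e : measurable_fun setT (fun y => rig e y * lnp y).
  by apply: measurable_funM; [exact: measurable_rig|exact: measurable_lnp].
apply: (@le_lt_trans _ _ ((expR eta)%:E * \int[leb]_(y in pos) (rig 0 y * lnp y)%:E)%E).
  rewrite -ge0_integralrZl ?expR_ge0//; last 2 first.
  - exact: mr.
  - by move=> y _; rewrite mulr_ge0 ?rig_ge0 ?lnp_ge0.
  apply: (@ge0_le_integralr R _ _ leb pos _ (fun y => rig eta y * lnp y)
    (fun y => expR eta * (rig 0 y * lnp y))) => //.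
  - exact: mr.
  - by apply: measurable_funM => //; exact: mr.
  - by move=> y _; rewrite mulr_ge0 ?rig_ge0 ?lnp_ge0.
  - move=> y; rewrite /= in_itv/= andbT => y0; rewrite rig_exp// mulrA ler_wpM2r ?lnp_ge0//.
    rewrite mulrC ler_wpM2r ?rig_ge0// ler_expR lerBlDr lerDl.
    by rewrite divr_ge0 ?sqr_ge0// mulr_ge0// ltW.
by rewrite lte_mul_pinfty ?lee_fin ?expR_ge0 ?integral_rig0_lnp_fin.
Qed.

(** The crossing comparison for the nonincreasing function [- ln], whose mean under [rig 0] is [c2];
    the finite integral of [lnp] against [rig 0] then cancels. *)
Let integral_rig_lnm_le eta : 0 < eta ->
  (\int[leb]_(y in pos) (rig eta y * lnm y)%:E <=
   \int[leb]_(y in pos) (rig eta y * lnp y)%:E + (c2 R)%:E)%E.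
Proof.
move=> e0; have := @rig_crossing R eta (@lnm R) (@lnp R) e0 (@measurable_lnm R) (@measurable_lnp R)
  (@lnm_ge0 R) (@lnp_ge0 R).
have H x y : 0 < x -> x <= y -> lnm y - lnp y <= lnm x - lnp x.
  move=> x0 xy; have : ln x <= ln y by rewrite ler_ln ?posrE//; exact: lt_le_trans xy.
  by rewrite (ln_lnpm x) (ln_lnpm y); lra.
move=> /(_ H); rewrite integral_rig0_lnm.
have F0 : (\int[leb]_(y in pos) (rig 0 y * lnp y)%:E \is a fin_num)%E.
  rewrite ge0_fin_numE ?integral_rig0_lnp_fin//.
  by apply: integral_ge0 => y _; rewrite lee_fin mulr_ge0 ?rig_ge0 ?lnp_ge0.
rewrite -addeA addeC leeD2lE//.
by rewrite addeC.
Qed.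

(** The identity [ln x = ln u + ln v - ln y] holds for the series weight [x], and the mean of
    [- ln y] is at most [c2]. The two maxima are the positive and negative parts of [c2 R], which
    keeps both sides nonnegative. *)
Lemma series_lnp_double u v : 0 < u -> 0 < v ->
  (series u v lnpE + (lnm u + lnm v + Num.max (- c2 R) 0)%:E <=
   series u v lnmE + (lnp u + lnp v + Num.max (c2 R) 0)%:E)%E.
Proof.
move=> u0 v0; have uv0 : 0 < u + v by exact: addr_gt0.
have mV : measurable_fun setT (fun x : R => u * v / x).
  by apply: measurable_funM => //; exact: measurable_invr.
have mlp : measurable_fun setT lnpE by apply: mE; exact: measurable_lnp.
have mlm : measurable_fun setT lnmE by apply: mE; exact: measurable_lnm.
have mlpV : measurable_fun setT (fun x => (lnp (u * v / x))%:E) by exact: (measurableT_comp mlp mV).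
have mlmV : measurable_fun setT (fun x => (lnm (u * v / x))%:E) by exact: (measurableT_comp mlm mV).
have p0 x : (0 <= (lnp x)%:E)%E by rewrite lee_fin lnp_ge0.
have m0 x : (0 <= (lnm x)%:E)%E by rewrite lee_fin lnm_ge0.
pose Gp := (\int[leb]_(y in pos) (rig (u + v) y * lnm y)%:E)%E.
pose Gm := (\int[leb]_(y in pos) (rig (u + v) y * lnp y)%:E)%E.
have eqs : (series u v lnpE + Gm + (lnm u + lnm v)%:E <= series u v lnmE + Gp + (lnp u + lnp v)%:E)%E.
  rewrite /Gp /Gm -!series_flip//.
  rewrite -(@series_cst _ u v (lnm u + lnm v)%:E)// ?lee_fin ?addr_ge0 ?lnm_ge0//.
  rewrite -(@series_cst _ u v (lnp u + lnp v)%:E)// ?lee_fin ?addr_ge0 ?lnp_ge0//.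
  rewrite -!seriesD//; do ?[exact: emeasurable_funD |
    by move=> x; rewrite -?EFinD ?lee_fin ?addr_ge0 ?lnp_ge0 ?lnm_ge0].
  apply: le_series => //; do ?[by apply: emeasurable_funD => //; exact: emeasurable_funD |
    by move=> x; rewrite -!EFinD lee_fin !addr_ge0 ?lnp_ge0 ?lnm_ge0].
  move=> x xp; rewrite -!EFinD lee_fin.
  have : ln (u * v / x) = ln u + ln v - ln x.
    by rewrite ln_div ?posrE ?mulr_gt0// lnM ?posrE.
  by rewrite (ln_lnpm (u * v / x)) (ln_lnpm u) (ln_lnpm v) (ln_lnpm x); lra.
have := integral_rig_lnm_le uv0; rewrite -/Gp -/Gm => G.
have Gmf : Gm \is a fin_num.
  rewrite ge0_fin_numE ?integral_rig_lnp_fin ?(ltW uv0)//.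
  by apply: integral_ge0 => y _; rewrite lee_fin mulr_ge0 ?rig_ge0 ?lnp_ge0.
have Gp0 : (0 <= Gp)%E by apply: integral_ge0 => y _; rewrite lee_fin mulr_ge0 ?rig_ge0 ?lnm_ge0.
have P0 : (0 <= series u v lnpE)%E by apply: series_ge0.
have M0 : (0 <= series u v lnmE)%E by apply: series_ge0.
have cc : Num.max (c2 R) 0 - Num.max (- c2 R) 0 = c2 R.
  by case: (leP (c2 R) 0); case: (leP (- c2 R) 0); lra.
move: G Gp0 P0 M0 eqs; rewrite -(fineK Gmf).
case: Gp => [gp| |]//; case: (series u v lnpE) => [p| |]//; case: (series u v lnmE) => [q| |]// ;
  rewrite -?EFinD ?lee_fin ?addye ?addey ?leey ?leye_eq//; lra.
Qed.

End SeriesInequalities.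

(** * Iteration of the one-step bounds along the levels *)

Section LevelBounds.
Local Open Scope classical_set_scope.
Context (R : realType) (mu : probability R R).
Hypothesis mu_pos : mu `]0, +oo[%classic = 1%E.
Implicit Types (u v x y a : R) (n : nat).
Local Notation powE a := (fun x : R => (x `^ a)%:E).
Local Notation lnpE := (fun x : R => (lnp x)%:E).
Local Notation lnmE := (fun x : R => (lnm x)%:E).
Local Open Scope ereal_scope.

Let mpow a : measurable_fun setT (powE a).
Proof. by apply/measurable_EFinP; exact: measurable_powR. Qed.
Let pow0 a x : 0 <= (x `^ a)%:E.
Proof. by rewrite lee_fin powR_ge0. Qed.
Let mlp : measurable_fun setT lnpE.
Proof. by apply/measurable_EFinP; exact: measurable_lnp. Qed.
Let mlm : measurable_fun setT lnmE.
Proof. by apply/measurable_EFinP; exact: measurable_lnm. Qed.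
Let lp0 x : 0 <= (lnp x)%:E. Proof. by rewrite lee_fin lnp_ge0. Qed.
Let lm0 x : 0 <= (lnm x)%:E. Proof. by rewrite lee_fin lnm_ge0. Qed.

Let m1 (h : R -> \bar R) : measurable_fun setT h -> measurable_fun setT (fun p : R * R => h p.1).
Proof. by move=> mh; exact: (measurableT_comp mh). Qed.
Let m2 (h : R -> \bar R) : measurable_fun setT h -> measurable_fun setT (fun p : R * R => h p.2).
Proof. by move=> mh; exact: (measurableT_comp mh). Qed.

Let mser (h : R -> \bar R) : measurable_fun setT h -> (forall x, 0 <= h x) ->
  measurable_fun setT (fun p : R * R => series p.1 p.2 h).
Proof.
move=> mh h0; apply: (@measurable_series _ _ _ fst snd (fun=> h)) => //.
exact: (measurableT_comp mh measurable_snd).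
Qed.

Let E a n := level mu n (powE a).
Let P n := level mu n lnpE.
Let M n := level mu n lnmE.

Let E0 a n : 0 <= E a n. Proof. exact: level_ge0. Qed.
Let P0 n : 0 <= P n. Proof. exact: level_ge0. Qed.
Let M0 n : 0 <= M n. Proof. exact: level_ge0. Qed.

Lemma level_powR_half a n : (0 <= a <= 1)%R -> E a n.+1 <= (2 `^ (- a))%:E * E a n.
Proof.
move=> a01; set c := (2 `^ (- a))%R; have c0 : (0 <= c)%R by exact: powR_ge0.
have h0 : (0 <= c / 2)%R by rewrite divr_ge0.
have mh : measurable_fun setT (fun x => (c / 2)%:E * powE a x) by exact: emeasurable_funM.
have hh0 x : 0 <= (c / 2)%:E * powE a x by rewrite mule_ge0.
have -> : c%:E * E a n = level2 mu n (fun u v => (c / 2)%:E * powE a u + (c / 2)%:E * powE a v).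
  rewrite (level2D mu n (H1 := fun u v => (c / 2)%:E * powE a u)
    (H2 := fun u v => (c / 2)%:E * powE a v))//; [|exact: (m1 mh)|exact: (m2 mh)].
  rewrite level2_l// (level2_r mu_pos n mh)// levelZ// -ge0_muleDl ?lee_fin//.
  by rewrite -EFinD -splitr.
rewrite /E levelS; apply: (le_level2 mu_pos) => //.
- exact: mser.
- by apply: emeasurable_funD; [exact: (m1 mh)|exact: (m2 mh)].
- by move=> u v; exact: series_ge0.
- by move=> u v; rewrite adde_ge0.
move=> u v u0 v0; apply: le_trans (series_powR_half u0 v0 a01) _.
by rewrite -!EFinM -EFinD lee_fin -/c; lra.
Qed.

Lemma level_powR_C a n : (0 <= a < 1 / 2)%R -> E a n.+1 <= (C_alpha a)%:E * (E a n * E a n).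
Proof.
move=> a01; have C0 := C_alpha_gt0 a01.
have mh : measurable_fun setT (fun x => (C_alpha a)%:E * powE a x) by exact: emeasurable_funM.
have hh0 x : 0 <= (C_alpha a)%:E * powE a x by rewrite mule_ge0// lee_fin ltW.
have -> : (C_alpha a)%:E * (E a n * E a n) =
    level2 mu n (fun u v => ((C_alpha a)%:E * powE a u) * powE a v).
  by rewrite (level2M mu n mh)// levelZ ?muleA// lee_fin ltW.
rewrite /E levelS; apply: (le_level2 mu_pos) => //.
- exact: mser.
- by apply: emeasurable_funM; [exact: (m1 mh)|exact: (m2 (mpow a))].
- by move=> u v; exact: series_ge0.
- by move=> u v; rewrite mule_ge0.
move=> u v u0 v0; apply: le_trans (series_powR_C u0 v0 a01) _.
by rewrite -!EFinM lee_fin mulrA.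
Qed.

Lemma level_lnm_mono n : M n <= M n.+1.
Proof.
rewrite /M -(level2_l mu_pos n mlm lm0) levelS; apply: (le_level2 mu_pos) => //.
- exact: (m1 mlm).
- exact: mser.
- by move=> u v; exact: series_ge0.
by move=> u v u0 v0; exact: series_lnm_ge.
Qed.

Let scaled (k : R) (h : R -> \bar R) n : (0 <= k)%R -> measurable_fun setT h -> (forall x, 0 <= h x) ->
  level2 mu n (fun u v => k%:E * h u + k%:E * h v) = k%:E * level mu n h + k%:E * level mu n h.
Proof.
move=> k0 mh h0.
have mkh : measurable_fun setT (fun x => k%:E * h x) by exact: emeasurable_funM.
have kh0 x : 0 <= k%:E * h x by rewrite mule_ge0.
rewrite (level2D mu n (H1 := fun u v => k%:E * h u) (H2 := fun u v => k%:E * h v))//;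
  [|exact: (m1 mkh)|exact: (m2 mkh)].
by rewrite level2_l// (level2_r mu_pos n mkh)// levelZ.
Qed.

(** Averages a pointwise logarithmic inequality over two independent copies; [k] is 1/2 for the
    Jensen step and 1 for the comparison step. *)
Let level_ln (k c1 c2 : R) n : (0 <= k)%R -> (0 <= c1)%R -> (0 <= c2)%R ->
  (forall u v, (0 < u)%R -> (0 < v)%R ->
    series u v lnpE + (k * (lnm u + lnm v) + c1)%:E <=
    series u v lnmE + (k * (lnp u + lnp v) + c2)%:E) ->
  P n.+1 + (k%:E * M n + k%:E * M n + c1%:E) <= M n.+1 + (k%:E * P n + k%:E * P n + c2%:E).
Proof.
move=> k0 c10 c20 H.
have mk2 (h : R -> \bar R) : measurable_fun setT h ->
    measurable_fun setT (fun p : R * R => k%:E * h p.1 + k%:E * h p.2).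
  move=> mh; apply: emeasurable_funD; apply: emeasurable_funM => //; [exact: (m1 mh)|exact: (m2 mh)].
have k20 (h : R -> \bar R) u v : (forall x, 0 <= h x) -> 0 <= k%:E * h u + k%:E * h v.
  by move=> h0; rewrite adde_ge0// mule_ge0.
have k2c (h : R -> \bar R) (c : R) u v : (forall x, 0 <= h x) -> (0 <= c)%R ->
    0 <= k%:E * h u + k%:E * h v + c%:E.
  by move=> h0 c0; apply: adde_ge0; [exact: k20|rewrite lee_fin].
have cE (c : R) : (0 <= c)%R -> level2 mu n (fun _ _ => c%:E) = c%:E.
  by move=> c0; rewrite /level2 !level_cst// level_cst.
rewrite -(scaled _ k0 mlm lm0) -(scaled _ k0 mlp lp0) -(cE c1 c10) -(cE c2 c20).
rewrite /P /M !levelS.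
rewrite -(level2D mu n (H2 := fun _ _ => c1%:E) (mk2 _ mlm) (measurable_cst _))//;
  do ?[by move=> u v; exact: (k20 _ _ _ lm0)|by move=> u v; exact: (k20 _ _ _ lp0)].
rewrite -(level2D mu n (H2 := fun _ _ => c2%:E) (mk2 _ mlp) (measurable_cst _))//;
  do ?[by move=> u v; exact: (k20 _ _ _ lm0)|by move=> u v; exact: (k20 _ _ _ lp0)].
rewrite -(level2D mu n (mser mlp lp0))//; last 3 first.
- by apply: emeasurable_funD => //; exact: (mk2 _ mlm).
- by move=> u v; exact: series_ge0.
- by move=> u v; exact: (k2c _ _ _ _ lm0 c10).
rewrite -(level2D mu n (mser mlm lm0))//; last 3 first.
- by apply: emeasurable_funD => //; exact: (mk2 _ mlp).
- by move=> u v; exact: series_ge0.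
- by move=> u v; exact: (k2c _ _ _ _ lp0 c20).
apply: (le_level2 mu_pos).
- by apply: emeasurable_funD; [exact: mser|apply: emeasurable_funD => //; exact: (mk2 _ mlm)].
- by apply: emeasurable_funD; [exact: mser|apply: emeasurable_funD => //; exact: (mk2 _ mlp)].
- by move=> u v; apply: adde_ge0; [exact: series_ge0|exact: (k2c _ _ _ _ lm0 c10)].
- by move=> u v; apply: adde_ge0; [exact: series_ge0|exact: (k2c _ _ _ _ lp0 c20)].
by move=> u v u0 v0; have := H u v u0 v0; rewrite !mulrDr !EFinD !EFinM.
Qed.

Lemma level_powR_le a n : (0 <= a <= 1)%R ->
  E a n <= ((2 `^ (- a)) ^+ n)%:E * E a 0.
Proof.
move=> a01; elim: n => [|n IH]; first by rewrite expr0 mul1e.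
apply: le_trans (level_powR_half n a01) _.
by rewrite exprS EFinM -muleA lee_pmul2l// lte_fin powR_gt0.
Qed.

Let expeD (x : \bar R) (m n : nat) : x ^+ (m + n) = x ^+ m * x ^+ n.
Proof. by elim: m => [|m IH]; rewrite ?expe0 ?mul1e// addSn !expeS IH muleA. Qed.

Let expe_le (x y : \bar R) n : 0 <= x -> x <= y -> x ^+ n <= y ^+ n.
Proof.
move=> x0 xy; elim: n => [|n IH]; first by rewrite !expe0.
by rewrite !expeS; apply: lee_pmul => //; exact: expe_ge0.
Qed.

(** After multiplication by [C_alpha a] the product bound reads [x_(n+1) <= x_n^2], so [k] steps
    raise the value at level [j] to the power [2^k]. *)
Lemma level_powR_le_pow a j k : (0 <= a < 1 / 2)%R ->
  E a (j + k) <= ((C_alpha a)^-1)%:E * ((C_alpha a * (2 `^ (- a)) ^+ j)%:E * E a 0) ^+ (2 ^ k).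
Proof.
move=> a01; have C0 := C_alpha_gt0 a01; have Cn0 : (C_alpha a != 0)%R by rewrite gt_eqF.
have a01' : (0 <= a <= 1)%R by lra.
have CE0 n : 0 <= (C_alpha a)%:E * E a n by rewrite mule_ge0// lee_fin ltW.
have step i : (C_alpha a)%:E * E a (j + i) <= ((C_alpha a)%:E * E a j) ^+ (2 ^ i).
  elim: i => [|i IH]; first by rewrite addn0 expn0 expeS expe0 mule1.
  rewrite addnS expnS mul2n -addnn expeD.
  apply: (@le_trans _ _ (((C_alpha a)%:E * E a (j + i)) * ((C_alpha a)%:E * E a (j + i)))).
    rewrite -muleA lee_pmul2l ?lte_fin// muleCA; exact: level_powR_C.
  by apply: lee_pmul.
apply: (@le_trans _ _ (((C_alpha a)^-1)%:E * ((C_alpha a)%:E * E a j) ^+ (2 ^ k))).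
  rewrite -[leLHS]mul1e -(mulVf Cn0) EFinM -muleA lee_pmul2l ?lte_fin ?invr_gt0//.
rewrite lee_pmul2l ?lte_fin ?invr_gt0//; apply: expe_le => //.
by rewrite [X in _ <= X * _]EFinM -[leRHS]muleA lee_pmul2l ?lte_fin//; exact: level_powR_le.
Qed.

Lemma level_lnp_half n : P n.+1 + (M n + (ln 2)%:E) <= M n.+1 + P n.
Proof.
have h0 : (0 <= 1 / 2 :> R)%R by lra.
have ln20 : (0 <= ln 2 :> R)%R by rewrite ln_ge0//; lra.
have half (x : \bar R) : 0 <= x -> (1 / 2)%:E * x + (1 / 2)%:E * x = x.
  by move=> x0; rewrite -ge0_muleDl ?lee_fin// -EFinD (_ : (1 / 2 + 1 / 2)%R = 1%R) ?mul1e//; lra.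
have := @level_ln (1 / 2) (ln 2) 0 n h0 ln20 (lexx _); rewrite !half// adde0; apply.
move=> u v u0 v0; have := series_lnp_half u0 v0.
by rewrite addr0 !mul1r ![(2^-1 * _)%R]mulrC.
Qed.

Lemma level_lnp_double n :
  P n.+1 + (M n + M n + (Num.max (- c2 R) 0)%:E) <= M n.+1 + (P n + P n + (Num.max (c2 R) 0)%:E).
Proof.
have m0 (x : R) : (0 <= Num.max x 0)%R by rewrite le_max lexx orbT.
have := @level_ln 1 _ _ n ler01 (m0 (- c2 R)%R) (m0 (c2 R)); rewrite !mul1e; apply.
by move=> u v u0 v0; have := series_lnp_double u0 v0; rewrite !mul1r.
Qed.

Let finM n k : M (n + k) \is a fin_num -> M n \is a fin_num.
Proof.
rewrite !ge0_fin_numE//; apply: le_lt_trans.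
elim: k => [|k IH]; first by rewrite addn0.
by apply: le_trans IH _; rewrite addnS; exact: level_lnm_mono.
Qed.

(** In the Jensen step a finite right-hand side bounds the next positive part, so finiteness
    propagates upwards from level 0. *)
Let finP n : P 0 \is a fin_num -> M n \is a fin_num -> P n \is a fin_num.
Proof.
move=> p0; elim: n => // n IH mf.
have mf' : M n \is a fin_num by apply: (@finM n 1); rewrite addn1.
have := level_lnp_half n; rewrite -(fineK (IH mf')) -(fineK mf) -(fineK mf').
have := P0 n.+1; case: (P n.+1) => //.
Qed.

(** The comparison step [e |-> 2 e + c2] doubles the shifted quantity [e + c2], which explains the
    constant added inside and removed outside. *)
Lemma level_ln_le j k :
  P (j + k) - M (j + k) <=
  (2 ^ k)%:R%:E * (P 0 - M 0 + (j%:R * - ln 2 + c2 R)%:E) - (c2 R)%:E.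
Proof.
have [Mf|] := boolP (M (j + k) \is a fin_num); last first.
  rewrite ge0_fin_numE// -leNgt leye_eq => /eqP ->.
  by rewrite addeC /= leNye.
have M0f : M 0 \is a fin_num by apply: (@finM 0 (j + k)).
have [P0f|] := boolP (P 0 \is a fin_num); last first.
  rewrite ge0_fin_numE// -leNgt leye_eq => /eqP ->.
  have -> : +oo - M 0 = +oo by rewrite -(fineK M0f).
  rewrite addye// gt0_muley ?lte_fin ?ltr0n ?expn_gt0//.
  by rewrite addye// leey.
have Mi i : (i <= j + k)%N -> M i \is a fin_num.
  by move=> ij; apply: (@finM i (j + k - i)); rewrite subnKC.
have Pi i : (i <= j + k)%N -> P i \is a fin_num by move=> /Mi mi; exact: (finP P0f mi).
pose e i := (fine (P i) - fine (M i))%R.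
have s1 i : (i < j + k)%N -> (e i.+1 <= e i - ln 2)%R.
  move=> ij; have := level_lnp_half i.
  rewrite -(fineK (Pi _ ij)) -(fineK (Mi _ ij)) -(fineK (Pi _ (ltnW ij))) -(fineK (Mi _ (ltnW ij))).
  by rewrite -!EFinD lee_fin /e; lra.
have cc : (Num.max (c2 R) 0 - Num.max (- c2 R) 0 = c2 R)%R.
  by case: (leP (c2 R) 0%R); case: (leP (- c2 R)%R 0%R); lra.
have s2 i : (i < j + k)%N -> (e i.+1 <= 2 * e i + c2 R)%R.
  move=> ij; have := level_lnp_double i.
  rewrite -(fineK (Pi _ ij)) -(fineK (Mi _ ij)) -(fineK (Pi _ (ltnW ij))) -(fineK (Mi _ (ltnW ij))).
  by rewrite -!EFinD lee_fin /e; lra.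
have b1 i : (i <= j)%N -> (e i <= e 0 - i%:R * ln 2)%R.
  elim: i => [|i IH] ij; first by rewrite mul0r subr0.
  apply: le_trans (s1 _ _) _; first by rewrite (leq_trans ij)// leq_addr.
  by have := IH (ltnW ij); rewrite -(natr1 i) mulrDl mul1r; lra.
have b2 i : (i <= k)%N -> (e (j + i)%N + c2 R <= (2 ^ i)%:R * (e j + c2 R))%R.
  elim: i => [|i IH] ik; first by rewrite addn0 expn0 mul1r.
  rewrite addnS; have := s2 (j + i)%N; rewrite ltn_add2l => /(_ ik).
  by have := IH (ltnW ik); rewrite expnS natrM -mulrA; lra.
have k0 : (0 <= (2 ^ k)%:R :> R)%R by exact: ler0n.
rewrite -(fineK (Pi _ (leqnn _))) -(fineK (Mi _ (leqnn _))) -(fineK P0f) -(fineK M0f).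
rewrite -!(EFinB, EFinD, EFinM) lee_fin -!/(e _) lerBrDr.
apply: le_trans (b2 _ (leqnn k)) _; apply: ler_wpM2l => //.
by have := b1 _ (leqnn j); lra.
Qed.

End LevelBounds.

(** * Gaussian elimination *)

Section Elimination.
Context (R : realType) (T : finType).
Implicit Types (H W : T -> T -> R) (s : seq T) (i j a c : T) (b : T -> R).

Definition schur i H : T -> T -> R := fun a c => H a c - H a i * H i c / H i i.

(** Forms, sums and determinants are indexed by the list of vertices still present, so that
    eliminating a vertex removes the head of the list. *)
Definition quadS s H (x : T -> R) : R := \sum_(a <- s) \sum_(c <- s) x a * H a c * x c.

Definition posS s H := forall x : T -> R, (exists2 a, a \in s & x a != 0) -> 0 < quadS s H x.

Definition sumS s H : R := \sum_(a <- s) \sum_(c <- s) H a c.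

Definition detS s H : R :=
  \det (\matrix_(k < size s, l < size s) H (tnth (in_tuple s) k) (tnth (in_tuple s) l)).

Definition nuS s H : R :=
  if `[< posS s H >] then
    (2 / pi) `^ ((size s)%:R / 2) * expR (- (1/2) * sumS s H) * detS s H `^ (- (1/2))
  else 0.

Definition symS H := forall a c, H a c = H c a.

Let row s i H (x : T -> R) := \sum_(c <- s) H i c * x c.

Let quadS_cons i s H x : symS H -> H i i != 0 ->
  quadS (i :: s) H x = H i i * (x i + row s i H x / H i i) ^+ 2 + quadS s (schur i H) x.
Proof.
move=> sH p0; rewrite /quadS big_cons big_cons.
have -> : \sum_(c <- s) x i * H i c * x c = x i * row s i H x.
  by rewrite /row mulr_sumr; apply: eq_bigr => c _; rewrite mulrA.
have -> : \sum_(a <- s) \sum_(c <- i :: s) x a * H a c * x c =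
    x i * row s i H x + \sum_(a <- s) \sum_(c <- s) x a * H a c * x c.
  rewrite /row mulr_sumr -big_split /=; apply: eq_bigr => a _.
  by rewrite big_cons (sH a i); congr (_ + _); ring.
have -> : \sum_(a <- s) \sum_(c <- s) x a * schur i H a c * x c =
    \sum_(a <- s) \sum_(c <- s) x a * H a c * x c - row s i H x ^+ 2 / H i i.
  have -> : row s i H x ^+ 2 / H i i = \sum_(a <- s) \sum_(c <- s) (H i a * x a) * (H i c * x c) / H i i.
    rewrite expr2 {1}/row mulr_suml mulr_suml; apply: eq_bigr => a _.
    by rewrite mulr_sumr mulr_suml.
  rewrite -sumrB; apply: eq_bigr => a _; rewrite -sumrB; apply: eq_bigr => c _.
  by rewrite /schur (sH a i); field.
by field.
Qed.

Let eq_quadS s H x x' : {in s, x =1 x'} -> quadS s H x = quadS s H x'.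
Proof.
move=> xx; rewrite /quadS !big_seq; apply: eq_bigr => a as_.
by rewrite !big_seq; apply: eq_bigr => c cs; rewrite !xx.
Qed.

Let eq_row s i H x x' : {in s, x =1 x'} -> row s i H x = row s i H x'.
Proof. by move=> xx; rewrite /row !big_seq; apply: eq_bigr => c cs; rewrite !xx. Qed.

Lemma posS_cons i s H : symS H -> i \notin s ->
  posS (i :: s) H <-> 0 < H i i /\ posS s (schur i H).
Proof.
move=> sH is_; split=> [P|[p0 P] x [a]].
  have p0 : 0 < H i i.
    have := P (fun a => (a == i)%:R); rewrite /quadS big_cons big_cons eqxx mul1r mulr1.
    have z c : c \in s -> (c == i) = false by move=> cs; apply: contraNF is_ => /eqP <-.
    rewrite big_seq big1 ?addr0; last by move=> c /z ->; rewrite mulr0.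
    rewrite big_seq big1 ?addr0; last by move=> c /z ->; rewrite big1// => d _; rewrite !mul0r.
    by apply; exists i; rewrite ?mem_head// eqxx oner_neq0.
  split=> // x [a as_ xa].
  (* This value at [i] annihilates the completed square and leaves the form of the Schur
     complement. *)
  pose x' c := if c == i then - (row s i H x / H i i) else x c.
  have xx' : {in s, x' =1 x}.
    by move=> c cs; rewrite /x'; case: eqP => // ci; rewrite -ci cs in is_.
  have := P x'; rewrite quadS_cons ?gt_eqF// (eq_row _ _ xx') (eq_quadS _ xx').
  have -> : x' i = - (row s i H x / H i i) by rewrite /x' eqxx.
  rewrite addNr expr0n/= mulr0 add0r; apply.
  by exists a; rewrite ?xx'// inE as_ orbT.
have pn0 : H i i != 0 by rewrite gt_eqF.
rewrite inE quadS_cons// => ais xa.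
have [/hasP[c cs xc]|/hasPn xs] := boolP (has (fun c => x c != 0) s).
  apply: ltr_wpDl; first by rewrite mulr_ge0 ?sqr_ge0// ltW.
  by apply: P; exists c.
have x0 : {in s, x =1 fun=> 0} by move=> c /xs; rewrite negbK => /eqP.
have ai : a = i by case/orP: ais => [/eqP//|/x0 xa0]; rewrite xa0 eqxx in xa.
rewrite (eq_row _ _ x0) (eq_quadS _ x0) /row /quadS.
rewrite big1; last by move=> c _; rewrite mulr0.
rewrite big1; last by move=> c _; rewrite big1// => d _; rewrite mulr0.
by rewrite mul0r !addr0 mulr_gt0// -ai lt_neqAle sqr_ge0 eq_sym sqrf_eq0 xa.
Qed.

Lemma sumS_cons i s H : symS H -> H i i != 0 ->
  sumS (i :: s) H = (H i i + \sum_(c <- s) H i c) ^+ 2 / H i i + sumS s (schur i H).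
Proof.
move=> sH p0; have q1 s' H' : sumS s' H' = quadS s' H' (fun=> 1).
  by apply: eq_bigr => a _; apply: eq_bigr => c _; rewrite mul1r mulr1.
rewrite !q1 quadS_cons//; congr (_ + _).
rewrite (_ : row _ _ _ _ = \sum_(c <- s) H i c); first by field.
by apply: eq_bigr => c _; rewrite mulr1.
Qed.

Lemma detS_tuple n (t : n.-tuple T) H :
  \det (\matrix_(k < n, l < n) H (tnth t k) (tnth t l)) = detS t H.
Proof.
case: t => s sz; rewrite /detS /=; have n_ : n = size s by rewrite (eqP sz).
subst n.
congr (\det _); apply/matrixP => k l; rewrite !mxE.
by rewrite !(tnth_nth (tnth_default (in_tuple s) k)).
Qed.

(** Block LU factorisation with a one-by-one pivot. *)
Lemma detS_cons i s H : H i i != 0 -> detS (i :: s) H = H i i * detS s (schur i H).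
Proof.
move=> p0; rewrite /detS /=.
set M : matrix R (1 + size s) (1 + size s) := \matrix_(k, l) _; set D := (X in _ = _ * \det X).
pose u := ursubmx M; pose v := dlsubmx M.
have ME : M = block_mx (1%:M) 0 ((H i i)^-1 *: v) (1%:M) *m block_mx ((H i i)%:M) u 0 D.
  rewrite mulmx_block !mul1mx !mul0mx !addr0 -{1}(submxK M); congr block_mx.
  - by apply/matrixP => k l; rewrite !mxE (ord1 k) (ord1 l) !eqxx mulr1n.
  - by rewrite mul_mx_scalar scalerA mulfV// scale1r.
  - apply/matrixP => k l; rewrite !mxE big_ord1 !mxE.
    rewrite /schur.
    have r0 : tnth (in_tuple (i :: s)) (lshift (size s) (0 : 'I_1)) = i by [].
    have r1 (m : 'I_(size s)) : tnth (in_tuple (i :: s)) (rshift 1 m) = tnth (in_tuple s) m.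
      by rewrite !(tnth_nth i).
    rewrite r0 !r1; field.
    exact: p0.
by rewrite -[LHS]/(@determinant R (1 + size s) M) ME det_mulmx det_lblock det_ublock !det1 !mul1r det_scalar1.
Qed.

End Elimination.

(** * The density of beta and the effective weights in pivot coordinates *)

Section EliminationWeights.
Context (R : realType) (T : finType).
Implicit Types (H W : T -> T -> R) (s : seq T) (i j a c : T) (b : T -> R).

Lemma symS_schur i H : symS H -> symS (schur i H).
Proof. by move=> sH a c; rewrite /schur (sH a c) (sH a i) (sH i c); congr (_ - _ / _); ring. Qed.

Lemma eq_nuS s H H' : (forall a c, a \in s -> c \in s -> H a c = H' a c) -> nuS s H = nuS s H'.
Proof.
move=> HH.
have qE x : quadS s H x = quadS s H' x.
  rewrite /quadS !big_seq; apply: eq_bigr => a as_; rewrite !big_seq.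
  by apply: eq_bigr => c cs; rewrite HH.
have sE : sumS s H = sumS s H'.
  rewrite /sumS !big_seq; apply: eq_bigr => a as_; rewrite !big_seq.
  by apply: eq_bigr => c cs; rewrite HH.
rewrite /nuS; have -> : posS s H = posS s H'.
  by apply/propext; split=> P x xs; have := P x xs; rewrite qE.
rewrite sE; case: asboolP => // _; congr (_ * _ `^ _); congr (\det _).
by apply/matrixP => k l; rewrite !mxE HH// mem_tnth.
Qed.

Lemma posS_det_ge0 s H : symS H -> uniq s -> posS s H -> 0 <= detS s H.
Proof.
elim: s H => [|i s IH] H sH /=; first by rewrite /detS det_mx00.
move=> /andP[is_ us] /(posS_cons sH is_)[p0 P].
rewrite detS_cons ?gt_eqF// mulr_ge0 ?(ltW p0)//.
by apply: IH => //; exact: symS_schur.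
Qed.

(** The square completed at the constant vector 1 gives the exponent of [rig], and the determinant
    splits off the pivot [y]. The factor 2 comes from [(2 / pi)^(1/2) y^(-1/2) = 2 (2 pi
    y)^(-1/2)]. *)
Lemma nuS_cons i s H : symS H -> uniq (i :: s) ->
  nuS (i :: s) H = if 0 < H i i then
    2 * rig (- \sum_(c <- s) H i c) (H i i) * nuS s (schur i H) else 0.
Proof.
move=> sH /= /andP[is_ us]; rewrite /nuS.
have [P|nP] := asboolP (posS (i :: s) H); last first.
  case: ifPn => // p0; case: asboolP => [P|]; last by rewrite mulr0.
  by case: nP; apply/(posS_cons sH is_).
have [p0 P'] := (posS_cons sH is_).1 P.
have pn0 : H i i != 0 by rewrite gt_eqF.
rewrite p0; case: asboolP => // _.
rewrite sumS_cons// detS_cons//.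
have d0 := posS_det_ge0 (symS_schur i sH) us P'.
rewrite (powRM _ (ltW p0) d0) mulrDr expRD /rig opprK.
set S := \sum_(c <- s) H i c.
have -> : - (1 / 2) * ((H i i + S) ^+ 2 / H i i) = - (H i i + S) ^+ 2 / (2 * H i i).
  by field.
have pi0 : 0 < pi :> R := pi_gt0 R.
have -> : (size (i :: s))%:R / 2 = 1 / 2 + (size s)%:R / 2 :> R.
  by rewrite /= -(natr1 (size s)); field.
rewrite powRD; last by rewrite gt_eqF ?implybT// divr_gt0.
have -> : (2 * pi * H i i) `^ (- (1 / 2)) = (2 / pi) `^ (1 / 2) / 2 * H i i `^ (- (1 / 2)).
  rewrite powRM ?(ltW p0) ?mulr_ge0 ?(ltW pi0)//; congr (_ * _).
  have -> : 2 * pi = (2 / pi)^-1 * 2 ^+ 2 :> R by rewrite invf_div; field.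
  rewrite powRM ?invr_ge0 ?divr_ge0 ?sqr_ge0 ?(ltW pi0)//; congr (_ * _).
    by rewrite -powR_inv1 ?divr_ge0 ?(ltW pi0)// -powRrM mulN1r opprK.
  by rewrite powRN mul1r powR12_sqrt ?sqr_ge0// sqrtr_sqr ger0_norm.
by field.
Qed.

(* The Schur complement at [i], with [y] standing for the pivot [2 * b i - W i i]. *)
Definition elim1 i (y : R) W : T -> T -> R := fun a c => W a c + W a i * W i c / y.

(* [nu^W] in pivot coordinates; the factor 2 is the Jacobian of [b i |-> y]. *)
Fixpoint densW s W b : R :=
  if s is i :: s' then
    let y := 2 * b i - W i i in
    if 0 < y then 2 * rig (\sum_(c <- s') W i c) y * densW s' (elim1 i y W) b else 0
  else 1.

Fixpoint elimW s W b : T -> T -> R :=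
  if s is i :: s' then elimW s' (elim1 i (2 * b i - W i i) W) b else W.

Fixpoint pivotsW s W b : Prop :=
  if s is i :: s' then
    0 < 2 * b i - W i i /\ pivotsW s' (elim1 i (2 * b i - W i i) W) b
  else True.

Lemma symS_elim1 i y W : symS W -> symS (elim1 i y W).
Proof. by move=> sW a c; rewrite /elim1 (sW a c) (sW a i) (sW i c); congr (_ + _ / _); ring. Qed.

Lemma symS_Hmat W b : symS W -> symS (Hmat W b).
Proof. by move=> sW a c; rewrite /Hmat (sW a c) eq_sym; case: eqP => // ->. Qed.

Lemma nuS_densW s W b : symS W -> uniq s -> nuS s (Hmat W b) = densW s W b.
Proof.
elim: s W => [|i s IH] W sW us.
  rewrite /nuS /=; case: asboolP => [_|[]]; last by move=> x [].
  rewrite /sumS big_nil mulr0 expR0 mul0r powRr0 /detS det_mx00 powR1 !mulr1.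
  by [].
rewrite nuS_cons//; last exact: symS_Hmat.
move: us => /= /andP[is_ us].
have -> : Hmat W b i i = 2 * b i - W i i by rewrite /Hmat eqxx.
case: ifPn => // y0; congr (_ * rig _ _ * _).
  rewrite -sumrN !big_seq; apply: eq_bigr => c cs.
  by rewrite /Hmat ifN ?sub0r ?opprK//; apply: contraNneq is_ => ->.
rewrite -IH//; last exact: symS_elim1.
apply: eq_nuS => a c as_ cs.
have ai : a != i by apply: contraNneq is_ => <-.
have ci : i != c by apply: contraNneq is_ => ->.
rewrite /schur /Hmat /elim1 eqxx (negPf ai) (negPf ci) !sub0r mulrNN; ring.
Qed.

(** Any enumeration [s] of the vertices gives the same density; this is what permits eliminating the
    interior of a chosen edge first. *)
Lemma nu_density_densW s W b : symS W -> perm_eq s (enum T) ->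
  nu_density W b = (densW s W b)%:E.
Proof.
move=> sW ps; have us : uniq s by rewrite (perm_uniq ps) enum_uniq.
rewrite -nuS_densW// /nu_density /nuS.
have ss : size s = #|T| by rewrite (perm_size ps) -cardE.
have bigs (F : T -> R) : \sum_(a <- s) F a = \sum_a F a.
  by rewrite (perm_big _ ps) big_enum.
have -> : posdef (Hmat W b) = posS s (Hmat W b).
  have qE x : quadS s (Hmat W b) x = \sum_a \sum_c x a * Hmat W b a c * x c.
    by rewrite /quadS bigs; apply: eq_bigr => a _; rewrite bigs.
  apply/propext; split=> P x.
    by move=> [a _ xa]; rewrite qE; apply: P; exists a.
  by move=> [a xa]; rewrite -qE; apply: P; exists a => //; rewrite (perm_mem ps) mem_enum.
case: asboolP => // _; congr (_ %:E); rewrite ss; congr (_ * expR (_ * _) * _ `^ _).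
  by rewrite /sumS bigs; apply: eq_bigr => a _; rewrite bigs.
(* Reordering rows and columns by the same permutation multiplies the determinant by the square of a
   sign. *)
have [p sE] : exists p : 'S_#|T|, s = [tuple tnth (enum_tuple T) (p k) | k < #|T|] :> seq T.
  by apply/tuple_permP.
rewrite sE -detS_tuple /detT.
pose A := \matrix_(k < #|T|, l < #|T|) Hmat W b (enum_val k) (enum_val l).
rewrite [X in _ = \det X](_ : _ = row_perm p (col_perm p A)).
  by rewrite row_permE col_permE !det_mulmx !det_perm ?odd_permV mulrC -mulrA -expr2 sqrr_sign mulr1.
have tE m : tnth (enum_tuple T) m = enum_val m by rewrite (tnth_nth (enum_default m)).
by apply/matrixP => k l; rewrite !mxE !tnth_mktuple !tE.
Qed.

Lemma densW_pivots s1 s2 W b : densW (s1 ++ s2) W b != 0 -> pivotsW s1 W b.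
Proof.
elim: s1 W => //= i s IH W; case: ifPn => [y0|]; last by rewrite eqxx.
by rewrite mulf_eq0 negb_or => /andP[_ /IH].
Qed.

Lemma densW_ge0 s W b : 0 <= densW s W b.
Proof.
elim: s W => //= i s IH W; case: ifPn => // y0.
by rewrite mulr_ge0// mulr_ge0 ?rig_ge0.
Qed.

(* Back substitution: eliminating [s] amounts to solving the linear system on [s]. *)
Lemma elimW_solve s W b (x : T -> R) i j : symS W -> uniq s -> pivotsW s W b ->
  {in s, forall a, 2 * b a * x a - \sum_(c <- s) W a c * x c = W a j} ->
  elimW s W b i j = W i j + \sum_(c <- s) W i c * x c.
Proof.
elim: s W => [|k s IH] W sW; first by rewrite big_nil addr0.
move=> /= /andP[ks us] [y0 pv] sol; set y := 2 * b k - W k k in y0 pv *.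
have yn0 : y != 0 by rewrite gt_eqF.
have solk := sol k (mem_head _ _); rewrite big_cons in solk.
have Sk : \sum_(c <- s) W k c * x c = y * x k - W k j by rewrite /y -solk; ring.
have sumE a : \sum_(c <- s) elim1 k y W a c * x c =
    \sum_(c <- s) W a c * x c + W a k * x k - W a k * W k j / y.
  transitivity (\sum_(c <- s) W a c * x c + W a k / y * \sum_(c <- s) W k c * x c).
    rewrite mulr_sumr -big_split /=; apply: eq_bigr => c _.
    by rewrite /elim1; ring.
  by rewrite Sk; field.
rewrite IH//; last 2 first.
- exact: symS_elim1.
- move=> a as_; rewrite sumE /elim1; have := sol a; rewrite inE as_ orbT => /(_ isT); rewrite big_cons => <-.
  by ring.
by rewrite sumE big_cons /elim1; ring.
Qed.

(** The vector [H_II^-1 W_Ij], extended by zero, solves the system of [elimW_solve]. The block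
    [H_II] is invertible because a kernel vector extended by zero would contradict positive
    definiteness. *)
Lemma effective_elimW (J : {set T}) s W b i j : symS W -> posdef (Hmat W b) ->
  perm_eq s (enum (~: J)) -> pivotsW s W b -> effective J W b i j = elimW s W b i j.
Proof.
move=> sW P ps pv; rewrite /effective.
set HII := \matrix_(_, _) _.
have us : uniq s by rewrite (perm_uniq ps) enum_uniq.
have bigs (F : T -> R) : \sum_(a <- s) F a = \sum_(k < #|~: J|) F (enum_val k).
  by rewrite (perm_big _ ps) big_enum /= big_enum_val.
pose ext (z : 'I_#|~: J| -> R) a := \sum_k (enum_val k == a)%:R * z k.
have extE z k : ext z (enum_val k) = z k.
  rewrite /ext (bigD1 k)//= eqxx mul1r big1 ?addr0// => l lk.
  by rewrite (inj_eq enum_val_inj) (negPf lk) mul0r.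
have ext0 z a : a \in J -> ext z a = 0.
  move=> aJ; rewrite /ext big1// => k _; case: eqP => [ka|]; last by rewrite mul0r.
  by have := enum_valP k; rewrite ka inE aJ.
have HU : HII \in unitmx.
  rewrite unitmxE unitfE; apply/negP => /det0P[v v0 vH].
  have [k vk] : exists k, v 0 k != 0.
    apply/existsP; apply: contraNT v0 => /existsPn v0; apply/eqP/rowP => k.
    by rewrite mxE; apply/eqP; have := v0 k; rewrite negbK.
  have := P (ext (v 0)); suff -> : \sum_a \sum_c ext (v 0) a * Hmat W b a c * ext (v 0) c = 0.
    by rewrite ltxx => H; suff : false by []; apply: H; exists (enum_val k); rewrite extE.
  have split_sum (F : T -> R) : (forall a, a \in J -> F a = 0) ->
      \sum_a F a = \sum_(l < #|~: J|) F (enum_val l).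
    move=> F0; rewrite -bigs (perm_big _ ps) big_enum /= (bigID (mem (~: J)))/=.
    by rewrite [X in _ + X]big1 ?addr0// => a; rewrite inE negbK => /F0.
  rewrite split_sum; last first.
    by move=> a aJ; rewrite big1// => c _; rewrite ext0// !mul0r.
  rewrite exchange_big /= split_sum; last first.
    by move=> a aJ; rewrite big1// => c _; rewrite (ext0 _ _ aJ) mulr0.
  rewrite big1// => l _; rewrite -mulr_suml !extE.
  have := congr1 (fun m : matrix R 1 #|~: J| => m 0 l) vH; rewrite !mxE => vH0.
  rewrite (_ : \sum_(_ < _) _ = 0) ?mul0r// -[RHS]vH0; apply: eq_bigr => m _.
  by rewrite extE !mxE.
pose z k := \sum_l invmx HII k l * W (enum_val l) j.
rewrite (@elimW_solve s W b (ext z) i j)//.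
  congr (_ + _); rewrite bigs; apply: eq_bigr => k _; rewrite extE /z mulr_sumr.
  by apply: eq_bigr => l _; rewrite mulrA.
move=> a; rewrite (perm_mem ps) mem_enum => aJ.
rewrite bigs -(enum_rankK_in aJ aJ); set k := enum_rank_in _ _.
rewrite extE.
under eq_bigr do rewrite extE.
have HE l : HII k l = (if k == l then 2 * b (enum_val k) else 0) - W (enum_val k) (enum_val l).
  by rewrite mxE /Hmat (inj_eq enum_val_inj).
transitivity (\sum_l HII k l * z l).
  apply: esym; transitivity (\sum_l ((if k == l then 2 * b (enum_val k) else 0) * z l -
      W (enum_val k) (enum_val l) * z l)).
    by apply: eq_bigr => l _; rewrite -mulrBl; congr (_ * _); exact: HE.
  rewrite sumrB; congr (_ - _); rewrite (bigD1 k)//= eqxx big1 ?addr0// => l lk.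
  by rewrite eq_sym (negPf lk) mul0r.
transitivity (\sum_l (HII *m invmx HII) k l * W (enum_val l) j).
  rewrite /z; under eq_bigr do rewrite mulr_sumr.
  rewrite exchange_big /=; apply: eq_bigr => l _; rewrite mxE mulr_suml.
  by apply: eq_bigr => m _; rewrite mulrA.
rewrite mulmxV// (bigD1 k)//= mxE eqxx mul1r big1 ?addr0// => l lk.
by rewrite mxE eq_sym (negPf lk) mul0r.
Qed.

End EliminationWeights.

(** * Integration over beta as integration over pivots *)

Section NormalizedElimination.
Context (R : realType) (T : finType).
Local Notation leb := (@lebesgue_measure R).
Local Notation pos := `]0, +oo[%classic.
Implicit Types (W : T -> T -> R) (s q : seq T) (i j a c : T) (b x : T -> R)
  (C : (T -> T -> R) -> \bar R).

Let posP (y : R) : pos y -> 0 < y. Proof. by rewrite /= in_itv/= andbT. Qed.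

Definition mfunW C := forall (d : measure_display) (D : measurableType d) (Wz : D -> T -> T -> R),
  (forall a c, measurable_fun setT (fun z => Wz z a c)) ->
  measurable_fun setT (fun z => C (Wz z)).

Definition nnW W := forall a c, 0 <= W a c.

Lemma nnW_elim1 i (y : R) W : 0 < y -> nnW W -> nnW (elim1 i y W).
Proof. by move=> y0 nW a c; rewrite /elim1 addr_ge0// divr_ge0 ?mulr_ge0// ltW. Qed.

Lemma measurable_elim1 d (D : measurableType d) (Wz : D -> T -> T -> R) (y : D -> R) i :
  (forall a c, measurable_fun setT (fun z => Wz z a c)) -> measurable_fun setT y ->
  forall a c, measurable_fun setT (fun z => elim1 i (y z) (Wz z) a c).
Proof.
move=> mW my a c; apply: measurable_funD => //; apply: measurable_funM; first exact: measurable_funM.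
exact: (measurableT_comp (@measurable_invr R)).
Qed.

Lemma measurable_row d (D : measurableType d) (Wz : D -> T -> T -> R) i s :
  (forall a c, measurable_fun setT (fun z => Wz z a c)) ->
  measurable_fun setT (fun z => \sum_(c <- s) Wz z i c).
Proof. by move=> mW; exact: measurable_sum. Qed.

Lemma measurable_densW d (D : measurableType d) (Wz : D -> T -> T -> R) (bz : D -> T -> R) s :
  (forall a c, measurable_fun setT (fun z => Wz z a c)) ->
  (forall a, measurable_fun setT (fun z => bz z a)) ->
  measurable_fun setT (fun z => densW s (Wz z) (bz z)).
Proof.
elim: s Wz => [|i s IH] Wz mW mb //=.
have my : measurable_fun setT (fun z => 2 * bz z i - Wz z i i).
  by apply: measurable_funB => //; exact: measurable_funM.
apply: measurable_fun_ifT => //; first exact: measurable_fun_ltr.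
apply: measurable_funM; last by apply: IH => //; exact: measurable_elim1.
apply: measurable_funM => //; apply: measurable_rig => //; exact: measurable_row.
Qed.

Lemma measurable_elimW d (D : measurableType d) (Wz : D -> T -> T -> R) (bz : D -> T -> R) s :
  (forall a c, measurable_fun setT (fun z => Wz z a c)) ->
  (forall a, measurable_fun setT (fun z => bz z a)) ->
  forall a c, measurable_fun setT (fun z => elimW s (Wz z) (bz z) a c).
Proof.
elim: s Wz => [|i s IH] Wz mW mb a c //=.
apply: IH => // a' c'; apply: measurable_elim1 => //.
by apply: measurable_funB => //; exact: measurable_funM.
Qed.

(* Mean of [C] over the random weights left on [q] once [s] has been eliminated. *)
Fixpoint El s q C W : \bar R :=
  if s is i :: s' then
    (\int[leb]_(y in pos) ((rig (\sum_(c <- s' ++ q) W i c) y)%:E * El s' q C (elim1 i y W)))%E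
  else C W.

Lemma El_ge0 s q C W : (forall W', 0 <= C W')%E -> (0 <= El s q C W)%E.
Proof.
move=> C0; elim: s W => [|i s IH] W //=.
by apply: integral_ge0 => y _; rewrite mule_ge0// lee_fin rig_ge0.
Qed.

Lemma mfunW_El s q C : (forall W, 0 <= C W)%E -> mfunW C -> mfunW (El s q C).
Proof.
move=> C0 mC; elim: s => [|i s IH] // d D Wz mW /=.
apply: (@measurable_integral_in R _ D _ _ leb pos (fun z y =>
  (rig (\sum_(c <- s ++ q) Wz z i c) y)%:E * El s q C (elim1 i y (Wz z)))%E) => //; last first.
  by move=> z y; rewrite mule_ge0 ?El_ge0// lee_fin rig_ge0.
have mW1 a c : measurable_fun setT (fun p : D * R => Wz p.1 a c).
  exact: (measurableT_comp (mW a c)).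
apply: emeasurable_funM.
  apply/measurable_EFinP; apply: measurable_rig; last exact: measurable_snd.
  exact: (measurable_row (Wz := fun p : D * R => Wz p.1)).
apply: (IH _ _ (fun p : D * R => elim1 i p.2 (Wz p.1))).
by apply: measurable_elim1 => //; exact: measurable_snd.
Qed.

Lemma eq_El (Inv : (T -> T -> R) -> Prop) s q C C' W :
  (forall i (y : R) W', i \in s -> 0 < y -> Inv W' -> Inv (elim1 i y W')) ->
  Inv W -> (forall W', Inv W' -> C W' = C' W') -> El s q C W = El s q C' W.
Proof.
elim: s W => [|i s IH] W stable IW CC' /=; first exact: CC'.
apply: eq_integral => y; rewrite inE => /posP y0; congr (_ * _)%E; apply: IH => //.
  by move=> i' y' W' is_; apply: stable; rewrite inE is_ orbT.
by apply: stable => //; exact: mem_head.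
Qed.

Lemma El_cat s1 s2 q C W : El (s1 ++ s2) q C W = El s1 (s2 ++ q) (El s2 q C) W.
Proof.
elim: s1 W => [|i s IH] W //=; apply: eq_integral => y _.
by rewrite catA IH.
Qed.

Lemma El_cst s q (c : \bar R) W : (0 <= c)%E -> nnW W -> El s q (fun=> c) W = c.
Proof.
move=> c0; elim: s W => [|i s IH] W nW //=.
transitivity (\int[leb]_(y in pos) (c * (rig (\sum_(a <- s ++ q) W i a) y)%:E))%E.
  apply: eq_integral => y; rewrite inE => /posP y0; rewrite IH 1?muleC//.
  exact: nnW_elim1.
rewrite ge0_integralZl//.
- by rewrite integral_rig ?mule1// sumr_ge0.
- by apply: measurable_funTS; apply/measurable_EFinP; exact: measurable_rig.
- by move=> y _; rewrite lee_fin rig_ge0.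
Qed.

(* [2 b_i - W_ii] is the pivot: integrating over [b_i] gives the law [rig] of the pivot,
   whatever the diagonal entry [W_ii] is. *)
Let iint_densW_step i s W (G : (T -> T -> R) -> (T -> R) -> \bar R) C x :
  i \notin s -> nnW W -> (forall W' b, 0 <= G W' b)%E -> (forall W', mfun (G W')) ->
  (forall W', 0 <= C W')%E -> mfunW C ->
  (forall (y : R) b, 0 < y ->
    iint leb s (fun b => (densW s (elim1 i y W) b)%:E * G (elim1 i y W) b)%E b = C (elim1 i y W)) ->
  iint leb (i :: s) (fun b => (densW (i :: s) W b)%:E * G (elim1 i (2 * b i - W i i) W) b)%E x =
  (\int[leb]_(y in pos) ((rig (\sum_(c <- s) W i c) y)%:E * C (elim1 i y W)))%E.
Proof.
move=> is_ nW G0 mG C0 mC sC /=.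
pose g (y : R) := (if (0 < y)%R then (rig (\sum_(c <- s) W i c) y)%:E * C (elim1 i y W) else 0)%E.
have g0 y : (0 <= g y)%E by rewrite /g; case: ifP => // _; rewrite mule_ge0// lee_fin rig_ge0.
have mg : measurable_fun setT g.
  apply: measurable_fun_ifT => //; first exact: measurable_fun_ltr.
  apply: emeasurable_funM; first by apply/measurable_EFinP; exact: measurable_rig.
  by apply: mC; exact: (measurable_elim1 (Wz := fun=> W)).
transitivity (\int[leb]_t (2%:E * g (2 * t - W i i)%R))%E.
  apply: eq_integral => t _; set y := 2 * t - W i i.
  pose F b := (if (0 < y)%R then (2 * rig (\sum_(c <- s) W i c) y)%:E *
    ((densW s (elim1 i y W) b)%:E * G (elim1 i y W) b) else 0)%E.
  rewrite (@eq_iint R _ _ T leb s _ F); last first.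
    move=> b bx; have -> : b i = t by rewrite bx// eqxx.
    by rewrite -/y /F; case: ifP => _; rewrite ?mul0e// EFinM muleA.
  rewrite /F /g; case: ifP => y0; last first.
    rewrite mule0; move: (fun i' => _ : R) => z; elim: (s) z => //= a s' IH z.
    by rewrite integral0_eq.
  rewrite iintZl ?sC//.
  - by rewrite EFinM muleA.
  - by move=> b; rewrite mule_ge0// lee_fin densW_ge0.
  - move=> d D bz mb; apply: emeasurable_funM; last exact: mG.
    apply/measurable_EFinP.
    by apply: (measurable_densW (Wz := fun=> elim1 i y W)).
  - by rewrite lee_fin mulr_ge0 ?rig_ge0.
rewrite integral_affine// [RHS]integral_mkcond; apply: eq_integral => y _.
rewrite patchE /g (_ : (y \in _) = (0 < y)); first by case: ifP.
by apply/idP/idP; rewrite inE /= in_itv/= andbT.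
Qed.

Let iint_densW_mass s W x : uniq s -> nnW W ->
  iint leb s (fun b => (densW s W b)%:E * 1)%E x = 1%E.
Proof.
elim: s W x => [|i s IH] W x us nW; first by rewrite /= mule1.
have /= /andP[is_ us'] := us.
have c0 : (0 <= 1 :> \bar R)%E by [].
have S := @iint_densW_step i s W (fun _ _ => 1%E) (fun=> 1%E) x is_ nW (fun _ _ => c0).
apply: etrans; first apply: S.
- by move=> W' d D bz _; exact: measurable_cst.
- by [].
- by move=> d D Wz _; exact: measurable_cst.
- by move=> y b y0; apply: IH => //; exact: nnW_elim1.
by under eq_integral do rewrite mule1; rewrite integral_rig// sumr_ge0.
Qed.

(** The matrix left after eliminating [s1] depends only on beta over [s1]; the remaining variables
    contribute total mass 1, and those of [s1] become independent choices of pivots given the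
    current weights. *)
Lemma iint_densW s1 s2 W C x : uniq (s1 ++ s2) -> nnW W ->
  (forall W', 0 <= C W')%E -> mfunW C ->
  iint leb (s1 ++ s2) (fun b => (densW (s1 ++ s2) W b)%:E * C (elimW s1 W b))%E x = El s1 s2 C W.
Proof.
move=> us nW C0 mC; elim: s1 W x us nW => [|i s IH] W x us nW.
  rewrite cat0s in us *.
  transitivity (iint leb s2 (fun b => C W * ((densW s2 W b)%:E * 1))%E x).
    by apply: eq_iint => b _; rewrite mule1 muleC.
  rewrite iintZl ?iint_densW_mass ?mule1//.
  - by move=> b; rewrite mule1 lee_fin densW_ge0.
  - move=> d D bz mb; apply: emeasurable_funM => //; apply/measurable_EFinP.
    by apply: (measurable_densW (Wz := fun=> W)).
have := us; rewrite cat_cons /= => /andP[is_ us'].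
have mG W' : mfun (fun b => C (elimW s W' b)).
  by move=> d D bz mb; apply: mC => a c; apply: (measurable_elimW (Wz := fun=> W')).
apply: (etrans (@iint_densW_step i (s ++ s2) W (fun W' b => C (elimW s W' b)) (El s s2 C) x
  is_ nW (fun _ _ => C0 _) mG (fun W' => El_ge0 s s2 W' C0) (mfunW_El s s2 C0 mC) _)) => //.
by move=> y b y0; apply: IH => //; exact: nnW_elim1.
Qed.

End NormalizedElimination.

Ltac natlia := repeat (match goal with H : ?P |- _ => lazymatch P with
  | is_true (leq _ _) => fail
  | is_true (andb (leq _ _) (leq _ _)) => fail
  | @eq nat _ _ => fail
  | nat => fail
  | _ => clear H
  end end); lia.

(** * Elimination along a path *)

Section PathElimination.
Context (R : realType) (T : finType).
Local Notation pos := `]0, +oo[%classic.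
Implicit Types (W : T -> T -> R) (s q : seq T) (C : (T -> T -> R) -> \bar R) (h : R -> \bar R).

(** The [2^n] edges from index [k] on, reduced in series along a balanced binary tree; it is the
    counterpart of [level] for given weights. *)
Fixpoint dyadic n (w : nat -> R) k h : \bar R :=
  if n is n'.+1 then
    dyadic n' w k (fun u => dyadic n' w (k + 2 ^ n')%N (fun u' => series u u' h))
  else h (w k).

Lemma eq_dyadic n w w' k h : (forall a, (k <= a < k + 2 ^ n)%N -> w a = w' a) ->
  dyadic n w k h = dyadic n w' k h.
Proof.
elim: n k h => [|n IH] k h ww' /=; first by rewrite ww'// expn0; lia.
rewrite (IH k); last by move=> a ak; apply: ww'; rewrite expnS; lia.
congr (dyadic n w' k); apply/funext => u.
by apply: IH => a ak; apply: ww'; rewrite expnS; lia.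
Qed.

Variable v : nat -> T.

(** Inner vertices in the order both halves, then midpoint, so that each vertex meets only two
    already reduced edges when its turn comes. *)
Fixpoint blockV n k : seq T :=
  if n is n'.+1 then blockV n' k ++ (blockV n' (k + 2 ^ n')%N ++ [:: v (k + 2 ^ n')%N]) else [::].

Lemma mem_blockV n k x : reflect (exists2 a, (k < a < k + 2 ^ n)%N & x = v a) (x \in blockV n k).
Proof.
elim: n k x => [|n IH] k x /=; first by constructor; move=> [a]; rewrite expn0; lia.
have p0 : (0 < 2 ^ n)%N by rewrite expn_gt0.
rewrite !mem_cat inE; apply: (iffP or3P) => [[/IH[a ak ->]|/IH[a ak ->]|/eqP->]|[a ak ->]].
- by exists a => //; rewrite expnS; lia.
- by exists a => //; rewrite expnS; lia.
- by exists (k + 2 ^ n)%N => //; rewrite expnS; lia.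
have [ak'|ak'|->] := ltngtP a (k + 2 ^ n)%N.
- by constructor 1; apply/IH; exists a => //; lia.
- by constructor 2; apply/IH; exists a => //; rewrite expnS in ak; lia.
- by constructor 3.
Qed.

Variable N : nat.
Hypothesis vinj : forall a c, (a <= N)%N -> (c <= N)%N -> v a = v c -> a = c.

Let vneq a c : (a <= N)%N -> (c <= N)%N -> a != c -> v a != v c.
Proof. by move=> aN cN; apply: contraNneq => /vinj ->. Qed.

Definition is_pair (x y a c : T) := ((a == x) && (c == y)) || ((a == y) && (c == x)).

Let sum_delta q z (u : R) : uniq q -> z \in q -> \sum_(c <- q) (c == z)%:R * u = u.
Proof.
move=> uq zq; rewrite (bigD1_seq z)//= eqxx mul1r big1 ?addr0// => c /negPf ->.
by rewrite mul0r.
Qed.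

(** By induction each half collapses to one edge. The midpoint is then joined within [q] to the two
    ends only, with weights [u1] and [u2]: its pivot has density [rig (u1 + u2)], and its removal
    creates the weight [u1 u2 / y], as the ends were not joined before. Of the final matrix, the
    continuation [C] is told the new weight, symmetry, nonnegativity and the unchanged off-diagonal
    entries. *)
Lemma El_block n k (w : nat -> R) W q C h : (k + 2 ^ n <= N)%N ->
  uniq (blockV n k ++ q) -> symS W -> nnW W -> v k \in q -> v (k + 2 ^ n)%N \in q ->
  (forall a, (k <= a < k + 2 ^ n)%N -> W (v a) (v a.+1) = w a) ->
  (forall a x, (k < a < k + 2 ^ n)%N -> x \in blockV n k ++ q ->
     x != v a -> x != v a.-1 -> x != v a.+1 -> W (v a) x = 0) ->
  ((0 < n)%N -> W (v k) (v (k + 2 ^ n)%N) = 0) ->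
  (forall W' u, symS W' -> nnW W' -> W' (v k) (v (k + 2 ^ n)%N) = u ->
     (forall a c, a \in q -> c \in q -> a != c -> ~~ is_pair (v k) (v (k + 2 ^ n)%N) a c ->
        W' a c = W a c) -> C W' = h u) ->
  El (blockV n k) q C W = dyadic n w k h.
Proof.
elim: n k W q C h => [|n IH] k W q C h kN us sW nW kq eq We Wz W0 Ch.
  apply: Ch => //; first by rewrite expn0 addn1 We// expn0; lia.
have [D DE] : {D | D = (2 ^ n)%N} by exists (2 ^ n)%N.
have D0 : (0 < D)%N by rewrite DE expn_gt0.
have [k' k'E] : {k' | k' = (k + D)%N} by exists (k + D)%N.
have [e eE] : {e | e = (k' + D)%N} by exists (k' + D)%N.
have ke : (k + 2 ^ n.+1 = e)%N by rewrite expnS -DE; natlia.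
rewrite ke in kN eq We Wz W0 Ch *.
have D2 : (0 < n)%N -> (1 < D)%N by move=> n0; rewrite DE -{1}(expn0 2) ltn_exp2l.
have k'N : (k' <= N)%N by natlia.
have kN' : (k <= N)%N by natlia.
have bE : blockV n.+1 k = blockV n k ++ (blockV n k' ++ [:: v k']) by rewrite k'E DE.
set q'' := v k' :: q; set q' := blockV n k' ++ q''.
have us' : uniq (blockV n k ++ q') by rewrite bE -!catA /= in us.
have us'' : uniq (blockV n k' ++ q'') by move: us'; rewrite cat_uniq => /and3P[].
have /andP[k'q uq] : uniq q'' by move: us''; rewrite cat_uniq => /and3P[].
have memq x : (x \in blockV n.+1 k ++ q) = (x \in blockV n k ++ q').
  by rewrite bE -!catA.
have qq' x : x \in q -> x \in q'.
  by move=> xq; rewrite mem_cat inE xq !orbT.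
have q''q' x : x \in q'' -> x \in q' by move=> xq; rewrite mem_cat xq orbT.
have vq' a : (k' <= a <= e)%N -> v a \in q'.
  move=> /andP[]; rewrite leq_eqVlt => /predU1P[<- _|ka].
    by rewrite mem_cat mem_head orbT.
  rewrite leq_eqVlt => /predU1P[->|ae]; first exact: qq'.
  by rewrite mem_cat; apply/orP; left; apply/mem_blockV; exists a => //; rewrite -DE -eE ka.
rewrite bE El_cat -catA; apply: (IH _ _ _ _ _ _ us') => //.
- by rewrite -DE -k'E.
- exact: qq'.
- by rewrite -DE -k'E; apply: vq'; natlia.
- by move=> a; rewrite -DE -k'E => ak; apply: We; natlia.
- by move=> a x; rewrite -DE -k'E => ak; rewrite -memq; apply: Wz; natlia.
- move=> n0; rewrite -DE -k'E sW; have {}D2 := D2 n0.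
  apply: Wz; [by natlia|by rewrite memq mem_cat qq' ?orbT| | |]; apply: vneq => //; natlia.
rewrite -DE -k'E => W1 u1 sW1 nW1 Wu1 W1E.
have W1W a c : a \in q' -> c \in q' -> a != c -> ~~ is_pair (v k) (v k') a c -> W1 a c = W a c.
  exact: W1E.
rewrite El_cat; apply: (IH _ _ _ _ _ _ us'') => //.
- by rewrite -DE -eE.
- exact: mem_head.
- by rewrite -DE -eE inE eq orbT.
- rewrite -DE -eE => a ak; rewrite W1W.
  + by apply: We; natlia.
  + by apply: vq'; natlia.
  + by apply: vq'; natlia.
  + by apply: vneq; natlia.
  + by rewrite negb_or !negb_and; apply/andP; split; apply/orP;
      [left|right]; apply: vneq; natlia.
- rewrite -DE -eE => a x ak xq xa xa1 xa2; rewrite W1W//.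
  + by apply: Wz => //; [natlia|rewrite memq mem_cat xq orbT].
  + by apply: vq'; natlia.
  + by rewrite eq_sym.
  + by rewrite negb_or !negb_and; apply/andP; split; apply/orP; left; apply: vneq; natlia.
- rewrite -DE -eE => n0; have {}D2 := D2 n0.
  rewrite W1W; [|by apply: vq'; natlia|by apply: vq'; natlia|by apply: vneq; natlia|].
    apply: Wz; [natlia|by rewrite memq mem_cat qq' ?orbT| | |]; apply: vneq => //; natlia.
  by rewrite negb_or !negb_and; apply/andP; split; apply/orP; [left|right]; apply: vneq; natlia.
rewrite -DE -eE => W2 u2 sW2 nW2 Wu2 W2E /=.
have k'q2 a : a \in q -> a != v k' by move=> aq; apply: contraNneq k'q => <-.
have W2W1 a c : a \in q'' -> c \in q'' -> a != c -> ~~ is_pair (v k') (v e) a c -> W2 a c = W1 a c.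
  exact: W2E.
have W2q a c : a \in q -> c \in q -> a != c -> W2 a c = W a c.
  move=> aq cq ac; rewrite W2W1 ?W1W ?qq' ?inE ?aq ?cq ?orbT//.
    by rewrite negb_or !negb_and (k'q2 a)// (k'q2 c)// !orbT.
  by rewrite negb_or !negb_and (k'q2 a)// (k'q2 c)// !orbT.
have W2k : W2 (v k') (v k) = u1.
  rewrite W2W1 ?mem_head ?inE ?kq ?orbT//; first by rewrite sW1.
    by apply: vneq; natlia.
  by rewrite negb_or !negb_and; apply/andP; split; apply/orP; [right|left]; apply: vneq; natlia.
have W2z c : c \in q -> c != v k -> c != v e -> W2 (v k') c = 0.
  move=> cq ck ce; have ck' := k'q2 _ cq.
  rewrite W2W1 ?mem_head ?inE ?cq ?orbT//; last 2 first.
  - by rewrite eq_sym.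
  - by rewrite negb_or !negb_and ce ck' !orbT.
  rewrite W1W ?(q''q' _ (mem_head _ _)) ?(qq' _ cq)//; last 2 first.
  - by rewrite eq_sym.
  - by rewrite negb_or !negb_and ck ck' !orbT.
  have notq s1 s2 x : uniq (s1 ++ s2) -> x \in s1 -> x \notin s2.
    by rewrite cat_uniq => /and3P[_ /hasPn H _] xs1; apply/negP => /H; rewrite xs1.
  apply: Wz => //; [by natlia|by rewrite memq mem_cat qq' ?orbT| |].
  (* A path neighbour of the midpoint other than an end has already been eliminated, hence is not in
     [q]. *)
  + apply: contraNneq ck => cE; move: cq; rewrite cE.
    have [kk|kk] := eqVneq k'.-1 k; first by rewrite kk.
    have {}kk : (k < k'.-1)%N by rewrite ltn_neqAle eq_sym kk /=; natlia.
    have : v k'.-1 \in blockV n k by apply/mem_blockV; exists k'.-1 => //; rewrite -DE; natlia.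
    by move=> /(notq _ _ _ us') /negP nq /qq' /nq.
  + apply: contraNneq ce => cE; move: cq; rewrite cE.
    have [kk|kk] := eqVneq k'.+1 e; first by rewrite kk.
    have {}kk : (k'.+1 < e)%N by rewrite ltn_neqAle kk /=; natlia.
    have : v k'.+1 \in blockV n k' by apply/mem_blockV; exists k'.+1 => //; rewrite -DE -eE; natlia.
    by move=> /(notq _ _ _ us'') /negP nq xq; case: nq; rewrite inE xq orbT.
have ek : v e != v k by apply: vneq; natlia.
(* Total weight at the midpoint: only its edges to the two ends survive. *)
have rowE : \sum_(c <- q) W2 (v k') c = u1 + u2.
  rewrite -[in RHS](sum_delta u1 uq kq) -[in RHS](sum_delta u2 uq eq) -big_split /=.
  apply: eq_big_seq => z zq.
  have [->|zk] := eqVneq z (v k); first by rewrite W2k eq_sym (negPf ek) mul1r mul0r addr0.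
  have [->|ze] := eqVneq z (v e); first by rewrite Wu2 mul0r mul1r add0r.
  by rewrite W2z// !mul0r addr0.
rewrite rowE; apply: eq_integral => y; rewrite inE /= in_itv/= andbT => y0.
congr (_ * _)%E; apply: Ch.
- exact: symS_elim1.
- exact: nnW_elim1.
- rewrite /elim1 W2q// 1?eq_sym// W0// add0r [W2 (v k) _]sW2 W2k Wu2.
  by [].
- move=> a c aq cq ac npair; rewrite /elim1 W2q//.
  suff -> : W2 a (v k') * W2 (v k') c = 0 by rewrite mul0r addr0.
  rewrite [W2 a _]sW2.
  have [ak|ak] := eqVneq a (v k).
    have [ce|ce] := eqVneq c (v e); first by rewrite /is_pair ak ce !eqxx in npair.
    by rewrite [X in _ * X]W2z ?mulr0// -ak eq_sym.
  have [ae|ae] := eqVneq a (v e); last by rewrite W2z// mul0r.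
  have [ck|ck] := eqVneq c (v k); first by rewrite /is_pair ae ck !eqxx orbT in npair.
  by rewrite [X in _ * X]W2z ?mulr0// -ae eq_sym.
Qed.

(* Eliminating the interiors of the other level-[l] edges never joins [i] and [j],
   because each interior touches at most one of them. *)
Lemma El_labels (L : eqType) (lab : T -> L) i j s q h W : nnW W -> (forall x, 0 <= h x)%E ->
  {in s &, forall a c, lab a != lab c -> W a c = 0} ->
  (forall k, {in s, forall a, lab a = k -> W i a = 0} \/ {in s, forall a, lab a = k -> W a j = 0}) ->
  El s q (fun W' => h (W' i j)) W = h (W i j).
Proof.
move=> nW h0 lab0 side.
pose Inv W' := [/\ nnW W', {in s &, forall a c, lab a != lab c -> W' a c = 0},
  forall k, {in s, forall a, lab a = k -> W' i a = 0} \/ {in s, forall a, lab a = k -> W' a j = 0} &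
  W' i j = W i j].
rewrite (@eq_El _ _ Inv s q _ (fun=> h (W i j))) ?El_cst//; last by move=> W' [_ _ _ ->].
move=> a y W' as_ y0 [nW' lab0' side' ij]; split.
- exact: nnW_elim1.
- move=> b c bs cs bc; rewrite /elim1 lab0'// add0r.
  have [ab|ab] := eqVneq (lab b) (lab a).
    by rewrite [W' a c]lab0' ?mulr0 ?mul0r// -ab.
  by rewrite [W' b a]lab0' ?mul0r.
- move=> k; case: (side' k) => zk; [left|right] => b bs bk; rewrite /elim1 zk// add0r.
    have [ak|ak] := eqVneq (lab a) k; first by rewrite (zk a)// !mul0r.
    by rewrite [W' a b]lab0' ?mulr0 ?mul0r// bk.
  have [ak|ak] := eqVneq (lab a) k; first by rewrite (zk a)// mulr0 mul0r.
  by rewrite [W' b a]lab0' ?mul0r// bk eq_sym.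
- rewrite /elim1 ij; case: (side' (lab a)) => zk; rewrite (zk a)// ?mulr0 !mul0r addr0//.
Qed.

End PathElimination.

(** * Averaging dyadic reductions over independent weights *)

Section DyadicLevel.
Local Open Scope classical_set_scope.
Context (R : realType) (mu : probability R R).
Local Notation leb := (@lebesgue_measure R).
Local Notation pos := `]0, +oo[%classic.
Implicit Types (w : nat -> R) (h : R -> \bar R).

Lemma dyadic_ge0 n w k h : (forall u, 0 <= h u)%E -> (0 <= dyadic n w k h)%E.
Proof.
elim: n k h => [|n IH] k h h0 //=.
by apply: (IH) => u; apply: (IH) => u'; exact: series_ge0.
Qed.

Lemma measurable_dyadic d (D : measurableType d) n (w : D -> nat -> R) k (H : D -> R -> \bar R) :
  (forall a, measurable_fun setT (fun z => w z a)) ->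
  measurable_fun setT (fun p : D * R => H p.1 p.2) -> (forall z x, 0 <= H z x)%E ->
  measurable_fun setT (fun z => dyadic n (w z) k (H z)).
Proof.
elim: n d D w k H => [|n IH] d D w k H mw mH H0 /=.
  by apply: (measurableT_comp mH (g := fun z => (z, w z k))); exact: measurable_fun_pair.
apply: (IH d D w k (fun z u => dyadic n (w z) (k + 2 ^ n)%N (fun u' => series u u' (H z)))) => //.
- apply: (IH _ (D * R)%type (fun p => w p.1) _ (fun p u' => series p.2 u' (H p.1))).
  + by move=> a; apply: (measurableT_comp (mw a)); exact: measurable_fst.
  + apply: (@measurable_series _ _ (D * R * R)%type (fun q => q.1.2) (fun q => q.2)
      (fun q x => H q.1.1 x)) => //.
    * exact: (measurableT_comp measurable_snd measurable_fst).
    * exact: measurable_snd.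
    * apply: (measurableT_comp mH (g := fun q : (D * R * R) * R => (q.1.1.1, q.2))).
      apply: measurable_fun_pair; last exact: measurable_snd.
      apply: (measurableT_comp measurable_fst (g := fun q : (D * R * R) * R => q.1.1)).
      exact: (measurableT_comp measurable_fst measurable_fst).
  + by move=> p v; exact: series_ge0.
- by move=> z u; apply: dyadic_ge0 => v; exact: series_ge0.
Qed.

Lemma series_integral u v (G : R -> R -> \bar R) :
  measurable_fun setT (fun p : R * R => G p.1 p.2) -> (forall t x, 0 <= G t x)%E ->
  series u v (fun x => \int[mu]_t G t x)%E = (\int[mu]_t series u v (G t))%E.
Proof.
move=> mG G0; pose F y t := ((rig (u + v) y)%:E * G t (u * v / y)%R)%E.
have mF : measurable_fun setT (fun p : R * R => F p.1 p.2).
  apply: emeasurable_funM.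
    by apply/measurable_EFinP; apply: measurable_rig => //; exact: measurable_fst.
  apply: (measurableT_comp mG (g := fun p : R * R => (p.2, u * v / p.1))).
  apply: measurable_fun_pair; first exact: measurable_snd.
  apply: measurable_funM => //; apply: (measurableT_comp (@measurable_invr R)).
  exact: measurable_fst.
rewrite /series -(@tonelli_in R _ _ _ _ leb mu pos setT F)//; last first.
  by move=> y t; rewrite mule_ge0// lee_fin rig_ge0.
apply: eq_integral => y _; rewrite ge0_integralZl// ?lee_fin ?rig_ge0//.
by apply: (measurableT_comp mG (g := fun t => (t, u * v / y))); exact: measurable_fun_pair.
Qed.

Lemma dyadic_integral n w k (G : R -> R -> \bar R) :
  measurable_fun setT (fun p : R * R => G p.1 p.2) -> (forall t x, 0 <= G t x)%E ->
  dyadic n w k (fun x => \int[mu]_t G t x)%E = (\int[mu]_t dyadic n w k (G t))%E.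
Proof.
elim: n k G => [//|n IH] k G mG G0 /=.
have ms : measurable_fun setT (fun p : R * R * R => series p.1.2 p.2 (G p.1.1)).
  apply: (@measurable_series _ _ _ (fun q : R * R * R => q.1.2) (fun q => q.2)
      (fun q x => G q.1.1 x)) => //.
  - exact: (measurableT_comp measurable_snd measurable_fst).
  - exact: measurable_snd.
  - apply: (measurableT_comp mG (g := fun q : (R * R * R) * R => (q.1.1.1, q.2))).
    apply: measurable_fun_pair; last exact: measurable_snd.
    apply: (measurableT_comp measurable_fst (g := fun q : (R * R * R) * R => q.1.1)).
    exact: (measurableT_comp measurable_fst measurable_fst).
rewrite -(IH k (fun t u => dyadic n w (k + 2 ^ n)%N (fun u' => series u u' (G t)))).
- congr (dyadic n w k); apply/funext => u.
  rewrite -(IH _ (fun t u' => series u u' (G t))).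
  + by congr (dyadic n w _); apply/funext => u'; exact: series_integral.
  + apply: (measurableT_comp ms (g := fun p : R * R => (p.1, u, p.2))).
    apply: measurable_fun_pair; last exact: measurable_snd.
    by apply: measurable_fun_pair => //; exact: measurable_fst.
  + by move=> t x; exact: series_ge0.
- apply: (@measurable_dyadic _ _ n (fun=> w) _ (fun (p : R * R) u' => series p.2 u' (G p.1))) => //.
  by move=> p x; exact: series_ge0.
- by move=> t x; apply: dyadic_ge0 => u; exact: series_ge0.
Qed.

Context (I : eqType).

Lemma dyadic_iint n w k s (G : (I -> R) -> R -> \bar R) x0 :
  (forall d (D : measurableType d) (g : D -> I -> R) (u : D -> R),
    (forall i, measurable_fun setT (fun z => g z i)) -> measurable_fun setT u ->
    measurable_fun setT (fun z => G (g z) (u z))) ->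
  (forall y x, 0 <= G y x)%E ->
  dyadic n w k (fun u => iint mu s (fun y => G y u) x0) =
  iint mu s (fun y => dyadic n w k (G y)) x0.
Proof.
move=> mG G0; elim: s x0 => [//|a s IH] x0 /=.
rewrite (@dyadic_integral n w k (fun t u => iint mu s (fun y => G y u) (upd x0 a t))).
- by apply: eq_integral => t _; exact: IH.
- apply: (@measurable_iint _ _ R I mu _ R s (fun u y => G y u) _ _ _ (R * R)%type snd
    (fun p : R * R => upd x0 a p.1)) => //.
  + by move=> d D g x mg mx; exact: mG.
  + by apply: (measurable_upd (x := fun=> x0)) => //; exact: measurable_fst.
- by move=> t x; exact: iint_ge0.
Qed.

(* Independent edge weights along a dyadic block turn the pointwise series
   reductions into the recursion on laws. *)
Lemma iint_dyadic n k (c : nat -> I) h x0 :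
  {in [pred a | (k <= a < k + 2 ^ n)%N] &, injective c} ->
  measurable_fun setT h -> (forall u, 0 <= h u)%E ->
  iint mu [seq c a | a <- iota k (2 ^ n)] (fun x => dyadic n (x \o c) k h) x0 = level mu n h.
Proof.
elim: n k h x0 => [|n IH] k h x0 cinj mh h0 /=.
  by apply: eq_integral => t _; rewrite /= eqxx.
have m2 : measurable_fun setT (fun p : R * R => series p.1 p.2 h).
  apply: (@measurable_series _ _ _ fst snd (fun=> h)) => //.
  exact: (measurableT_comp mh).
rewrite expnS mul2n -addnn iotaD map_cat iint_cat.
rewrite -(IH k _ x0); first last.
- by move=> u; apply: level_ge0 => v; exact: series_ge0.
- apply: (@measurable_level _ mu _ _ n (fun u v => series u v h)) => //.
  by move=> u v; exact: series_ge0.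
- by move=> a b ak bk; apply: cinj; move: ak bk; rewrite !inE expnS; lia.
apply: (@eq_iint R _ _ I mu) => x _.
rewrite (@eq_iint R _ _ I mu _ _ (fun y => dyadic n (x \o c) k (fun u =>
  dyadic n (y \o c) (k + 2 ^ n)%N (fun u' => series u u' h)))); last first.
  move=> y yx; apply: eq_dyadic => a ak /=; apply: yx.
  apply/negP => /mapP[b]; rewrite mem_iota => bk /cinj E.
  have : a = b by apply: E; rewrite !inE expnS; lia.
  by lia.
(* The weights of the first half are frozen in [x], and the integrals over the second half move
   inside its reduction, where the induction hypothesis applies. *)
rewrite -(@dyadic_iint n (x \o c) k _ (fun y u =>
  dyadic n (y \o c) (k + 2 ^ n)%N (fun u' => series u u' h)) x); last first.
- by move=> y u; apply: dyadic_ge0 => u'; exact: series_ge0.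
- move=> d D g u mg mu'.
  apply: (@measurable_dyadic _ _ n (fun z => g z \o c) _ (fun z u' => series (u z) u' h)) => //.
  + by move=> a /=; exact: mg.
  + apply: (measurableT_comp m2 (g := fun p : D * R => (u p.1, p.2))).
    apply: measurable_fun_pair; last exact: measurable_snd.
    by apply: (measurableT_comp mu'); exact: measurable_fst.
  + by move=> z u'; exact: series_ge0.
congr (dyadic n _ k); apply/funext => u; apply: IH.
- by move=> a b ak bk; apply: cinj; move: ak bk; rewrite !inE expnS; lia.
- by apply: (measurableT_comp m2 (g := fun v => (u, v))); exact: measurable_fun_pair.
- by move=> v; exact: series_ge0.
Qed.

End DyadicLevel.

(** * Subdivided graphs *)

Section Subdivision.
Context (R : realType) (V Ed : finType) (src tgt : Ed -> V).
Hypothesis HG : simple_connected_graph src tgt.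
Variable r : nat.
Local Notation T := (svert V Ed r).
Local Notation N := (2 ^ r)%N.
Local Notation pos := (pos src tgt r).
Implicit Types (e f : Ed) (j t : nat).

Let N0 : (0 < N)%N. Proof. by rewrite expn_gt0. Qed.

Lemma pos_first e : pos e 0 = inl (src e). Proof. by []. Qed.

Lemma pos_last e j : (N <= j)%N -> pos e j = inl (tgt e).
Proof.
move=> jN; rewrite /Defs.pos ifF; last by apply/eqP; lia.
by rewrite insubF//; apply/negbTE; lia.
Qed.

Lemma pos_inner e j (jN : (j < N.-1)%N) : pos e j.+1 = inr (e, Ordinal jN).
Proof. by rewrite /Defs.pos /= insubT. Qed.

Lemma pos_inner_inj e f j t : (0 < j < N)%N -> pos e j = pos f t -> e = f /\ j = t.
Proof.
case: j => // j /andP[_ jN]; have jN' : (j < N.-1)%N by lia.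
rewrite (pos_inner _ jN'); case: t => [|t]; first by rewrite pos_first.
have [tN|tN] := ltnP t N.-1; last by rewrite pos_last; [|lia].
by rewrite (pos_inner _ tN) => -[-> ->].
Qed.

Lemma pos_inj e j t : (j <= N)%N -> (t <= N)%N -> pos e j = pos e t -> j = t.
Proof.
case: HG => st _ _ jN tN E.
have [j0|j0] := boolP (0 < j < N)%N; first by case: (pos_inner_inj j0 E).
have [t0|t0] := boolP (0 < t < N)%N; first by case: (pos_inner_inj t0 (esym E)).
have {}j0 : j = 0%N \/ j = N by lia.
have {}t0 : t = 0%N \/ t = N by lia.
have neq := st e.
case: j0 t0 E => -> [] ->//; rewrite pos_first pos_last// => -[] /eqP; rewrite ?(negPf neq)//.
by rewrite eq_sym (negPf neq).
Qed.

Definition touches e j f t D := pos e j = pos f t \/ pos e j = pos f (t + D).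

(** A segment of length [D] is determined by its ends. If one end is an inner vertex, it fixes the
    original edge and the position; otherwise the segments are whole edges of the original graph,
    and the absence of loops and multiple edges decides. *)
Lemma block_ends_inj D e f q p : (0 < D)%N -> (q.+1 * D <= N)%N -> (p.+1 * D <= N)%N ->
  touches e (q * D) f (p * D) D -> touches e (q.+1 * D) f (p * D) D -> e = f /\ q = p.
Proof.
rewrite /touches addnC -mulSn => D0 qN pN Eq Eq1.
have [qi|qi] := boolP (0 < q * D < N)%N.
  have ef : e = f by case: Eq => /(pos_inner_inj qi)[].
  split=> //; rewrite -ef in Eq Eq1.
  have Eq' : q = p \/ q = p.+1.
    by case: Eq => /(pos_inner_inj qi)[_] /eqP; rewrite eqn_pmul2r// => /eqP; [left|right].
  have Eq1' : q.+1 = p \/ q.+1 = p.+1.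
    case: Eq1 => /pos_inj E1; [left|right]; apply/eqP; rewrite -(eqn_pmul2r D0); apply/eqP.
      by apply: E1 => //; lia.
    exact: E1.
  lia.
have [qi1|qi1] := boolP (0 < q.+1 * D < N)%N.
  have ef : e = f by case: Eq1 => /(pos_inner_inj qi1)[].
  split=> //; rewrite -ef in Eq Eq1.
  have Eq1' : q.+1 = p \/ q.+1 = p.+1.
    by case: Eq1 => /(pos_inner_inj qi1)[_] /eqP; rewrite eqn_pmul2r// => /eqP; [left|right].
  have Eq' : q = p \/ q = p.+1.
    case: Eq => /pos_inj E1; [left|right]; apply/eqP; rewrite -(eqn_pmul2r D0); apply/eqP.
      by apply: E1 => //; lia.
    by apply: E1 => //; lia.
  lia.
have q0 : q = 0%N.
  have : (q * D < N)%N by lia.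
  move: qi; case: (q) => // q'; rewrite mulSn; lia.
move: qi1 Eq Eq1; rewrite q0 mul1n mul0n => Di.
have DN : D = N by rewrite q0 mul1n in qN; lia.
have p0 : p = 0%N.
  by apply/eqP; rewrite -leqn0 -(leq_pmul2r D0) mul0n; rewrite mulSn DN in pN *; lia.
rewrite p0 mul0n mul1n DN !pos_first !(pos_last _ (leqnn N)).
case: HG => st pairI _ E1 E2; split=> //; apply: pairI.
have ne := st e; have nf := st f.
case: E1 E2 => -[E1] [] [E2].
- by rewrite E1 E2 eqxx in ne.
- by rewrite E1 E2.
- by apply/setP => x; rewrite !inE E1 E2 orbC.
- by rewrite E1 E2 eqxx in ne.
Qed.

Implicit Types (w : sedge Ed r -> R) (a b x : T).

Lemma sedge_endsP (k : sedge Ed r) x :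
  reflect (x = pos k.1 k.2 \/ x = pos k.1 k.2.+1) (x \in sedge_ends src tgt k).
Proof. by rewrite !inE; apply: (iffP orP) => -[/eqP|/eqP]; auto; move=> ->; auto; right; apply/eqP. Qed.

Lemma Wmat_sym w a b : Wmat src tgt w a b = Wmat src tgt w b a.
Proof.
rewrite /Wmat; apply: eq_bigl => k; congr (_ == _).
by apply/setP => x; rewrite !inE orbC.
Qed.

Lemma Wmat_ge0 w a b : (forall k, 0 <= w k) -> 0 <= Wmat src tgt w a b.
Proof. by move=> w0; apply: sumr_ge0. Qed.

Lemma Wmat_neq0 w a b : Wmat src tgt w a b != 0 ->
  exists k : sedge Ed r, pair2 a b = sedge_ends src tgt k.
Proof.
have [/existsP[k /eqP Ef] _|/existsPn nex] := boolP [exists k : sedge Ed r, pair2 a b == sedge_ends src tgt k].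
  by exists k.
by rewrite /Wmat big_pred0 ?eqxx// => k; apply/negbTE/nex.
Qed.

Lemma Wmat_edge w (k : sedge Ed r) : Wmat src tgt w (pos k.1 k.2) (pos k.1 k.2.+1) = w k.
Proof.
rewrite /Wmat (big_pred1 k)// => g; rewrite /= eq_sym.
apply/eqP/eqP => [E|-> //].
have tch x : x \in sedge_ends src tgt g -> x = pos k.1 k.2 \/ x = pos k.1 k.2.+1.
  by rewrite E => xE; apply/sedge_endsP.
(* Edges of [G_r] are the segments with [D = 1], so the sum defining [Wmat] has a single term. *)
have := @block_ends_inj 1 g.1 k.1 g.2 k.2 isT; rewrite !muln1 /touches !addn1.
case=> //.
- by apply: tch; apply/sedge_endsP; left.
- by apply: tch; apply/sedge_endsP; right.
by case: g k {E tch} => g1 g2 [f1 f2] /= -> /val_inj ->.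
Qed.

Lemma Wmat_inner w e t b : (0 < t < N)%N -> b != pos e t -> Wmat src tgt w (pos e t) b != 0 ->
  b = pos e t.-1 \/ b = pos e t.+1.
Proof.
move=> tN bt /Wmat_neq0[k E].
have /sedge_endsP : pos e t \in sedge_ends src tgt k by rewrite -E !inE eqxx.
have /sedge_endsP : b \in sedge_ends src tgt k by rewrite -E !inE eqxx orbT.
move=> bE [] /(pos_inner_inj tN)[ef tf]; rewrite -ef -tf in bE *.
  by case: bE => bE; [rewrite bE eqxx in bt|right].
by case: bE => bE; [left; rewrite tf|rewrite bE tf eqxx in bt].
Qed.

Lemma Wmat_far w e j t : (1 < N)%N -> (j <= N)%N -> (t <= N)%N -> (j.+1 < t)%N ->
  Wmat src tgt w (pos e j) (pos e t) = 0.
Proof.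
move=> N1 jN tN jt; apply/eqP; apply: contraT => W0.
have jt' : pos e t != pos e j by apply/eqP => /pos_inj E; have := E tN jN; lia.
have [ji|ji] := boolP (0 < j < N)%N.
  by case: (Wmat_inner ji jt' W0) => /pos_inj E; have := E ltac:(lia) ltac:(lia); lia.
have [ti|ti] := boolP (0 < t < N)%N.
  rewrite eq_sym in jt'; rewrite Wmat_sym in W0.
  by case: (Wmat_inner ti jt' W0) => /pos_inj E; have := E ltac:(lia) ltac:(lia); lia.
case/Wmat_neq0: W0 => k E.
(* Both vertices are original ones here, whereas every edge of a proper subdivision has an inner
   end. *)
have [j0 tE] : j = 0%N /\ t = N by lia.
have fN := ltn_ord k.2.
have [fi|fi] := boolP (0 < k.2 < N)%N.
  have : pos k.1 k.2 \in pair2 (pos e j) (pos e t) by rewrite E; apply/sedge_endsP; left.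
  by rewrite !inE => /orP[] /eqP /(pos_inner_inj fi)[_]; lia.
have : pos k.1 k.2.+1 \in pair2 (pos e j) (pos e t) by rewrite E; apply/sedge_endsP; right.
by rewrite !inE => /orP[] /eqP /pos_inner_inj[|_]; lia.
Qed.

End Subdivision.

Lemma uniq_blockV (T : finType) (v : nat -> T) N n k :
  (forall a c, (a <= N)%N -> (c <= N)%N -> v a = v c -> a = c) ->
  (k + 2 ^ n <= N)%N -> uniq (blockV v n k).
Proof.
move=> vinj; elim: n k => [//|n IH] k kN /=; rewrite expnS in kN.
have p0 : (0 < 2 ^ n)%N by rewrite expn_gt0.
rewrite cat_uniq cats1 rcons_uniq !IH ?andbT /=; [|lia|lia].
apply/andP; split.
  apply/hasPn => x; rewrite mem_rcons inE => /predU1P[->|/mem_blockV[a ak ->]].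
    by apply/negP => /mem_blockV[c ck] /vinj E; have := E ltac:(lia) ltac:(lia); lia.
  by apply/negP => /mem_blockV[c ck] /vinj E; have := E ltac:(lia) ltac:(lia); lia.
by apply/negP => /mem_blockV[c ck] /vinj E; have := E ltac:(lia) ltac:(lia); lia.
Qed.

(** * Elimination of all vertices outside the level-l skeleton *)

Section SubdivisionElimination.
Context (R : realType) (V Ed : finType) (src tgt : Ed -> V).
Hypothesis HG : simple_connected_graph src tgt.
Variables (l r : nat).
Hypothesis Hlr : (l <= r)%N.
Local Notation T := (svert V Ed r).
Local Notation N := (2 ^ r)%N.
Local Notation D := (2 ^ (r - l))%N.
Local Notation pos := (pos src tgt r).
Implicit Types (e f : Ed) (j t : nat) (w : sedge Ed r -> R) (h : R -> \bar R).

Let N0 : (0 < N)%N. Proof. by rewrite expn_gt0. Qed.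
Let D0 : (0 < D)%N. Proof. by rewrite expn_gt0. Qed.
Let lD : (2 ^ l * D = N)%N. Proof. by rewrite -expnD subnKC. Qed.

Definition skeleton : {set T} :=
  imset (sembed src tgt r (m:=l)) (mem (finset.setT : {set svert V Ed l})).

Lemma sembed_pos e q : (q <= 2 ^ l)%N -> sembed src tgt r (Defs.pos src tgt l e q) = pos e (q * D).
Proof.
case: q => [|q] ql; first by rewrite mul0n.
have [ql'|ql'] := ltnP q (2 ^ l).-1; first by rewrite (pos_inner _ _ _ ql').
have qE : q.+1 = (2 ^ l)%N by lia.
by rewrite pos_last ?qE// lD pos_last.
Qed.

Lemma mem_skeleton e j : (j <= N)%N -> (pos e j \in skeleton) = (D %| j)%N.
Proof.
move=> jN; have skl u : inl u \in skeleton by apply/imsetP; exists (inl u).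
have [->|j0] := eqVneq j 0%N; first by rewrite dvdn0 pos_first skl.
have [->|jN'] := eqVneq j N; first by rewrite pos_last// skl -lD dvdn_mull.
have ji : (0 < j < N)%N by lia.
apply/imsetP/idP => [[[u|[f q]] _ E]|/dvdnP[q qE]].
- move: ji E; case: j {jN j0 jN'} => // j jN.
  have jN' : (j < N.-1)%N by lia.
  by rewrite (pos_inner _ _ _ jN').
- by case: (pos_inner_inj ji E) => _ ->; rewrite dvdn_mull.
have q0 : (0 < q)%N by case: (q) qE => // qE; move: ji; rewrite qE mul0n.
have ql : (q < 2 ^ l)%N by rewrite -(ltn_pmul2r D0) lD -qE; lia.
case: q q0 qE ql => // q _ qE ql.
have ql' : (q < (2 ^ l).-1)%N by lia.
by exists (inr (e, Ordinal ql')); rewrite ?inE //= qE.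
Qed.

Lemma not_skeletonP x : reflect (exists e j, [/\ (0 < j < N)%N, ~~ (D %| j)%N & x = pos e j])
  (x \in ~: skeleton).
Proof.
rewrite inE; apply: (iffP idP) => [|[e [j [jN jD ->]]]]; last by rewrite mem_skeleton//; lia.
case: x => [u|[e [t tN]]].
  by case/imsetP; exists (inl u).
move=> xs; exists e, t.+1; rewrite (pos_inner _ _ _ tN); split=> //; first by lia.
by rewrite -(@mem_skeleton e)// ?(pos_inner _ _ _ tN)//; lia.
Qed.

Variable ebar : sedge Ed l.
Local Notation e0 := ebar.1.
Local Notation k0 := (ebar.2 * D)%N.

Definition block : seq T := blockV (pos e0) (r - l) k0.
Definition others : seq T := [seq x <- enum (~: skeleton) | x \notin block].

Let kN : (k0 + D <= N)%N.
Proof. by rewrite addnC -mulSn -lD leq_pmul2r// ltn_ord. Qed.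

Let block_skel x : x \in block -> x \in ~: skeleton.
Proof.
case/mem_blockV => a ak ->; apply/not_skeletonP; exists e0, a; split=> //; first by lia.
apply/negP => /dvdnP[q qE]; move: ak; rewrite qE addnC -mulSn !ltn_pmul2r//; lia.
Qed.

Lemma perm_block_others : perm_eq (block ++ others) (enum (~: skeleton)).
Proof.
apply: uniq_perm.
- rewrite cat_uniq (uniq_blockV (N := N))//; last exact: pos_inj.
  rewrite filter_uniq ?enum_uniq// andbT.
  by apply/hasPn => x; rewrite mem_filter => /andP[].
- exact: enum_uniq.
move=> x; rewrite mem_cat mem_filter mem_enum.
by have [/block_skel ->|] := boolP (x \in block).
Qed.

Lemma perm_all : perm_eq ((block ++ others) ++ enum skeleton) (enum T).
Proof.
apply: uniq_perm; last 2 first.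
- exact: enum_uniq.
- move=> x; rewrite mem_cat (perm_mem perm_block_others) !mem_enum finset.in_setC.
  by rewrite orbC orbN.
rewrite cat_uniq (perm_uniq perm_block_others) !enum_uniq andbT /=.
by apply/hasPn => x; rewrite (perm_mem perm_block_others) !mem_enum finset.in_setC negbK.
Qed.

(** Total on natural numbers, as [dyadic] requires; indices from [2 ^ r] on fall back to 0 and are
    never read inside the block. *)
Definition block_edge t : sedge Ed r := (e0, insubd (Ordinal N0) t).

(** [El_block] collapses the block, and [El_labels] shows that the other interiors leave the new
    weight alone: an interior adjacent to both ends would belong to a level-l edge with the ends of
    [ebar], hence to [ebar] itself. *)
Lemma El_subdivision w h : (forall k, 0 <= w k) -> (forall x, 0 <= h x)%E ->
  El (block ++ others) (enum skeleton) (fun W => h (W (pos e0 k0) (pos e0 (k0 + D)))) (Wmat src tgt w)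
  = dyadic (r - l) (w \o block_edge) k0 h.
Proof.
move=> w0 h0; set W := Wmat src tgt w.
have symW : symS W by move=> a b; exact: Wmat_sym.
have nnWW : nnW W by move=> a b; exact: Wmat_ge0.
have pinj := pos_inj HG (r := r) (e := e0).
have us : uniq (block ++ (others ++ enum skeleton)).
  by rewrite catA (perm_uniq perm_all) enum_uniq.
have inskel e j : (j <= N)%N -> (D %| j)%N -> pos e j \in enum skeleton.
  by move=> jN jD; rewrite mem_enum mem_skeleton.
have Dk : (D %| k0)%N by rewrite dvdn_mull.
have DkD : (D %| k0 + D)%N by rewrite dvdn_addr.
have inq x : x \in enum skeleton -> x \in others ++ enum skeleton by rewrite mem_cat orbC => ->.
rewrite El_cat; apply: (@El_block _ _ _ N) => //.
- by apply: inq; apply: inskel => //; lia.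
- by apply: inq; apply: inskel.
- move=> a ak; rewrite /= /block_edge.
  have aN : (a < N)%N by lia.
  rewrite -(Wmat_edge HG w (e0, insubd (Ordinal N0) a)) /=.
  by rewrite insubdK.
- move=> a x ak _ xa xa1 xa2; apply/eqP; apply: contraT => W0.
  have aN : (0 < a < N)%N by lia.
  by case: (Wmat_inner aN xa W0) => E; [rewrite E eqxx in xa1|rewrite E eqxx in xa2].
- move=> n0; have D1 : (1 < D)%N by rewrite -{1}(expn0 2) ltn_exp2l.
  by apply: Wmat_far => //; lia.
move=> W' u symW' nnW' W'u W'W.
(* The label of an inner vertex records the level-l edge containing it: the original edge and the
   segment index [j %/ D]. *)
pose lab (x : T) := if x is inr (e, t) then Some (e, t.+1 %/ D)%N else None.
have labE e j : (0 < j < N)%N -> lab (pos e j) = Some (e, j %/ D)%N.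
  case: j => // j jN; have jN' : (j < N.-1)%N by lia.
  by rewrite (pos_inner _ _ _ jN').
have othersP x : x \in others -> exists e j, [/\ (0 < j < N)%N, ~~ (D %| j)%N, x = pos e j,
    lab x = Some (e, j %/ D)%N & (e, j %/ D)%N <> (e0, nat_of_ord ebar.2)].
  rewrite mem_filter mem_enum => /andP[xb /not_skeletonP[e [j [jN jD xE]]]].
  exists e, j; split=> //; first by rewrite xE labE.
  move=> [ee0 jk]; move/negP: xb; apply; apply/mem_blockV; exists j; last by rewrite xE ee0.
  have := divn_eq j D; rewrite jk; have := ltn_pmod j D0.
  have : (0 < j %% D)%N by rewrite lt0n.
  move=> m0 mD ->; rewrite -{1}(addn0 (ebar.2 * D)%N).
  by rewrite ltn_add2l m0 ltn_add2l.
have notpair a c : a \in others -> ~~ is_pair (pos e0 k0) (pos e0 (k0 + D)) a c /\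
    ~~ is_pair (pos e0 k0) (pos e0 (k0 + D)) c a.
  have nsk j : (j <= N)%N -> (D %| j)%N -> a \in others -> a != pos e0 j.
    move=> jN jD /othersP[e [t [tN tD -> _ _]]]; apply: contraNneq tD.
    by move=> /(pos_inner_inj tN)[_ ->].
  move=> ao; have := nsk _ kN DkD ao; have := nsk k0 ltac:(lia) Dk ao.
  by rewrite /is_pair => /negPf -> /negPf ->; rewrite !andbF.
have oq a : a \in others -> a \in others ++ enum skeleton by rewrite mem_cat => ->.
rewrite -W'u; apply: (El_labels (lab := lab)) => //.
- move=> a c ao co lac; have ac : a != c by apply: contraNneq lac => ->.
  rewrite W'W ?oq//; last by case: (notpair a c ao).
  apply/eqP; apply: contraT => W0.
  have [e [j [jN jD aE la _]]] := othersP a ao; have [f [t [tN tD cE lc _]]] := othersP c co.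
  rewrite la lc aE cE in W0 ac lac *.
  rewrite eq_sym in ac; exfalso; move/eqP: lac; apply; congr (Some _).
  case: (Wmat_inner jN ac W0) => /(pos_inner_inj tN)[ef tj]; rewrite ef tj in tD *.
    case: (j) jN jD => // j' _ jD; by rewrite divnS// (negPf jD).
  by rewrite divnS// (negPf tD).
(* A neighbour of a level-l vertex in the interior of a segment makes that vertex an end of the
   segment. *)
have near e1 j1 a : (j1 <= N)%N -> (D %| j1)%N -> a \in others -> W (pos e1 j1) a != 0 ->
    exists e m, [/\ lab a = Some (e, m), (m.+1 * D <= N)%N, (e, m) <> (e0, nat_of_ord ebar.2) &
      touches src tgt r e1 j1 e (m * D) D].
  move=> j1N j1D ao W0; have [e [j [jN jD aE la ne]]] := othersP a ao.
  exists e, (j %/ D)%N; split=> //.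
    by rewrite -lD leq_pmul2r// ltn_divLR// lD; lia.
  have sk j2 : (j2 <= N)%N -> pos e1 j1 = pos e j2 -> (D %| j2)%N.
    by move=> j2N E; rewrite -(mem_skeleton e)// -E mem_skeleton.
  rewrite aE symW in W0.
  have ne1 : pos e1 j1 != pos e j.
    by apply: contraNneq jD => /sk; apply; lia.
  case: (Wmat_inner jN ne1 W0) => E.
    left; rewrite E; congr (pos e _); have := sk j.-1 ltac:(lia) E.
    case: (j) jN jD => // j' _ jD /= jD'; rewrite divnS// (negPf jD) add0n.
    by rewrite divnK.
  right; rewrite E; congr (pos e _); have {}E := sk j.+1 ltac:(lia) E.
  by rewrite -{1}(divnK E) divnS// E mulnDl mul1n addnC.
move=> k.
(* Either no vertex labelled [k] sees the first end, or one does; in the latter case a vertex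
   labelled [k] seeing the second end would identify its segment with that of [ebar]. *)
have [/'forall_implyP Fa|] := boolP [forall a : T, (a \in others) && (lab a == k) ==> (W' (pos e0 k0) a == 0)].
  by left => a ao ak; apply/eqP/Fa; rewrite ao ak eqxx.
rewrite negb_forall => /existsP[a]; rewrite negb_imply => /andP[/andP[ao /eqP ak] Wa].
right => c co ck; apply/eqP; apply: contraT => Wc.
have ni x j1 : x \in others -> (j1 <= N)%N -> (D %| j1)%N -> pos e0 j1 != x.
  move=> /othersP[e [t [tN tD -> _ _]]] j1N j1D; apply: contraNneq tD.
  by move=> /esym /(pos_inner_inj tN)[_ ->].
have k0N : (k0 <= N)%N by lia.
have iq : pos e0 k0 \in others ++ enum skeleton by apply: inq; apply: inskel => //; lia.
have jq : pos e0 (k0 + D) \in others ++ enum skeleton by apply: inq; exact: inskel.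
rewrite (W'W _ _ iq (oq _ ao) (ni _ _ ao k0N Dk) (proj2 (notpair a _ ao))) in Wa.
rewrite (W'W _ _ (oq _ co) jq) in Wc; last 2 first.
- by rewrite eq_sym; exact: ni.
- by case: (notpair c (pos e0 (k0 + D)) co).
rewrite symW in Wc.
have [e [m [la mN ne ta]]] := near _ _ _ k0N Dk ao Wa.
have [f [p [lc pN nf tc]]] := near _ _ _ kN DkD co Wc.
move: lc tc; rewrite ck -ak la => -[<- <-] tc; case: ne.
have E : (k0 + D = ebar.2.+1 * D)%N by rewrite mulSn addnC.
have kN' := kN; rewrite E in tc kN'.
by have [-> ->] := block_ends_inj HG D0 kN' mN ta tc.
Qed.

End SubdivisionElimination.

(** * The law of the effective weight *)

Section EffectiveWeightLaw.
Local Open Scope classical_set_scope.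
Context (R : realType) (V Ed : finType) (src tgt : Ed -> V).
Hypothesis HG : simple_connected_graph src tgt.
Variables (mu : probability R R) (l r : nat).
Hypothesis mu_pos : mu `]0, +oo[ = 1%E.
Hypothesis Hlr : (l <= r)%N.
Variable ebar : sedge Ed l.
Local Notation T := (svert V Ed r).
Local Notation leb := (@lebesgue_measure R).
Local Notation D := (2 ^ (r - l))%N.
Local Notation vi := (pos src tgt r ebar.1 (ebar.2 * D)).
Local Notation vj := (pos src tgt r ebar.1 (ebar.2 * D + D)).
Local Notation s1 := (block src tgt r ebar ++ others src tgt r ebar).
Local Notation s2 := (enum (skeleton src tgt l r)).
Implicit Types (w : sedge Ed r -> R) (b : T -> R) (h : R -> \bar R).

(** Where the density vanishes both sides are 0; elsewhere [H] is positive definite and all pivots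
    are positive, so the inverse matrix can be replaced by elimination. *)
Lemma nu_density_effW w b h :
  (nu_density (Wmat src tgt w) b * h (effW src tgt w b ebar) =
   (densW (s1 ++ s2) (Wmat src tgt w) b)%:E * h (elimW s1 (Wmat src tgt w) b vi vj))%E.
Proof.
have sW : symS (Wmat src tgt w) by move=> x y; exact: Wmat_sym.
have nuE := nu_density_densW b sW (perm_all HG Hlr ebar).
rewrite nuE; have [->|d0] := eqVneq (densW (s1 ++ s2) (Wmat src tgt w) b) 0; first by rewrite !mul0e.
congr (_ * h _)%E; rewrite /effW -/(skeleton src tgt l r).
rewrite !sembed_pos ?ltn_ord//; last by rewrite ltnW.
rewrite mulSn addnC; apply: effective_elimW => //.
- move: nuE; rewrite /nu_density; case: asboolP => // _ [E].
  by rewrite -E eqxx in d0.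
- exact: perm_block_others.
- exact: densW_pivots d0.
Qed.

Lemma measurable_Wmat d (Z : measurableType d) (g : Z -> sedge Ed r -> R) x y :
  (forall k, measurable_fun setT (fun z => g z k)) ->
  measurable_fun setT (fun z => Wmat src tgt (g z) x y).
Proof.
move=> mg; rewrite /Wmat.
under eq_fun do rewrite big_mkcond /=.
apply: measurable_sum => k. by case: (pair2 x y == sedge_ends src tgt k).
Qed.

Theorem Epos_effW h : measurable_fun setT h -> (forall x, 0 <= h x)%E ->
  Epos src tgt mu (fun w b => h (effW src tgt w b ebar)) = level mu (r - l) h.
Proof.
move=> mh h0; rewrite /Epos.
pose G w b := ((densW (s1 ++ s2) (Wmat src tgt w) b)%:E * h (elimW s1 (Wmat src tgt w) b vi vj))%E.
have G0 w b : (0 <= G w b)%E by rewrite mule_ge0// lee_fin densW_ge0.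
have mG (d : measure_display) (Z : measurableType d) (g : Z -> sedge Ed r -> R) (x : Z -> T -> R) :
    (forall k, measurable_fun setT (fun z => g z k)) ->
    (forall i, measurable_fun setT (fun z => x z i)) -> measurable_fun setT (fun z => G (g z) (x z)).
  move=> mg mx; have mW a c := measurable_Wmat a c mg.
  apply: emeasurable_funM; first by apply/measurable_EFinP; exact: measurable_densW.
  by apply: (measurableT_comp mh); exact: measurable_elimW.
pose F w := iint leb (enum T) (G w) (fun=> 0).
have F0 w : (0 <= F w)%E by exact: iint_ge0.
have mF : mfun F.
  move=> d Z g mg.
  have := @measurable_iint R _ _ T leb _ Z (enum T) (fun z => G (g z)) _ _ _ Z id (fun=> (fun=> 0)).
  apply => //.
  by move=> d' D' g' x mg' mx; apply: (mG _ _ (fun z => g (g' z))) => // k; exact: (measurableT_comp (mg k)).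
pose c := block_edge r ebar.
pose F2 w := dyadic (r - l) (w \o c) (ebar.2 * D)%N h.
transitivity (iint mu (enum (sedge Ed r)) F (fun=> 0)).
  congr (iint _ _ _ _); apply/funext => w; congr (iint _ _ _ _); apply/funext => b.
  exact: nu_density_effW.
have F20 w : (0 <= F2 w)%E by exact: dyadic_ge0.
have mF2 : mfun F2.
  move=> d Z g mg; apply: (@measurable_dyadic _ _ _ _ (fun z => g z \o c) _ (fun=> h)) => //.
    by move=> a; exact: mg.
  exact: (measurableT_comp mh).
(* By [mu_pos] only positive weights count. For these the integral over beta, taken in the order
   block, other interiors, skeleton, is the dyadic reduction of the block. *)
transitivity (iint mu (enum (sedge Ed r)) F2 (fun=> 0)).
  apply: (@ae_eq_iint R _ _ _ mu `]0, +oo[%classic) => // w wpos _.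
  have w0 k : 0 <= w k.
    by have := wpos k; rewrite mem_enum => /(_ isT) /=; rewrite in_itv/= andbT => /ltW.
  have ps : perm_eq (enum T) (s1 ++ s2) by rewrite perm_sym; exact: perm_all.
  rewrite /F (@perm_iint R _ _ T leb _ (s1 ++ s2) (G w))//; last first.
    by move=> d Z x mx; apply: (mG _ _ (fun=> w)).
  have us : uniq (s1 ++ s2) by rewrite (perm_uniq (perm_all HG Hlr ebar)) enum_uniq.
  have nW : nnW (Wmat src tgt w) by move=> x y; exact: Wmat_ge0.
  have mC : mfunW (fun W : T -> T -> R => h (W vi vj)).
    by move=> d Z Wz mW; exact: (measurableT_comp mh).
  rewrite (iint_densW _ us nW _ mC)//.
  exact: El_subdivision.
have kN : (ebar.2 * D + D <= 2 ^ r)%N.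
  have -> : (2 ^ r = 2 ^ l * D)%N by rewrite -expnD subnKC.
  by rewrite addnC -mulSn leq_pmul2r ?expn_gt0// ltn_ord.
pose cs := [seq c a | a <- iota (ebar.2 * D) D].
have cinj : {in [pred a | (ebar.2 * D <= a < ebar.2 * D + D)%N] &, injective c}.
  move=> a a'; rewrite !inE => aN aN' [/(congr1 val)]; rewrite !val_insubd.
  by rewrite !ifT//; lia.
have csu : uniq cs.
  by rewrite map_inj_in_uniq ?iota_uniq// => a a'; rewrite !mem_iota; exact: cinj.
(* The edges of the block are integrated innermost; they already give the constant
   [level mu (r - l) h], which the remaining probability integrals preserve. *)
have ps : perm_eq (enum (sedge Ed r)) ([seq k <- enum (sedge Ed r) | k \notin cs] ++ cs).
  apply: uniq_perm; first exact: enum_uniq.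
    rewrite cat_uniq filter_uniq ?enum_uniq// csu andbT /=.
    by apply/hasPn => k kc; rewrite mem_filter kc.
  by move=> k; rewrite mem_cat mem_filter mem_enum inE andbT orNb.
rewrite (perm_iint mu _ F20 mF2 ps) iint_cat.
rewrite (_ : iint mu cs F2 = fun=> level mu (r - l) h); first by rewrite iint_cst.
apply/funext => x; apply: iint_dyadic => //.
Qed.

End EffectiveWeightLaw.

Section EdgeWeightLaw.
Local Open Scope classical_set_scope.
Context (R : realType) (V Ed : finType) (src tgt : Ed -> V).
Hypothesis HG : simple_connected_graph src tgt.
Variables (mu : probability R R) (r : nat).
Hypothesis mu_pos : mu `]0, +oo[ = 1%E.

Lemma effW_id (w : sedge Ed r -> R) b (e : sedge Ed r) : effW src tgt w b e = w e.
Proof.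
rewrite /effW /effective -/(skeleton src tgt r r) !sembed_pos ?ltn_ord//; last by rewrite ltnW.
rewrite subnn !muln1 Wmat_edge// big1 ?addr0// => a _.
have /(not_skeletonP src tgt (leqnn r)) := enum_valP a.
by rewrite subnn => -[f [j [_]]]; rewrite dvd1n.
Qed.

(** The case [l = r] of the law of the effective weight, where nothing is eliminated; beta
    integrates to mass 1. *)
Lemma Epos_edge (e : sedge Ed r) (h : R -> \bar R) : measurable_fun setT h -> (forall x, 0 <= h x)%E ->
  Epos src tgt mu (fun w b => h (w e)) = (\int[mu]_x h x)%E.
Proof.
move=> mh h0; have := Epos_effW HG mu_pos (leqnn r) e mh h0.
rewrite subnn /= => <-; congr Epos; apply/funext => w; apply/funext => b.
by rewrite effW_id.
Qed.

End EdgeWeightLaw.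

(** * Minimizers *)

Section Minimizer.
Context (R : realType) (l r : nat) (s : R).

(* The exponent of 2 in both bounds, up to a monotone transformation; its
   increment at [m] is 2^(m-l) (s - r + m + 2), which changes sign at
   [m = r - 2 - floor s]. *)
Let g (m : nat) : R := (2 ^ (m - l))%:R * (s - (r - m)%:R).

Let gS m : (l <= m < r)%N -> g m.+1 - g m = (2 ^ (m - l))%:R * (s - r%:R + m%:R + 2).
Proof.
move=> /andP[lm mr]; rewrite /g subSn// expnS natrM !natrB; [|lia..].
by rewrite -addn1 natrD; ring.
Qed.

Let m0 : int := r%:Z - 2 - Num.floor s.

Let m0E : m0%:~R = r%:R - 2 - (Num.floor s)%:~R :> R.
Proof. by rewrite /m0 !rmorphB. Qed.

Let g_up m m' : (l <= m)%N -> (m <= m' <= r)%N -> m0 <= m%:Z -> g m <= g m'.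
Proof.
move=> lm /andP[mm' m'r] m0m; elim: m' mm' m'r => [|m' IH].
  by rewrite leqn0 => /eqP -> _.
rewrite leq_eqVlt => /predU1P[->//|mm'] m'r.
apply: le_trans (IH _ _) _ => //; first exact: ltnW.
rewrite -subr_ge0 gS ?m'r ?(leq_trans lm)//.
apply: mulr_ge0 => //.
have : m0%:~R <= m'%:R :> R by rewrite -[m'%:R]/((m'%:Z)%:~R : R) ler_int; lia.
by rewrite m0E; have := Num.Theory.floor_le s; lra.
Qed.

Let g_down m m' : (l <= m)%N -> (m <= m' <= r)%N -> m'%:Z <= m0 -> g m' <= g m.
Proof.
move=> lm /andP[mm' m'r]; elim: m' mm' m'r => [|m' IH].
  by rewrite leqn0 => /eqP ->.
rewrite leq_eqVlt => /predU1P[->//|mm'] m'r m'm0.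
apply: le_trans _ (IH _ _ _) => //; [|exact: ltnW|by lia].
rewrite -subr_le0 gS ?m'r ?(leq_trans lm)//.
apply: mulr_ge0_le0 => //.
have : m'.+1%:R <= m0%:~R :> R by rewrite -[m'.+1%:R]/((m'.+1%:Z)%:~R : R) ler_int; lia.
by rewrite m0E -natr1; have := floorD1_gt s; rewrite rmorphD /=; lra.
Qed.

Lemma minimizer (X : nat -> \bar R) : (l <= r)%N ->
  (forall m m', (l <= m <= r)%N -> (l <= m' <= r)%N ->
    (2 ^ (m - l))%:R * (s - (r - m)%:R) <= (2 ^ (m' - l))%:R * (s - (r - m')%:R) ->
    (X m <= X m')%E) ->
  [/\ l%:Z <= m0 <= r%:Z -> forall m : nat, (l <= m <= r)%N -> (X `|m0|%N <= X m)%E,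
      m0 < l%:Z -> forall m : nat, (l <= m <= r)%N -> (X l <= X m)%E &
      r%:Z < m0 -> forall m : nat, (l <= m <= r)%N -> (X r <= X m)%E].
Proof.
move=> lr gX; split=> [/andP[lm mr] m lmr|m0l m lmr|rm0 m lmr]; apply: gX => //; try lia.
- have [n nE] : exists n : nat, m0 = n%:Z by exists `|m0|%N; lia.
  rewrite nE absz_nat; have [mn|nm] := leqP m n.
    by apply: g_down; lia.
  by apply: g_up; lia.
- by apply: g_up; lia.
- by apply: g_down; lia.
Qed.

End Minimizer.

Theorem theorem1p6 (R : realType) (V Ed : finType) (src tgt : Ed -> V)
  (HG : simple_connected_graph src tgt)
  (l r : nat) (Hlr : (l <= r)%N)
  (mu : probability R R) (Hmu : mu `]0, +oo[%classic = 1%E)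
  (ebar : sedge Ed l) (e' : sedge Ed r) :
  let EW (a : R) := Epos src tgt mu (fun w b => (w e' `^ a)%:E) in
  let EWl (a : R) := Epos src tgt mu (fun w b => (effW src tgt (m:=l) (r:=r) w b ebar `^ a)%:E) in
  let ElogW := Ereal src tgt mu (fun w b => ln (w e')) in
  let ElogWl := Ereal src tgt mu (fun w b => ln (effW src tgt (m:=l) (r:=r) w b ebar)) in
  let X2 (a : R) (m : nat) : \bar R :=
    (((C_alpha a)^-1)%:E * ((C_alpha a * (2 `^ (- a)) ^+ (r - m))%:E * EW a) ^+ (2 ^ (m - l)))%E in
  let X3 (m : nat) : \bar R :=
    (((2 ^ (m - l))%:R)%:E * (ElogW + ((r - m)%:R * - ln 2 + c2 R)%:E) - (c2 R)%:E)%E in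
  let m0 (a : R) : int :=
    r%:Z - 2 - Num.floor (a^-1 * (ln (C_alpha a * fine (EW a)) / ln 2)) in
  let m1 : int := r%:Z - 2 - Num.floor ((ln 2)^-1 * (fine ElogW + c2 R)) in
  [/\ (forall a : R, 0 <= a <= 1 -> (EWl a <= (2 `^ (- a) ^+ (r - l))%:E * EW a)%E),
      (forall a : R, 0 <= a < 1/2 -> forall m : nat, (l <= m <= r)%N -> (EWl a <= X2 a m)%E),
      (forall m : nat, (l <= m <= r)%N -> (ElogWl <= X3 m)%E),
      (forall a : R, 0 <= a < 1/2 -> EW a \is a fin_num ->
         [/\ l%:Z <= m0 a <= r%:Z ->
               forall m : nat, (l <= m <= r)%N -> (X2 a `|m0 a|%N <= X2 a m)%E,
             m0 a < l%:Z -> forall m : nat, (l <= m <= r)%N -> (X2 a l <= X2 a m)%E &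
             r%:Z < m0 a -> forall m : nat, (l <= m <= r)%N -> (X2 a r <= X2 a m)%E]) &
      (ElogW \is a fin_num ->
         [/\ l%:Z <= m1 <= r%:Z ->
               forall m : nat, (l <= m <= r)%N -> (X3 `|m1|%N <= X3 m)%E,
             m1 < l%:Z -> forall m : nat, (l <= m <= r)%N -> (X3 l <= X3 m)%E &
             r%:Z < m1 -> forall m : nat, (l <= m <= r)%N -> (X3 r <= X3 m)%E])].
Proof.
move=> EW EWl ElogW ElogWl X2 X3 m0 m1.
have mpow a : measurable_fun setT (fun x : R => (x `^ a)%:E).
  by apply/measurable_EFinP; exact: measurable_powR.
have pow0 a (x : R) : (0 <= (x `^ a)%:E)%E by rewrite lee_fin powR_ge0.
have mlp : measurable_fun setT (fun x : R => (lnp x)%:E).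
  by apply/measurable_EFinP; exact: measurable_lnp.
have mlm : measurable_fun setT (fun x : R => (lnm x)%:E).
  by apply/measurable_EFinP; exact: measurable_lnm.
have lp0 (x : R) : (0 <= (lnp x)%:E)%E by rewrite lee_fin lnp_ge0.
have lm0 (x : R) : (0 <= (lnm x)%:E)%E by rewrite lee_fin lnm_ge0.
have EWE a : EW a = level mu 0 (fun x : R => (x `^ a)%:E).
  exact: (Epos_edge HG Hmu e' (mpow a) (pow0 a)).
have EWlE a : EWl a = level mu (r - l) (fun x : R => (x `^ a)%:E).
  exact: (Epos_effW HG Hmu Hlr ebar (mpow a) (pow0 a)).
have ElogWE : ElogW = (level mu 0 (fun x : R => (lnp x)%:E) - level mu 0 (fun x : R => (lnm x)%:E))%E.
  rewrite /ElogW /Ereal; congr (_ - _)%E.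
    exact: (Epos_edge HG Hmu e' mlp lp0).
  exact: (Epos_edge HG Hmu e' mlm lm0).
have ElogWlE : ElogWl = (level mu (r - l) (fun x : R => (lnp x)%:E) -
    level mu (r - l) (fun x : R => (lnm x)%:E))%E.
  rewrite /ElogWl /Ereal; congr (_ - _)%E.
    exact: (Epos_effW HG Hmu Hlr ebar mlp lp0).
  exact: (Epos_effW HG Hmu Hlr ebar mlm lm0).
have rlE m : (l <= m <= r)%N -> (r - l = (r - m) + (m - l))%N by lia.
have ln2 : 0 < ln 2 :> R by rewrite ln_gt0// ltr1n.
split.
- by move=> a a01; rewrite EWlE EWE; exact: level_powR_le.
- by move=> a a01 m lmr; rewrite EWlE /X2 EWE (rlE m lmr); exact: level_powR_le_pow.
- by move=> m lmr; rewrite ElogWlE /X3 ElogWE (rlE m lmr); exact: level_ln_le.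
- move=> a a01 EWf; have C0 := C_alpha_gt0 a01.
  (* For [a = 0] the exponent in [m0] contains the inverse of 0, but all bounds equal 1 and every
     index is a minimizer. *)
  have [a0|a0] := eqVneq a 0.
    have EW0 : EW a = 1%E.
      rewrite EWE a0 /=; under eq_integral do rewrite powRr0.
      by rewrite integral_cst// mul1e; exact: probability_setT.
    have X2c m : X2 a m = 1%E.
      rewrite /X2 EW0 mule1 a0 C_alpha0 oppr0 powRr0 expr1n mul1r invr1 mul1e.
      by rewrite -EFin_expe expr1n.
    by split=> // *; rewrite !X2c.
  have {}a0 : 0 < a by rewrite lt_neqAle eq_sym a0; case/andP: a01.
  have EW0 : 0 < fine (EW a).
    rewrite fine_gt0//; move: EWf; rewrite ge0_fin_numE => [-> |]; last first.
      by rewrite EWE; exact: level_ge0.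
    rewrite andbT EWE /=.
    have posI : measurable (`]0, +oo[%classic : set R) by [].
    have mu0 : mu `]0, +oo[%classic != 0%E by rewrite Hmu gt_eqF// lte01.
    have : (0 < \int[mu]_(x in `]0%R, +oo[%classic) (x `^ a)%:E)%E.
      apply: integral_gt0 => //.
      - by apply: measurable_funTS; exact: measurable_powR.
      - by move=> x; rewrite /= in_itv/= andbT => x0; exact: powR_gt0.
    move/lt_le_trans; apply; apply: ge0_subset_integral => //.
  set A := fine (EW a) in EW0 m0 *.
  have EA : EW a = A%:E by rewrite fineK.
  apply: minimizer => // m m' lmr lmr' gmm'.
  rewrite /X2 EA -!EFinM -!EFin_expe -!EFinM lee_fin ler_pM2l ?invr_gt0//.
  (* The logarithm of the bound is [a ln 2], which is positive, times the function minimized in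
     [minimizer], with [s = log_2 (C_alpha E[W^a]) / a]. *)
  have YE n : (C_alpha a * 2 `^ (- a) ^+ (r - n) * A) ^+ (2 ^ (n - l)) =
      expR ((a * ln 2) * ((2 ^ (n - l))%:R * (a^-1 * (ln (C_alpha a * A) / ln 2) - (r - n)%:R))).
    have CA : C_alpha a * A = expR (ln (C_alpha a * A)) by rewrite lnK// posrE mulr_gt0.
    have pE : 2 `^ (- a) = expR (- a * ln 2) :> R by rewrite /powR pnatr_eq0.
    rewrite pE -expRM_natl mulrAC {1}CA -expRD -expRM_natl.
    by congr expR; field; rewrite !gt_eqF.
  by rewrite !YE ler_expR ler_pM2l// mulr_gt0.
- move=> Ef; apply: minimizer => // m m' lmr lmr' gmm'.
  rewrite /X3 -(fineK Ef) -!EFinD lee_fin lerD2r.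
  (* The same function, now with the factor [ln 2] and [s = (E[log W] + c2) / ln 2]. *)
  have YE n : (2 ^ (n - l))%:R * (fine ElogW + ((r - n)%:R * - ln 2 + c2 R)) =
      ln 2 * ((2 ^ (n - l))%:R * ((ln 2)^-1 * (fine ElogW + c2 R) - (r - n)%:R)).
    by field; rewrite gt_eqF.
  by rewrite !YE ler_pM2l.
Qed.
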